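(* The ring $R_{[n]}$ is generated over $\mathbb Z$ by the elements ${}_\lambda\mathbf 1_\mu$ (for comparable $\lambda,\mu\in\mathrm{Part}([n])$) and $w_*$ ($w\in\mathfrak S_n$). For any $\lambda,\nu\in\mathrm{Part}([n])$, a $\mathbb Z$-basis of ${}_\nu R_\lambda$ is given by the set of expressions $${}_\nu\mathbf 1_\mu\cdot{}_\mu\mathbf 1_{w\lambda}\cdot w_*,$$ where $w\in\mathfrak S_n$ runs over a set of representatives of double cosets $\mathfrak S_\nu\backslash\mathfrak S_n/\mathfrak S_\lambda$, and $\mu$ runs over a set of representatives of orbits of $\mathfrak S_{\nu\wedge w\lambda}$ acting on the interval $[(1^n),\nu\wedge w\lambda]$. Furthermore, a complete set of relations for $R_{[n]}$ in these generators is given by: (a) If $\lambda\le\mu\le\nu$ or $\nu\le\mu\le\lambda$, then ${}_\nu\mathbf 1_\mu\cdot{}_\mu\mathbf 1_\lambda={}_\nu\mathbf 1_\lambda$. The idempotents ${}_\lambda\mathbf 1_\lambda$ are orthogonal: if $\mu\neq\lambda$, then ${}_\lambda\mathbf 1_\lambda\cdot{}_\mu\mathbf 1_\mu=0$. (b) For any $w,z\in\mathfrak S_n$, $w_*\cdot z_*=(wz)_*$; and $e_*=\sum_\lambda{}_\lambda\mathbf 1_\lambda$ where $e\in\mathfrak S_n$ is the identity. (c) For any $w\in\mathfrak S_n$ and any $\mu,\nu\in\mathrm{Part}([n])$ with $\mu\le\nu$ or $\nu\le\mu$, $w_*\cdot{}_\nu\mathbf 1_\mu={}_{w\nu}\mathbf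 1_{w\mu}\cdot w_*$. If $w\in\mathfrak S_\nu$ then $w_*\cdot{}_\nu\mathbf 1_\mu={}_\nu\mathbf 1_\mu$, and if $w\in\mathfrak S_\mu$ then ${}_\nu\mathbf 1_\mu\cdot w_*={}_\nu\mathbf 1_\mu$. (d) If $\lambda,\mu\le\nu$, then $${}_\mu\mathbf 1_\nu\cdot{}_\nu\mathbf 1_\lambda=\sum_z{}_\mu\mathbf 1_{\mu\wedge z\lambda}\cdot z_*\cdot{}_{z^{-1}\mu\wedge\lambda}\mathbf 1_\lambda=\sum_z{}_\mu\mathbf 1_{\mu\wedge z\lambda}\cdot{}_{\mu\wedge z\lambda}\mathbf 1_{z\lambda}\cdot z_*,$$ where the sum is over a set of representatives $z$ of double cosets in $\mathfrak S_\mu\backslash\mathfrak S_\nu/\mathfrak S_\lambda$.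
   Context: Set partitions: $[n]=\{1,\dots,n\}$ and $\mathrm{Part}([n])$ is the set of set partitions of $[n]$, ordered by refinement ($\lambda\le\mu$ if every part of $\lambda$ is contained in a part of $\mu$); $\lambda\wedge\mu$ is the meet (parts are the nonempty intersections of parts). $(1^n)$ is the minimum, the partition into $n$ singletons. $\mathfrak S_\lambda\subset\mathfrak S_n$ is the subgroup of permutations preserving each part of $\lambda$. $\mathfrak S_n$ acts on $\mathrm{Part}([n])$, and $\mathfrak S_{w\lambda}=w\mathfrak S_\lambda w^{-1}$. The ring: $\mathrm{Sh}([\mathfrak S_\nu\backslash\mathfrak S_n/\mathfrak S_\mu])$ is the category whose objects are families of finite-dimensional complex vector spaces $F_x$, $x\in\mathfrak S_n$, with commuting left $\mathfrak S_\nu$- and right $\mathfrak S_\mu$-actions on $\bigoplus_xF_x$ such that $g\cdot F_x\subset F_{gx}$, $F_x\cdot h\subset F_{xh}$. For $A\in\mathrm{Sh}([\mathfrak S_\nu\backslash\mathfrak S_n/\mathfrak S_\mu])$ and $B\in\mathrm{Sh}([\mathfrak S_\mu\backslash\mathfrak S_n/\mathfrak S_\lambda])$, define $A\circ B\in\mathrm{Sh}([\mathfrak S_\nu\backslash\mathfrak S_n/\mathfrak S_\lambda])$ by $(A\circ B)_x=\big[\bigoplus_{yz=x}A_y\otimes_{\mathbb C}B_z\big]^{\mathfrak S_\mu}$, with $w\in\mathfrak S_\mu$ acting by $a\otimes b\mapsto(a\cdot w^{-1})\otimes(w\cdot b)$. Put ${}_\mu R_\lambda=K(\mathrm{Sh}([\mathfrak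 S_\mu\backslash\mathfrak S_n/\mathfrak S_\lambda]))$ (Grothendieck group) and $R_{[n]}=\bigoplus_{\lambda,\mu\in\mathrm{Part}([n])}{}_\mu R_\lambda$, a ring with product ${}_\nu R_\mu\times{}_\mu R_\lambda\to{}_\nu R_\lambda$ induced by $\circ$ (all other products of summands are zero). Elements: for $\mu\le\nu$ or $\nu\le\mu$, ${}_\nu\mathbf 1_\mu\in{}_\nu R_\mu$ is the class of the sheaf that is $\mathbb C$ on every element of the larger of the two groups $\mathfrak S_\nu,\mathfrak S_\mu$ and zero elsewhere, with left and right actions by identity maps. For $w\in\mathfrak S_n$, $w_*=\sum_{\lambda\in\mathrm{Part}([n])}[{}_{w\lambda}(w_* )_\lambda]$, where ${}_{w\lambda}(w_* )_\lambda\in\mathrm{Sh}([\mathfrak S_{w\lambda}\backslash\mathfrak S_n/\mathfrak S_\lambda])$ is the sheaf that is $\mathbb C$ on every element of the double coset $\mathfrak S_{w\lambda}w\mathfrak S_\lambda$ and zero elsewhere, with actions by identity maps. *)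

(* Defs.v *)
From HB Require Import structures.
From mathcomp Require Import all_boot all_order all_fingroup all_algebra.
From mathcomp Require Import boolp reals complex.
From mathcomp Require Import finmap monalg.

Set Implicit Arguments.
Unset Strict Implicit.
Unset Printing Implicit Defensive.

Import Order.TTheory GRing.Theory Num.Theory.
Local Open Scope ring_scope.

(* In MathComp [s * t] is "s, then t"; permutations are composed here as
   functions, so that ['S_n] acts on the left of ['I_n] and of its partitions. *)
Definition pcomp n (w z : 'S_n) : 'S_n := (z * w)%g.
Notation "w *c z" := (pcomp w z) (at level 40, left associativity).

Lemma pcompE n (w z : 'S_n) i : (w *c z) i = w (z i).
Proof. by rewrite permM. Qed.

Section Composition.
Variable n : nat.
Implicit Types w z g : 'S_n.

Lemma pcompA : associative (@pcomp n).
Proof. by move=> x y z; rewrite /pcomp mulgA. Qed.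
Lemma pcomp1 w : w *c 1%g = w. Proof. exact: mul1g. Qed.
Lemma p1comp w : 1%g *c w = w. Proof. exact: mulg1. Qed.
Lemma pcompV w : w *c w^-1%g = 1%g. Proof. exact: mulVg. Qed.
Lemma pVcomp w : w^-1%g *c w = 1%g. Proof. exact: mulgV. Qed.
Lemma pcompK w : cancel (pcomp w) (pcomp w^-1%g).
Proof. by move=> x; rewrite pcompA pVcomp p1comp. Qed.
Lemma pcompVK w : cancel (pcomp w^-1%g) (pcomp w).
Proof. by move=> x; rewrite pcompA pcompV p1comp. Qed.
Lemma pcompI w : injective (pcomp w). Proof. exact: can_inj (pcompK w). Qed.
Lemma pcompIr w : injective (fun x => x *c w).
Proof. by move=> x y /mulgI. Qed.
Lemma pinvM w z : ((w *c z)^-1)%g = z^-1%g *c w^-1%g.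
Proof. by rewrite /pcomp invMg. Qed.
End Composition.

Section SetPartitions.
Variable n : nat.

Record part := MkPart {
  blocks :> {set {set 'I_n}};
  partP : partition blocks [set: 'I_n] }.

HB.instance Definition _ := [isSub for blocks].
HB.instance Definition _ := [Finite of part by <:].

Implicit Types (la mu nu : part) (w : 'S_n).

Lemma part_of_pblock la (i : 'I_n) : pblock la i \in blocks la.
Proof.
by apply: pblock_mem; rewrite (cover_partition (partP la)) inE.
Qed.

Lemma part_ex la (i : 'I_n) : exists2 B, B \in blocks la & i \in B.
Proof.
exists (pblock la i); first exact: part_of_pblock.
by rewrite mem_pblock (cover_partition (partP la)) inE.
Qed.

Lemma part_eq la B C i :
  B \in blocks la -> C \in blocks la -> i \in B -> i \in C -> B = C.
Proof.
case/and3P: (partP la) => _ tI _ lB lC iB iC.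
by rewrite -(def_pblock tI lB iB) (def_pblock tI lC iC).
Qed.

Lemma part_neq0 la B : B \in blocks la -> B != set0.
Proof. by case/and3P: (partP la) => _ _ /negP h lB; apply/eqP=> B0; rewrite B0 in lB. Qed.

Lemma mk_partition (P : {set {set 'I_n}}) :
    (forall i, exists2 B, B \in P & i \in B) ->
    (forall B C i, B \in P -> C \in P -> i \in B -> i \in C -> B = C) ->
    set0 \notin P -> partition P [set: 'I_n].
Proof.
move=> Pc Pt P0; apply/and3P; split=> //.
  apply/eqP/setP=> i; rewrite inE; apply/bigcupP.
  by have [B] := Pc i; exists B.
apply/trivIsetP=> B C PB PC; apply: contraR.
rewrite -setI_eq0 => BC; move/set0Pn: BC => [j]; rewrite inE => /andP[iB iC].
by apply/eqP; apply: Pt iB iC.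
Qed.

Definition refines la mu := [forall B in blocks la, exists C in blocks mu, B \subset C].

Fact pbot_subproof :
  partition [set [set i] | i : 'I_n] [set: 'I_n].
Proof.
apply: mk_partition.
- by move=> i; exists [set i]; rewrite ?imset_f ?inE.
- by move=> B C i /imsetP[j _ ->] /imsetP[k _ ->] /set1P<- /set1P<-.
- apply/imsetP=> -[i _ /setP/(_ i)]; by rewrite !inE eqxx.
Qed.
Definition pbot := MkPart pbot_subproof.

Fact pmeet_subproof la mu :
  partition ([set B :&: C | B in blocks la, C in blocks mu] :\ set0) [set: 'I_n].
Proof.
apply: mk_partition; last by rewrite !inE eqxx.
- move=> i; have [B lB iB] := part_ex la i; have [C lC iC] := part_ex mu i.
  exists (B :&: C); last by rewrite inE iB.
  rewrite !inE imset2_f // andbT; apply/set0Pn; exists i; by rewrite inE iB.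
- move=> B C i; rewrite !inE => /andP[_ /imset2P[B1 B2 l1 l2 ->]].
  move=> /andP[_ /imset2P[C1 C2 m1 m2 ->]]; rewrite !inE.
  move=> /andP[iB1 iB2] /andP[iC1 iC2].
  by rewrite (part_eq l1 m1 iB1 iC1) (part_eq l2 m2 iB2 iC2).
Qed.
Definition pmeet la mu := MkPart (pmeet_subproof la mu).

Fact pact_subproof w la :
  partition [set w @: (B : {set 'I_n}) | B in blocks la] [set: 'I_n].
Proof.
apply: mk_partition.
- move=> i; have [B lB iB] := part_ex la (w^-1%g i).
  exists (w @: B); first exact: imset_f.
  by rewrite -(permKV w i) imset_f.
- move=> B C i /imsetP[B1 l1 ->] /imsetP[C1 m1 ->] /imsetP[j jB ->].
  rewrite mem_imset; last exact: perm_inj.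
  by move=> jC; rewrite (part_eq l1 m1 jB jC).
- apply/imsetP=> -[B lB /esym/eqP]; rewrite imset_eq0.
  by rewrite (negPf (part_neq0 lB)).
Qed.
Definition pact w la := MkPart (pact_subproof w la).

Definition young la : {set 'S_n} :=
  [set s : 'S_n | [forall B in blocks la, s @: (B : {set 'I_n}) == B]].

Fact young_group_set la : group_set (young la).
Proof.
apply/group_setP; split=> [|s t].
  rewrite inE; apply/forall_inP=> B _; apply/eqP/setP=> i.
  by rewrite -{1}(perm1 i) mem_imset ?perm1 //; exact: perm_inj.
rewrite !inE => /forall_inP hs /forall_inP ht; apply/forall_inP=> B lB.
apply/eqP; rewrite -{2}(eqP (ht B lB)) -{2}(eqP (hs B lB)) -imset_comp.
by apply: eq_imset => i; rewrite permM.
Qed.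
Canonical young_group la := Group (young_group_set la).

Lemma youngM la : {in young la &, forall g h, g *c h \in young la}.
Proof. by move=> g h gl hl; rewrite groupM. Qed.

Definition part_comparable la mu := refines la mu || refines mu la.

End SetPartitions.

Arguments pbot {n}.

Section DoubleCosets.
Variable n : nat.
Implicit Types (H G K : {set 'S_n}) (la mu nu : part n).

Definition dcoset H (w : 'S_n) K : {set 'S_n} := [set h *c w *c k | h in H, k in K].
Definition dcosets H G K : {set {set 'S_n}} := [set dcoset H w K | w in G].

Definition pinterval la mu : {set part n} := [set ka | refines la ka && refines ka mu].
Definition part_orbits G (D : {set part n}) : {set {set part n}} :=
  [set [set pact g mu | g in G] | mu in D].
End DoubleCosets.

(* Linear algebra follows MathComp's row-vector convention: a matrix
   f : 'M_(p, q) is the linear map u |-> u *m f from C^p to C^q. *)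
Section Kronecker.
Variable F : fieldType.

(* The tensor product of C^p and C^q is C^(p * q), the tensor u (x) v being
   mxvec (u^T *m v); kron f g is the map f (x) g. *)
Definition kron p q p' q' (f : 'M[F]_(p, p')) (g : 'M[F]_(q, q')) :
    'M[F]_(p * q, p' * q') :=
  lin_mx (mulmxr g \o mulmx f^T).

Lemma kronE p q p' q' (f : 'M[F]_(p, p')) (g : 'M[F]_(q, q')) M :
  mxvec M *m kron f g = mxvec (f^T *m M *m g).
Proof. by rewrite /kron mul_vec_lin. Qed.

Lemma kron_tensor p q p' q' (f : 'M[F]_(p, p')) (g : 'M[F]_(q, q'))
    (u : 'rV_p) (v : 'rV_q) :
  mxvec (u^T *m v) *m kron f g = mxvec ((u *m f)^T *m (v *m g)).
Proof. by rewrite kronE trmx_mul !mulmxA. Qed.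

Lemma mxvec_ext p q m (X Y : 'M[F]_(p * q, m)) :
  (forall M, mxvec M *m X = mxvec M *m Y) -> X = Y.
Proof.
move=> h; apply/row_matrixP=> i; rewrite !rowE.
by rewrite -(vec_mxK (delta_mx 0 i)) h.
Qed.

Lemma kron_mul p q p' q' p'' q'' (f : 'M[F]_(p, p')) (g : 'M[F]_(q, q'))
    (f' : 'M[F]_(p', p'')) (g' : 'M[F]_(q', q'')) :
  kron f g *m kron f' g' = kron (f *m f') (g *m g').
Proof.
by apply: mxvec_ext => M; rewrite mulmxA !kronE trmx_mul !mulmxA.
Qed.

Lemma kron11 p q : kron 1%:M 1%:M = 1%:M :> 'M[F]_(p * q).
Proof. by apply: mxvec_ext => M; rewrite kronE trmx1 mulmx1 mul1mx mulmx1. Qed.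

Lemma kron_entry p q p' q' (f : 'M[F]_(p, p')) (g : 'M[F]_(q, q')) i j k l :
  kron f g (mxvec_index i j) (mxvec_index k l) = f i k * g j l.
Proof.
rewrite mxE /= vec_mx_delta mxvecE -(mul_delta_mx (0 : 'I_1)).
by rewrite mulmxA -colE -mulmxA -rowE mxE big_ord1 !mxE.
Qed.

Lemma kronDl p q p' q' (f f' : 'M[F]_(p, p')) (g : 'M[F]_(q, q')) :
  kron (f + f') g = kron f g + kron f' g.
Proof.
by apply: mxvec_ext => M; rewrite mulmxDr !kronE linearD /= !mulmxDl linearD.
Qed.
Lemma kronDr p q p' q' (f : 'M[F]_(p, p')) (g g' : 'M[F]_(q, q')) :
  kron f (g + g') = kron f g + kron f g'.
Proof. by apply: mxvec_ext => M; rewrite mulmxDr !kronE !mulmxDr linearD. Qed.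
Lemma kron0l p q p' q' (g : 'M[F]_(q, q')) :
  kron 0 g = 0 :> 'M_(p * q, p' * q').
Proof. by apply: mxvec_ext => M; rewrite kronE trmx0 !mul0mx mulmx0 linear0. Qed.
Lemma kron0r p q p' q' (f : 'M[F]_(p, p')) :
  kron f 0 = 0 :> 'M_(p * q, p' * q').
Proof. by apply: mxvec_ext => M; rewrite kronE !mulmx0 linear0. Qed.

Lemma kron_suml p q p' q' (I : finType) (P : pred I)
    (f : I -> 'M[F]_(p, p')) (g : 'M[F]_(q, q')) :
  kron (\sum_(i | P i) f i) g = \sum_(i | P i) kron (f i) g.
Proof. by elim/big_rec2: _ => [|i x y _ <-]; rewrite (kron0l, kronDl). Qed.
Lemma kron_sumr p q p' q' (I : finType) (P : pred I)
    (f : 'M[F]_(p, p')) (g : I -> 'M[F]_(q, q')) :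
  kron f (\sum_(i | P i) g i) = \sum_(i | P i) kron f (g i).
Proof. by elim/big_rec2: _ => [|i x y _ <-]; rewrite (kron0r, kronDr). Qed.

End Kronecker.

(* A family of spaces F_x = C^(d x), x in 'S_n: gbasis d is the union of their
   standard bases, C^(tdim d) is the direct sum of the F_x, and deg i is the
   index x of the summand containing the i-th vector of its basis. *)
Section Graded.
Variable n : nat.

Definition gbasis (d : 'S_n -> nat) : finType := {x : 'S_n & 'I_(d x)}.
Definition tdim (d : 'S_n -> nat) : nat := #|{: gbasis d}|.
Definition deg (d : 'S_n -> nat) (i : 'I_(tdim d)) : 'S_n := tag (enum_val i).

Variable F : fieldType.

(* f maps F_x to F'_(s x) for every x. *)
Definition homog (d d' : 'S_n -> nat) (s : 'S_n -> 'S_n) (f : 'M[F]_(tdim d, tdim d')) :=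
  forall i j, f i j != 0 -> deg j = s (deg i).

(* The projection of the direct sum of the F_x onto F_x. *)
Definition gproj (d : 'S_n -> nat) (x : 'S_n) : 'M[F]_(tdim d) :=
  diag_mx (\row_i (deg i == x)%:R).

Lemma gproj_mulE d m x (f : 'M[F]_(tdim d, m)) i j :
  (gproj d x *m f) i j = (deg i == x)%:R * f i j.
Proof. by rewrite mul_diag_mx !mxE. Qed.

Lemma mul_gprojE d m x (f : 'M[F]_(m, tdim d)) i j :
  (f *m gproj d x) i j = f i j * (deg j == x)%:R.
Proof. by rewrite mul_mx_diag !mxE. Qed.

Lemma homogP d d' s (f : 'M[F]_(tdim d, tdim d')) : injective s ->
  (forall x, gproj d x *m f = f *m gproj d' (s x)) <-> homog s f.
Proof.
move=> s_inj; split=> [h i j fij | h x].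
  have /matrixP/(_ i j) := h (deg i).
  rewrite gproj_mulE mul_gprojE eqxx mul1r.
  case: eqP => // _ /eqP; by rewrite mulr0 (negPf fij).
apply/matrixP=> i j; rewrite gproj_mulE mul_gprojE mulrC.
have [->|fij] := eqVneq (f i j) 0; first by rewrite !mul0r.
by rewrite (h _ _ fij) (inj_eq s_inj).
Qed.

Lemma gproj_sum d : \sum_x gproj d x = 1%:M.
Proof.
apply/matrixP=> i j; rewrite summxE (bigD1 (deg i)) //= big1 ?addr0.
  by rewrite !mxE eqxx.
by move=> x xi; rewrite !mxE eq_sym (negPf xi) mul0rn.
Qed.

Lemma gproj_mul d x y : gproj d x *m gproj d y = if x == y then gproj d x else 0.
Proof.
apply/matrixP=> i j; rewrite gproj_mulE.
case: (eqVneq x y) => [<-|xy]; rewrite !mxE.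
  by case: eqP => // _; rewrite ?mul1r ?mul0r ?mul0rn.
by case: eqP => [->|_]; rewrite ?mul0r // (negPf xy) mul1r mul0rn.
Qed.

(* A basis of the sum of the row spaces of the W x, made of bases of each. *)
Definition hbasis m (W : 'S_n -> 'M[F]_m) : 'M[F]_(tdim (fun x => \rank (W x)), m) :=
  \matrix_i row (tagged (enum_val i)) (row_base (W (tag (enum_val i)))).

Lemma hbasis_sub m (W : 'S_n -> 'M[F]_m) i : (row i (hbasis W) <= W (deg i))%MS.
Proof. by rewrite rowK (submx_trans (row_sub _ _)) // eq_row_base. Qed.

Lemma hbasis_sup m (W : 'S_n -> 'M[F]_m) x : (W x <= hbasis W)%MS.
Proof.
rewrite -(eq_row_base (W x)); apply/row_subP=> k.
pose t : gbasis (fun x => \rank (W x)) := Tagged (fun x => 'I_(\rank (W x))) k.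
have -> : row k (row_base (W x)) = row (enum_rank t) (hbasis W).
  by rewrite rowK enum_rankK.
exact: row_sub.
Qed.

Section HBasis.
Variables (m : nat) (W P : 'S_n -> 'M[F]_m).
Hypothesis WP : forall x, W x *m P x = W x.
Hypothesis WP0 : forall x y, x != y -> W x *m P y = 0.

Lemma hbasis_proj x : hbasis W *m P x = gproj _ x *m hbasis W.
Proof.
apply/row_matrixP=> i; rewrite row_mul.
have -> : row i (gproj (fun x => \rank (W x)) x *m hbasis W) =
    (deg i == x)%:R *: row i (hbasis W).
  by apply/rowP=> j; rewrite mxE gproj_mulE !mxE.
have /submxP[D ->] := hbasis_sub i.
rewrite -mulmxA; case: eqP => [->|/eqP ix]; first by rewrite WP scale1r.
by rewrite WP0 // mulmx0 scale0r.
Qed.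

Lemma hbasis_free : row_free (hbasis W).
Proof.
apply/row_freeP; suff : kermx (hbasis W) = 0.
  move/eqP; rewrite kermx_eq0 => /row_freeP. exact.
apply/row_matrixP=> r; rewrite row0; set u := row r _.
have u0 : u *m hbasis W = 0 by rewrite -row_mul mulmx_ker row0.
have ux x : u *m gproj _ x *m hbasis W = 0.
  by rewrite -mulmxA -hbasis_proj mulmxA u0 mul0mx.
apply/rowP=> i; rewrite [RHS]mxE.
pose d x := \rank (W x).
pose v : 'rV[F]_(d (deg i)) := \row_k u 0 (enum_rank (Tagged (fun x => 'I_(d x)) k : gbasis d)).
have : v *m row_base (W (deg i)) = 0.
  rewrite -(ux (deg i)); apply/rowP=> j; rewrite !mxE.
  transitivity (\sum_(k : 'I_(d (deg i)))
     u 0 (enum_rank (Tagged (fun x => 'I_(d x)) k : gbasis d)) *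
     row_base (W (deg i)) k j).
    by apply: eq_bigr => k _; rewrite mxE.
  transitivity (\sum_(k : 'I_(tdim d) | deg k == deg i) u 0 k * hbasis W k j); last first.
    rewrite big_mkcond /=; apply: eq_bigr => k _.
    by rewrite mul_gprojE; case: eqP; rewrite ?mulr1 ?mulr0 ?mul0r.
  rewrite (reindex (fun k : 'I_(d (deg i)) => enum_rank (Tagged (fun x => 'I_(d x)) k : gbasis d))) /=.
    apply: eq_big => k; first by rewrite /deg enum_rankK eqxx.
    by move=> _; rewrite /hbasis !mxE enum_rankK /=.
  pose g (k : 'I_(tdim d)) := tagged_as (Tagged (fun x => 'I_(d x)) (tagged (enum_val i))) (enum_val k).
  exists g.
    move=> k _; rewrite /g enum_rankK /=. 
    by rewrite tagged_asE.
  move=> k; rewrite inE /g /deg => /eqP e.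
  apply: enum_val_inj; rewrite enum_rankK.
  move: (enum_val k) e => [x y] /= e; subst x.
  by rewrite tagged_asE.
have := row_base_free (W (deg i)) => /row_free_inj inj.
rewrite -(mul0mx 1 (row_base (W (deg i)))) => /inj /rowP /(_ (tagged (enum_val i))).
rewrite [in X in X -> _]mxE [in X in _ = X -> _]mxE => e; apply: etrans e; congr (u 0 _); apply: enum_val_inj; rewrite enum_rankK.
by rewrite /deg; case: (enum_val i).
Qed.

End HBasis.
End Graded.
Arguments gproj {n F} d x.

Section Sheaves.
Variables (F : numFieldType) (n : nat).
Implicit Types (la mu nu : part n).

(* An object of Sh([S_nu \ S_n / S_mu]). *)
Record sheaf nu mu := Sheaf {
  sdim : 'S_n -> nat;
  lact : 'S_n -> 'M[F]_(tdim sdim);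
  ract : 'S_n -> 'M[F]_(tdim sdim);
  lact1 : lact 1%g = 1%:M;
  lactM : {in young nu &, forall g h, lact (g *c h) = lact h *m lact g};
  ract1 : ract 1%g = 1%:M;
  ractM : {in young mu &, forall g h, ract (g *c h) = ract g *m ract h};
  lractC : {in young nu & young mu, forall g h, lact g *m ract h = ract h *m lact g};
  lact_homog : {in young nu, forall g, homog (fun x => g *c x) (lact g)};
  ract_homog : {in young mu, forall h, homog (fun x => x *c h) (ract h)}
}.

HB.instance Definition _ nu mu := gen_eqMixin (sheaf nu mu).
HB.instance Definition _ nu mu := gen_choiceMixin (sheaf nu mu).

Section Objects.
Variables (nu mu : part n).
Implicit Types A B C : sheaf nu mu.

Definition sdimT A := tdim (sdim A).

Definition is_hom A B (f : 'M[F]_(sdimT A, sdimT B)) : Prop :=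
  [/\ homog id f,
      {in young nu, forall g, lact A g *m f = f *m lact B g} &
      {in young mu, forall h, ract A h *m f = f *m ract B h}].

(* 0 -> A -> B -> C -> 0 is exact. *)
Definition short_exact A B C (f : 'M[F]_(sdimT A, sdimT B)) (g : 'M[F]_(sdimT B, sdimT C)) : Prop :=
  [/\ is_hom f, is_hom g, row_free f, row_full g & (f == kermx g)%MS].

Definition ses_closed (S : {pred {malg (sheaf nu mu)}}) : Prop :=
  forall A B C f g, @short_exact A B C f g -> << B >> - << A >> - << C >> \in S.

Definition ses_span : {pred {malg (sheaf nu mu)}} := fun x =>
  `[< forall S : {pred {malg (sheaf nu mu)}}, zmod_closed S -> ses_closed S -> x \in S >].

Fact ses_span_zmod_closed : zmod_closed ses_span.
Proof.
split=> [|x y /asboolP hx /asboolP hy]; apply/asboolP=> S SZ SE.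
  by case: SZ.
by case: (SZ) => _; apply; [apply: hx | apply: hy].
Qed.
HB.instance Definition _ := GRing.isZmodClosed.Build {malg (sheaf nu mu)} ses_span ses_span_zmod_closed.

Definition groth : Type := Quotient.quot (ses_span : zmodClosed _).
HB.instance Definition _ := GRing.Zmodule.on groth.

End Objects.
End Sheaves.

Section Convolution.
Variables (F : numFieldType) (n : nat).

Section TensorGrading.
Variables d e : 'S_n -> nat.
(* The projection onto the sum of the F_y (x) F'_z with y *c z = x. *)
Definition tproj (x : 'S_n) : 'M[F]_(tdim d * tdim e) :=
  \sum_(p : 'S_n * 'S_n | p.1 *c p.2 == x) kron (gproj d p.1) (gproj e p.2).

Lemma tproj_mul x y : tproj x *m tproj y = if x == y then tproj x else 0.
Proof.
rewrite /tproj mulmx_suml.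
transitivity (\sum_(p : 'S_n * 'S_n | p.1 *c p.2 == x)
    if x == y then kron (gproj (F := F) d p.1) (gproj e p.2) else 0).
  apply: eq_bigr => p /eqP px; rewrite mulmx_sumr.
  case: eqP => [xy|xy].
    rewrite (bigD1 p) /=; last by rewrite px xy.
    rewrite kron_mul !gproj_mul !eqxx big1 ?addr0 // => q /andP[_ qp].
    rewrite kron_mul !gproj_mul.
    case: eqP => [e1|_]; last by rewrite kron0l.
    case: eqP => [e2|_]; last by rewrite kron0r.
    by move: qp; rewrite [q]surjective_pairing -e1 -e2 -surjective_pairing eqxx.
  rewrite big1 // => q /eqP qy; rewrite kron_mul !gproj_mul.
  case: eqP => [e1|_]; last by rewrite kron0l.
  case: eqP => [e2|_]; last by rewrite kron0r.
  by case: xy; rewrite -px -qy e1 e2.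
by case: eqP => // _; rewrite big1.
Qed.

Lemma tproj_sum : \sum_x tproj x = 1%:M.
Proof.
rewrite /tproj (exchange_big_dep predT) //=.
transitivity (\sum_(p : 'S_n * 'S_n) kron (gproj (F := F) d p.1) (gproj e p.2)).
  apply: eq_bigr => p _; rewrite (bigD1 (p.1 *c p.2)) //= big1 ?addr0 //.
  by move=> x /andP[/eqP-> /negP[]].
rewrite -(pair_bigA _ (fun y z => kron (gproj (F := F) d y) (gproj e z))) /=.
transitivity (\sum_y kron (gproj (F := F) d y) (1%:M : 'M_(tdim e))).
  by apply: eq_bigr => y _; rewrite -kron_sumr gproj_sum.
by rewrite -kron_suml gproj_sum kron11.
Qed.
End TensorGrading.

Lemma tproj_kron d e d' e' (s t r : 'S_n -> 'S_n)
    (f : 'M[F]_(tdim d, tdim d')) (g : 'M[F]_(tdim e, tdim e')) x :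
    injective s -> injective t -> injective r ->
    (forall y z, s y *c t z = r (y *c z)) -> homog s f -> homog t g ->
  tproj d e x *m kron f g = kron f g *m tproj d' e' (r x).
Proof.
move=> s_inj t_inj r_inj str /(homogP _ s_inj) hf /(homogP _ t_inj) hg.
rewrite /tproj mulmx_suml mulmx_sumr.
rewrite [RHS](reindex_inj (h := fun p => (s p.1, t p.2))) /=; last first.
  by move=> [y z] [y' z'] /= [/s_inj-> /t_inj->].
apply: eq_big => p; first by rewrite str (inj_eq r_inj).
by move=> _; rewrite !kron_mul hf hg.
Qed.

Section Tensor.
Variables (nu mu la : part n) (A : sheaf F nu mu) (B : sheaf F mu la).

(* a (x) b |-> (a . w^-1) (x) (w . b) *)
Definition tact (w : 'S_n) : 'M[F]_(sdimT A * sdimT B) :=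
  kron (ract A w^-1) (lact B w).

(* The invariants of S_mu in the sum of the A_y (x) B_z with y *c z = x. *)
Definition tinv (x : 'S_n) : 'M[F]_(sdimT A * sdimT B) :=
  ((\bigcap_(w in young mu) kermx (tact w - 1%:M)) :&: tproj _ _ x)%MS.

Definition cbasis := hbasis tinv.

Lemma tactM : {in young mu &, forall g h, tact (g *c h) = tact h *m tact g}.
Proof.
move=> g h gm hm; rewrite /tact kron_mul pinvM ractM ?groupV //.
by rewrite lactM.
Qed.

Lemma tact_tproj w x : w \in young mu ->
  tproj _ _ x *m tact w = tact w *m tproj _ _ x.
Proof.
move=> wm; apply: (tproj_kron (s := fun y => y *c w^-1%g) (t := pcomp w) (r := id)).
- exact: pcompIr.
- exact: pcompI.
- exact: inj_id.
- by move=> y z; rewrite -pcompA (pcompA w^-1%g) pVcomp p1comp.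
- by apply: ract_homog; rewrite groupV.
- exact: lact_homog.
Qed.

Definition avg : 'M[F]_(sdimT A * sdimT B) :=
  #|young mu|%:R^-1 *: \sum_(w in young mu) tact w.

Lemma cardY_neq0 : #|young mu|%:R != 0 :> F.
Proof. by rewrite pnatr_eq0 -lt0n cardG_gt0. Qed.

Lemma avg_tact w : w \in young mu -> avg *m tact w = avg.
Proof.
move=> wm; rewrite /avg -scalemxAl mulmx_suml; congr (_ *: _).
rewrite [RHS](reindex_inj (@pcompI _ w)) /=.
apply: eq_big => [v|v vm]; last by rewrite tactM.
by rewrite /pcomp groupMr.
Qed.

Lemma tact_avg w : w \in young mu -> tact w *m avg = avg.
Proof.
move=> wm; rewrite /avg -scalemxAr mulmx_sumr; congr (_ *: _).
rewrite [RHS](reindex_inj (@pcompIr _ w)) /=.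
apply: eq_big => [v|v vm]; last by rewrite tactM.
by rewrite /pcomp groupMl.
Qed.

Lemma avg_fix m (u : 'M_(m, _)) :
  (forall w, w \in young mu -> u *m tact w = u) -> u *m avg = u.
Proof.
move=> h; rewrite /avg -scalemxAr mulmx_sumr (eq_bigr (fun=> u)) //.
by rewrite sumr_const -scaler_nat scalerA mulVf ?cardY_neq0 // scale1r.
Qed.

Lemma tprojC x : tproj _ _ x *m avg = avg *m tproj _ _ x.
Proof.
rewrite /avg -scalemxAr -scalemxAl; congr (_ *: _).
rewrite [RHS]mulmx_suml [LHS]mulmx_sumr.
by apply: eq_bigr => w wm; rewrite tact_tproj.
Qed.

Lemma tinvP m (u : 'M_(m, _)) x :
  (u <= tinv x)%MS <->
  (forall w, w \in young mu -> u *m tact w = u) /\ u *m tproj _ _ x = u.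
Proof.
rewrite /tinv sub_capmx; split.
  case/andP=> /sub_bigcapmxP h /submxP[D uD]; split=> [w wm|]; last first.
    by rewrite uD -mulmxA tproj_mul eqxx.
  have /sub_kermxP := h w wm; rewrite mulmxBr mulmx1 => /eqP.
  by rewrite subr_eq0 => /eqP.
case=> h hx; apply/andP; split; last by rewrite -hx submxMl.
apply/sub_bigcapmxP=> w wm; apply/sub_kermxP.
by rewrite mulmxBr mulmx1 h ?subrr.
Qed.

Lemma tinv_proj x y : tinv x *m tproj _ _ y = if x == y then tinv x else 0.
Proof.
have /tinvP[_ h] := submx_refl (tinv x).
by rewrite -{1}h -mulmxA tproj_mul; case: eqP; rewrite ?mulmx0 ?h.
Qed.

Lemma cbasis_proj x : cbasis *m tproj _ _ x = gproj _ x *m cbasis.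
Proof.
by apply: hbasis_proj => [y|y z yz]; rewrite tinv_proj ?eqxx // (negPf yz).
Qed.

Lemma cbasis_free : row_free cbasis.
Proof.
apply: (hbasis_free (P := tproj _ _)) => [y|y z yz];
  by rewrite tinv_proj ?eqxx // (negPf yz).
Qed.

Lemma cbasis_tact w : w \in young mu -> cbasis *m tact w = cbasis.
Proof.
move=> wm; apply/row_matrixP=> i; rewrite row_mul.
by have /tinvP[-> //] := hbasis_sub (W := tinv) i.
Qed.

Lemma cbasis_avg : cbasis *m avg = cbasis.
Proof. by apply: avg_fix => w; apply: cbasis_tact. Qed.

Lemma avg_cbasis : (avg <= cbasis)%MS.
Proof.
rewrite -[avg]mulmx1 -tproj_sum mulmx_sumr; apply: summx_sub => x _.
apply: submx_trans (hbasis_sup tinv x); apply/tinvP; split=> [w wm|].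
  by rewrite -mulmxA tact_tproj // mulmxA avg_tact.
by rewrite -mulmxA tproj_mul eqxx.
Qed.

Lemma sub_cbasis m (u : 'M_(m, _)) : (u <= cbasis)%MS = (u *m avg == u).
Proof.
apply/idP/eqP => [/submxP[D ->]|<-]; first by rewrite -mulmxA cbasis_avg.
exact: submx_trans (submxMl _ _) avg_cbasis.
Qed.
End Tensor.

Section Induced.
Variables (nu mu la nu' mu' la' : part n).
Variables (A : sheaf F nu mu) (B : sheaf F mu la).
Variables (A' : sheaf F nu' mu') (B' : sheaf F mu' la').

(* The map between invariants induced by phi, in the bases cbasis. *)
Definition cmap (phi : 'M[F]_(sdimT A * sdimT B, sdimT A' * sdimT B')) :=
  cbasis A B *m phi *m pinvmx (cbasis A' B').

Definition cstable (phi : 'M[F]_(sdimT A * sdimT B, sdimT A' * sdimT B')) :=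
  avg A B *m phi = phi *m avg A' B'.

Lemma cmapE phi : cstable phi -> cmap phi *m cbasis A' B' = cbasis A B *m phi.
Proof.
move=> h; rewrite mulmxKpV // sub_cbasis -mulmxA -h mulmxA.
by rewrite cbasis_avg.
Qed.

Lemma cmap_homog phi r : injective r -> cstable phi ->
  (forall x, tproj _ _ x *m phi = phi *m tproj _ _ (r x)) ->
  homog r (cmap phi).
Proof.
move=> r_inj h hr; apply/homogP => // x.
apply: (row_free_inj (cbasis_free A' B')).
rewrite -mulmxA cmapE // mulmxA -cbasis_proj -mulmxA -(cbasis_proj A' B').
by rewrite -[LHS]mulmxA hr mulmxA [RHS]mulmxA cmapE.
Qed.
End Induced.
Arguments cstable {nu mu la nu' mu' la'} A B A' B' phi.
Arguments cmap {nu mu la nu' mu' la'} A B A' B' phi.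

Lemma cstable_kron (nu mu la nu' la' : part n) (A : sheaf F nu mu) (B : sheaf F mu la)
   (A' : sheaf F nu' mu) (B' : sheaf F mu la') f g :
  {in young mu, forall w, ract A w *m f = f *m ract A' w} ->
  {in young mu, forall w, lact B w *m g = g *m lact B' w} ->
  cstable A B A' B' (kron f g).
Proof.
move=> hf hg; rewrite /cstable /avg -scalemxAl -scalemxAr mulmx_suml mulmx_sumr.
congr (_ *: _); apply: eq_bigr => w wm.
by rewrite /tact !kron_mul hf ?groupV // hg.
Qed.

Lemma cmapM (nu mu la nu' mu' la' nu2 mu2 la2 : part n)
   (A : sheaf F nu mu) (B : sheaf F mu la)
   (A' : sheaf F nu' mu') (B' : sheaf F mu' la')
   (A2 : sheaf F nu2 mu2) (B2 : sheaf F mu2 la2) phi psi :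
  cstable A B A' B' phi -> cstable A' B' A2 B2 psi ->
  cmap A B A' B' phi *m cmap A' B' A2 B2 psi = cmap A B A2 B2 (phi *m psi).
Proof.
move=> h1 h2; apply: (row_free_inj (cbasis_free A2 B2)).
rewrite -mulmxA cmapE // mulmxA cmapE // cmapE ?mulmxA //.
by rewrite /cstable mulmxA h1 -mulmxA h2 mulmxA.
Qed.

Lemma cmap1 (nu mu la : part n) (A : sheaf F nu mu) (B : sheaf F mu la) :
  cmap A B A B 1%:M = 1%:M.
Proof.
apply: (row_free_inj (cbasis_free A B)); rewrite cmapE ?mul1mx ?mulmx1 //.
by rewrite /cstable mulmx1 mul1mx.
Qed.

Section Comp.
Variables (nu mu la : part n) (A : sheaf F nu mu) (B : sheaf F mu la).

Definition comp_lact (g : 'S_n) := cmap A B A B (kron (lact A g) 1%:M).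
Definition comp_ract (h : 'S_n) := cmap A B A B (kron 1%:M (ract B h)).

Fact comp_lst g : g \in young nu -> cstable A B A B (kron (lact A g) 1%:M).
Proof.
move=> gn; apply: cstable_kron => w wm; first by rewrite lractC.
by rewrite mul1mx mulmx1.
Qed.
Fact comp_rst g : g \in young la -> cstable A B A B (kron 1%:M (ract B g)).
Proof.
move=> gn; apply: cstable_kron => w wm; last by rewrite lractC.
by rewrite mul1mx mulmx1.
Qed.

Fact homog1 d : homog id (1%:M : 'M[F]_(tdim (n := n) d)).
Proof. by move=> i j; rewrite mxE; case: (eqVneq i j) => [->|_] //; rewrite eqxx. Qed.

Fact comp_lact1 : comp_lact 1%g = 1%:M.
Proof. by rewrite /comp_lact lact1 kron11 cmap1. Qed.
Fact comp_ract1 : comp_ract 1%g = 1%:M.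
Proof. by rewrite /comp_ract ract1 kron11 cmap1. Qed.
Fact comp_lactM : {in young nu &, forall g h,
  comp_lact (g *c h) = comp_lact h *m comp_lact g}.
Proof.
move=> g h gn hn; rewrite /comp_lact cmapM; try exact: comp_lst.
by rewrite kron_mul mul1mx lactM.
Qed.
Fact comp_ractM : {in young la &, forall g h,
  comp_ract (g *c h) = comp_ract g *m comp_ract h}.
Proof.
move=> g h gn hn; rewrite /comp_ract cmapM; try exact: comp_rst.
by rewrite kron_mul mul1mx ractM.
Qed.
Fact comp_lractC : {in young nu & young la, forall g h,
  comp_lact g *m comp_ract h = comp_ract h *m comp_lact g}.
Proof.
move=> g h gn hl; have Lg := comp_lst gn; have Rh := comp_rst hl.
rewrite /comp_lact /comp_ract (cmapM Lg Rh) (cmapM Rh Lg).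
by rewrite !kron_mul !mul1mx !mulmx1.
Qed.
Fact comp_lact_homog : {in young nu, forall g,
  homog (fun x => g *c x) (comp_lact g)}.
Proof.
move=> g gn; apply: cmap_homog; [exact: pcompI | exact: comp_lst|].
move=> x; apply: (tproj_kron (s := pcomp g) (t := id)).
- exact: pcompI.
- exact: inj_id.
- exact: pcompI.
- by move=> y z; rewrite pcompA.
- exact: lact_homog.
- exact: homog1.
Qed.
Fact comp_ract_homog : {in young la, forall h,
  homog (fun x => x *c h) (comp_ract h)}.
Proof.
move=> g gn; apply: cmap_homog; [exact: pcompIr | exact: comp_rst|].
move=> x; apply: (tproj_kron (s := id) (t := fun x => x *c g)).
- exact: inj_id.
- exact: pcompIr.
- exact: pcompIr.
- by move=> y z; rewrite pcompA.
- exact: homog1.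
- exact: ract_homog.
Qed.

(* A o B, where (A o B)_x is the space tinv x, with its basis of cbasis *)
Definition conv : sheaf F nu la :=
  Sheaf comp_lact1 comp_lactM comp_ract1 comp_ractM comp_lractC
        comp_lact_homog comp_ract_homog.
End Comp.
End Convolution.
Arguments cstable {F n nu mu la nu' mu' la'} A B A' B' phi.
Arguments cmap {F n nu mu la nu' mu' la'} A B A' B' phi.

Section Exactness.
Variables (F : numFieldType) (n : nat).
Implicit Types nu mu la : part n.

Lemma cmap_exact nu mu la nu' mu' la' nu2 mu2 la2
   (A : sheaf F nu mu) (B : sheaf F mu la)
   (A' : sheaf F nu' mu') (B' : sheaf F mu' la')
   (A2 : sheaf F nu2 mu2) (B2 : sheaf F mu2 la2) phi psi r t :
  cstable A B A' B' phi -> cstable A' B' A2 B2 psi ->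
  row_free phi -> phi *m psi = 0 -> t *m psi = 1%:M ->
  r *m phi + psi *m t = 1%:M ->
  [/\ row_free (cmap A B A' B' phi), row_full (cmap A' B' A2 B2 psi) &
      (cmap A B A' B' phi == kermx (cmap A' B' A2 B2 psi))%MS].
Proof.
move=> h1 h2 phif z0 tp rt; split.
- apply: inj_row_free => v v0; apply: (row_free_inj (cbasis_free A B)).
  apply: (row_free_inj phif); rewrite -mulmxA -cmapE // mulmxA v0.
  by rewrite !mul0mx.
- apply/row_fullP.
  have : (cbasis A2 B2 *m t *m avg A' B' <= cbasis A' B')%MS.
    exact: submx_trans (submxMl _ _) (avg_cbasis _ _).
  case/submxP=> D dD; exists D; apply: (row_free_inj (cbasis_free A2 B2)).
  rewrite -mulmxA cmapE // mulmxA -dD -mulmxA h2 !mulmxA.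
  by rewrite -(mulmxA _ t) tp mulmx1 cbasis_avg mul1mx.
- rewrite /eqmx; apply/andP; split.
    apply/sub_kermxP; rewrite cmapM // z0.
    by rewrite /cmap mulmx0 mul0mx.
  set u := kermx _.
  have u0 : u *m cbasis A' B' *m psi = 0.
    by rewrite -mulmxA -cmapE // mulmxA mulmx_ker mul0mx.
  pose v := u *m cbasis A' B' *m r.
  have vE : v *m phi = u *m cbasis A' B'.
    by rewrite -[RHS]mulmx1 -rt mulmxDr !mulmxA u0 mul0mx addr0.
  have : (v <= cbasis A B)%MS.
    rewrite sub_cbasis; apply/eqP/(row_free_inj phif).
    by rewrite -mulmxA h1 mulmxA vE -mulmxA cbasis_avg.
  case/submxP=> D vD; apply/submxP; exists D.
  apply: (row_free_inj (cbasis_free A' B')).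
  by rewrite -mulmxA cmapE // mulmxA -vD vE.
Qed.

Lemma exact_split a b c (f : 'M[F]_(a, b)) (g : 'M[F]_(b, c)) :
    row_free f -> row_full g -> (f == kermx g)%MS ->
  f *m g = 0 /\ exists r t, t *m g = 1%:M /\ r *m f + g *m t = 1%:M.
Proof.
move=> ff /row_fullP[t tg] /andP[/sub_kermxP fg kf]; split=> //.
have : (1%:M - g *m t <= f)%MS.
  apply: submx_trans kf; apply/sub_kermxP.
  by rewrite mulmxBl mul1mx -mulmxA tg mulmx1 subrr.
by case/submxP=> r rE; exists r, t; rewrite -rE subrK.
Qed.

Lemma kron_free a b c d (f : 'M[F]_(a, b)) (g : 'M[F]_(c, d)) :
  row_free f -> row_free g -> row_free (kron f g).
Proof.
move=> /row_freeP[f' ff] /row_freeP[g' gg]; apply/row_freeP.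
by exists (kron f' g'); rewrite kron_mul ff gg kron11.
Qed.

Section Objects.
Variables nu mu la : part n.

Lemma comp_hom_l (A A' : sheaf F nu mu) (B : sheaf F mu la) f :
  @is_hom _ _ _ _ A A' f ->
  cstable A B A' B (kron f 1%:M) /\
  @is_hom _ _ _ _ (conv A B) (conv A' B) (cmap A B A' B (kron f 1%:M)).
Proof.
case=> hf fl fr.
have st : cstable A B A' B (kron f 1%:M).
  by apply: cstable_kron => // w wm; rewrite mul1mx mulmx1.
split=> //; split.
- apply: cmap_homog => // x.
  by apply: (tproj_kron (s := id) (t := id) (r := id)) => //; exact: homog1.
- move=> g gn; have Lg := comp_lst A B gn; have Lg' := comp_lst A' B gn.
  rewrite /= /comp_lact (cmapM Lg st) (cmapM st Lg').
  by rewrite !kron_mul fl.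
- move=> g gn; have Lg := comp_rst A B gn; have Lg' := comp_rst A' B gn.
  rewrite /= /comp_ract (cmapM Lg st) (cmapM st Lg').
  by rewrite !kron_mul !mul1mx !mulmx1.
Qed.

Lemma comp_hom_r (A : sheaf F nu mu) (B B' : sheaf F mu la) f :
  @is_hom _ _ _ _ B B' f ->
  cstable A B A B' (kron 1%:M f) /\
  @is_hom _ _ _ _ (conv A B) (conv A B') (cmap A B A B' (kron 1%:M f)).
Proof.
case=> hf fl fr.
have st : cstable A B A B' (kron 1%:M f).
  by apply: cstable_kron => // w wm; rewrite mul1mx mulmx1.
split=> //; split.
- apply: cmap_homog => // x.
  by apply: (tproj_kron (s := id) (t := id) (r := id)) => //; exact: homog1.
- move=> g gn; have Lg := comp_lst A B gn; have Lg' := comp_lst A B' gn.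
  rewrite /= /comp_lact (cmapM Lg st) (cmapM st Lg').
  by rewrite !kron_mul !mul1mx !mulmx1.
- move=> g gn; have Lg := comp_rst A B gn; have Lg' := comp_rst A B' gn.
  rewrite /= /comp_ract (cmapM Lg st) (cmapM st Lg').
  by rewrite !kron_mul fr.
Qed.

Lemma row_free1 m : row_free (1%:M : 'M[F]_m).
Proof. by rewrite row_free_unit unitmx1. Qed.

Lemma comp_ses_l (A A' A2 : sheaf F nu mu) (B : sheaf F mu la) f g :
  @short_exact _ _ _ _ A A' A2 f g ->
  @short_exact _ _ _ _ (conv A B) (conv A' B) (conv A2 B)
    (cmap A B A' B (kron f 1%:M)) (cmap A' B A2 B (kron g 1%:M)).
Proof.
case=> hf hg ff gf fg; have [fg0 [r [t [tg rt]]]] := exact_split ff gf fg.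
have [st1 h1] := comp_hom_l B hf; have [st2 h2] := comp_hom_l B hg.
suff [i1 i2 i3] : [/\ row_free (cmap A B A' B (kron f 1%:M)),
   row_full (cmap A' B A2 B (kron g 1%:M)) &
   (cmap A B A' B (kron f 1%:M) == kermx (cmap A' B A2 B (kron g 1%:M)))%MS] by split.
apply: (cmap_exact (r := kron r 1%:M) (t := kron t 1%:M) st1 st2).
- exact: kron_free ff (row_free1 _).
- by rewrite kron_mul fg0 kron0l.
- by rewrite kron_mul tg mul1mx kron11.
- by rewrite !kron_mul !mul1mx -kronDl rt kron11.
Qed.

Lemma comp_ses_r (A : sheaf F nu mu) (B B' B2 : sheaf F mu la) f g :
  @short_exact _ _ _ _ B B' B2 f g ->
  @short_exact _ _ _ _ (conv A B) (conv A B') (conv A B2)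
    (cmap A B A B' (kron 1%:M f)) (cmap A B' A B2 (kron 1%:M g)).
Proof.
case=> hf hg ff gf fg; have [fg0 [r [t [tg rt]]]] := exact_split ff gf fg.
have [st1 h1] := comp_hom_r A hf; have [st2 h2] := comp_hom_r A hg.
suff [i1 i2 i3] : [/\ row_free (cmap A B A B' (kron 1%:M f)),
   row_full (cmap A B' A B2 (kron 1%:M g)) &
   (cmap A B A B' (kron 1%:M f) == kermx (cmap A B' A B2 (kron 1%:M g)))%MS] by split.
apply: (cmap_exact (r := kron 1%:M r) (t := kron 1%:M t) st1 st2).
- exact: kron_free (row_free1 _) ff.
- by rewrite kron_mul fg0 kron0r.
- by rewrite kron_mul tg mul1mx kron11.
- by rewrite !kron_mul !mul1mx -kronDr rt kron11.
Qed.
End Objects.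
End Exactness.

(* Additive extension to the free abelian group {malg T} of a map on T. *)
Section ZLift.
Variables (T : choiceType) (V : zmodType).
Implicit Type f : T -> V.

Definition zlift f (x : {malg T}) : V := \sum_(t <- msupp x) f t *~ x@_t.

Lemma zliftEw f x (D : {fset T}) : (msupp x `<=` D)%fset ->
  zlift f x = \sum_(t <- D) f t *~ x@_t.
Proof.
move=> le; rewrite /zlift (big_fset_incl _ le) // => t tD /mcoeff_outdom ->.
by rewrite mulr0z.
Qed.

Lemma zliftB f : {morph zlift f : x y / x - y}.
Proof.
move=> x y; pose D := (msupp x `|` msupp y `|` msupp (x - y))%fset.
have xD : (msupp x `<=` D)%fset by rewrite /D -fsetUA fsubsetUl.
have yD : (msupp y `<=` D)%fset by rewrite /D fsetUAC fsubsetUr.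
have xyD : (msupp (x - y) `<=` D)%fset by rewrite /D fsubsetUr.
rewrite (zliftEw _ xD) (zliftEw _ yD) (zliftEw _ xyD).
by rewrite -sumrB; apply: eq_bigr => t _; rewrite raddfB /= mulrzBr.
Qed.
HB.instance Definition _ f := GRing.isZmodMorphism.Build {malg T} V (zlift f) (zliftB f).

Lemma zliftU f t : zlift f << t >> = f t.
Proof.
by rewrite (@zliftEw _ _ [fset t]%fset) ?msuppU_le // big_seq_fset1 mcoeffUU mulr1z.
Qed.

Lemma zlift_ext (g h : {additive {malg T} -> V}) :
  (forall t, g << t >> = h << t >>) -> g =1 h.
Proof.
move=> gh x; rewrite [x]monalgE !raddf_sum /=; apply: eq_bigr => t _.
have -> : << x@_t *g t >> = << t >> *~ x@_t :> {malg T}.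
  by rewrite -[in LHS](intz x@_t) (raddfMz (mkmalgU t)).
by rewrite !raddfMz gh.
Qed.
End ZLift.

Arguments groth F {n} nu mu.

Section Groth.
Local Open Scope quotient_scope.
Variables (F : numFieldType) (n : nat).
Implicit Types nu mu la : part n.

Section Class.
Variables nu mu : part n.
Local Notation S := (sheaf F nu mu).
Local Notation Q := (Quotient.quot (@ses_span F n nu mu : zmodClosed _)).

Definition cls (A : S) : groth F nu mu := \pi_Q (<< A >> : {malg S}).

Lemma cls_ses A B C f g : @short_exact F n nu mu A B C f g -> cls B = cls A + cls C.
Proof.
move=> fg; rewrite /cls.
have -> : \pi_Q (<< A >> : {malg S}) + \pi_Q << C >> = \pi_Q (<< A >> + << C >>).
  by rewrite raddfD.
apply/eqP; rewrite -Quotient.idealrBE; apply/asboolP=> I IZ IE.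
by rewrite opprD addrA; apply: IE fg.
Qed.

Section Lift.
Variables (V : zmodType) (f : S -> V).
Definition ses_additive :=
  forall A B C u v, @short_exact F n nu mu A B C u v -> f B = f A + f C.

(* The map on the Grothendieck group induced by f, when f is additive on exact
   sequences. *)
Definition groth_lift (x : groth F nu mu) : V := zlift f (generic_quotient.repr (x : Q)).

Hypothesis fE : ses_additive.

Lemma zlift_ses_span x : x \in @ses_span F n nu mu -> zlift f x = 0.
Proof.
move=> /asboolP /(_ [pred x | zlift f x == 0]) h; apply/eqP/h.
  split=> [|y z]; rewrite !inE ?raddf0 // zliftB.
  by move=> /eqP-> /eqP->; rewrite subr0.
move=> A B C u v uv; rewrite inE !zliftB !zliftU (fE uv).
by rewrite addrAC addrK subrr.
Qed.

Lemma groth_lift_pi x : groth_lift (\pi_Q x) = zlift f x.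
Proof.
apply/eqP; rewrite -subr_eq0 -raddfB; apply/eqP/zlift_ses_span.
by rewrite Quotient.idealrBE reprK.
Qed.

Lemma groth_lift_cls A : groth_lift (cls A) = f A.
Proof. by rewrite groth_lift_pi zliftU. Qed.

Lemma groth_liftB : {morph groth_lift : x y / x - y}.
Proof.
move=> x y; rewrite -[x]reprK -[y]reprK.
have -> : \pi_Q (generic_quotient.repr (x : Q)) - \pi_Q (generic_quotient.repr (y : Q)) = \pi_Q (generic_quotient.repr (x : Q) - generic_quotient.repr (y : Q)).
  by rewrite raddfB.
by rewrite !groth_lift_pi raddfB.
Qed.
End Lift.

Lemma groth_ext (V : zmodType) (g h : groth F nu mu -> V) :
  {morph g : x y / x - y} -> {morph h : x y / x - y} ->
  (forall A, g (cls A) = h (cls A)) -> g =1 h.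
Proof.
move=> gB hB gh x; rewrite -[x]reprK; move: (generic_quotient.repr _) => y.
pose g' (y : {malg S}) := g (\pi_Q y); pose h' (y : {malg S}) := h (\pi_Q y).
have gm : {morph g' : x y / x - y} by move=> a b; rewrite /g' raddfB gB.
have hm : {morph h' : x y / x - y} by move=> a b; rewrite /h' raddfB hB.
pose gA := GRing.isZmodMorphism.Build {malg S} V g' gm.
pose hA := GRing.isZmodMorphism.Build {malg S} V h' hm.
pose G : {additive _ -> _} := HB.pack g' gA.
pose H : {additive _ -> _} := HB.pack h' hA.
exact: (@zlift_ext _ _ G H gh y).
Qed.
End Class.

Section Product.
Variables nu mu la : part n.

Definition kmul (x : groth F nu mu) (y : groth F mu la) : groth F nu la :=
  groth_lift (fun A => groth_lift (fun B => cls (conv A B)) y) x.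

Fact kmul_addr (A : sheaf F nu mu) :
  ses_additive (fun B : sheaf F mu la => cls (conv A B)).
Proof. by move=> B B' B2 u v uv; apply: cls_ses (comp_ses_r A uv). Qed.

Fact kmul_addl (y : groth F mu la) :
  ses_additive (fun A : sheaf F nu mu => groth_lift (fun B => cls (conv A B)) y).
Proof.
move=> A A' A2 u v uv; move: y.
apply: groth_ext => [x y|x y|B].
- exact: groth_liftB (kmul_addr _) _ _.
- rewrite !(groth_liftB (kmul_addr _)) opprD !addrA; congr (_ - _).
  by rewrite -!addrA; congr (_ + _); rewrite addrC.
- by rewrite !(groth_lift_cls (kmul_addr _)); apply: cls_ses (comp_ses_l B uv).
Qed.

Lemma kmul_cls A B : kmul (cls A) (cls B) = cls (conv A B).
Proof.
by rewrite /kmul (groth_lift_cls (kmul_addl _)) (groth_lift_cls (kmul_addr _)).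
Qed.

Lemma kmulBl y : {morph kmul^~ y : x x' / x - x'}.
Proof. exact: groth_liftB (kmul_addl y). Qed.

Lemma kmulBr x : {morph kmul x : y y' / y - y'}.
Proof.
move=> y y'; move: x; apply: groth_ext => [x x'|x x'|A].
- exact: kmulBl.
- by rewrite !kmulBl !opprD !opprK addrACA.
- rewrite /kmul !(groth_lift_cls (kmul_addl _)).
  exact: groth_liftB (kmul_addr _) _ _.
Qed.
End Product.
End Groth.

Section Isomorphisms.
Variables (F : numFieldType) (n : nat).
Implicit Types nu mu la ka : part n.

Section ZeroSheaf.
Variables nu mu : part n.
Definition zero_dim (x : 'S_n) := 0%N.
Fact zero_ord (i : 'I_(tdim zero_dim)) : False.
Proof. by case: (tagged (enum_val i)). Qed.

Definition zero_act (x : 'S_n) : 'M[F]_(tdim zero_dim) := 1%:M.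
Fact zero_actM (P : {pred 'S_n}) :
  {in P &, forall g h, zero_act (g *c h) = zero_act h *m zero_act g}.
Proof. by move=> g h _ _; rewrite mulmx1. Qed.
Fact zero_actC (P Q : {pred 'S_n}) :
  {in P & Q, forall g h, zero_act g *m zero_act h = zero_act h *m zero_act g}.
Proof. by move=> g h _ _; rewrite mulmx1. Qed.
Fact zero_homog (P : {pred 'S_n}) r :
  {in P, forall g, homog (r g) (zero_act g)}.
Proof. by move=> g _ i; case: (zero_ord i). Qed.

Definition zero_sheaf : sheaf F nu mu :=
  Sheaf (erefl : zero_act 1%g = 1%:M) (@zero_actM _) (erefl : zero_act 1%g = 1%:M)
    (@zero_actM _) (@zero_actC _ _) (@zero_homog _ _) (@zero_homog _ _).

Lemma iso_ses (A B : sheaf F nu mu) f : is_hom f -> row_free f -> row_full f ->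
  @short_exact _ _ _ _ A B zero_sheaf f 0.
Proof.
move=> hf ff fu; split=> //.
- by split=> [i j|g _|g _]; rewrite ?mxE ?eqxx ?mulmx0 ?mul0mx.
- rewrite /row_full mxrank0 eq_sym -leqn0 leqNgt; apply/negP=> h.
  exact: zero_ord (Ordinal h).
- by rewrite !kermx0 submx1 sub1mx.
Qed.
End ZeroSheaf.

Lemma is_hom1 nu mu (A : sheaf F nu mu) : @is_hom _ _ _ _ A A 1%:M.
Proof. by split=> [|g _|g _]; rewrite ?mulmx1 ?mul1mx //; apply: homog1. Qed.

Lemma cls_zero nu mu : cls (zero_sheaf nu mu) = 0.
Proof.
pose A := zero_sheaf nu mu.
have := cls_ses (iso_ses (is_hom1 A) (row_free1 _ _) _).
rewrite /row_full mxrank1 eqxx => /(_ isT) /eqP.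
by rewrite -subr_eq subrr eq_sym => /eqP.
Qed.

Lemma cls_iso nu mu (A B : sheaf F nu mu) f :
  @is_hom _ _ _ _ A B f -> row_free f -> row_full f -> cls A = cls B.
Proof. by move=> h1 h2 h3; rewrite (cls_ses (iso_ses h1 h2 h3)) cls_zero addr0. Qed.

(* Two objects which embed with the same image in a space with compatible
   grading and actions are isomorphic. *)
Lemma cls_embed nu mu (A B : sheaf F nu mu) m
    (P Phi Psi : 'S_n -> 'M[F]_m)
    (e : 'M_(sdimT A, m)) (e' : 'M_(sdimT B, m)) :
  row_free e -> row_free e' -> (e <= e')%MS -> (e' <= e)%MS ->
  (forall x, gproj _ x *m e = e *m P x) -> (forall x, gproj _ x *m e' = e' *m P x) ->
  {in young nu, forall g, lact A g *m e = e *m Phi g} ->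
  {in young nu, forall g, lact B g *m e' = e' *m Phi g} ->
  {in young mu, forall g, ract A g *m e = e *m Psi g} ->
  {in young mu, forall g, ract B g *m e' = e' *m Psi g} ->
  cls A = cls B.
Proof.
move=> ef ef' ee' e'e gA gB lA lB rA rB.
have [f fE] : exists f, f *m e' = e.
  by exists (e *m pinvmx e'); rewrite mulmxKpV.
apply: (@cls_iso _ _ _ _ f).
- split=> [|g gn|g gm].
  + apply/homogP => // x; apply: (row_free_inj ef').
    by rewrite -!mulmxA gB fE gA mulmxA fE.
  + by apply: (row_free_inj ef'); rewrite -!mulmxA lB // fE lA // mulmxA fE.
  + by apply: (row_free_inj ef'); rewrite -!mulmxA rB // fE rA // mulmxA fE.
- by apply: inj_row_free => v v0; apply: (row_free_inj ef); rewrite -fE mulmxA v0 !mul0mx.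
- case/submxP: e'e => D dD; apply/row_fullP; exists D.
  by apply: (row_free_inj ef'); rewrite -mulmxA fE -dD mul1mx.
Qed.

Section AssocMatrix.
Variables a b c : nat.
Definition unidx p q (k : 'I_(p * q)) : 'I_p * 'I_q :=
  enum_val (cast_ord (esym (mxvec_cast p q)) k).
Lemma unidxK p q (i : 'I_p) (j : 'I_q) : unidx (mxvec_index i j) = (i, j).
Proof. by rewrite /unidx /mxvec_index cast_ordK enum_rankK. Qed.

Definition asc (k : 'I_(a * b * c)) : 'I_(a * (b * c)) :=
  let: (p, l) := unidx k in let: (i, j) := unidx p in mxvec_index i (mxvec_index j l).
Definition asc' (k : 'I_(a * (b * c))) : 'I_(a * b * c) :=
  let: (i, p) := unidx k in let: (j, l) := unidx p in mxvec_index (mxvec_index i j) l.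
Lemma ascE i j l : asc (mxvec_index (mxvec_index i j) l) = mxvec_index i (mxvec_index j l).
Proof. by rewrite /asc !unidxK. Qed.
Lemma asc'E i j l : asc' (mxvec_index i (mxvec_index j l)) = mxvec_index (mxvec_index i j) l.
Proof. by rewrite /asc' !unidxK. Qed.
Lemma ascK : cancel asc asc'.
Proof. by move=> k; case/mxvec_indexP: k => k l; case/mxvec_indexP: k => i j; rewrite ascE asc'E. Qed.
Lemma asc'K : cancel asc' asc.
Proof. by move=> k; case/mxvec_indexP: k => i k; case/mxvec_indexP: k => j l; rewrite asc'E ascE. Qed.

Definition ascmx : 'M[F]_(a * (b * c), a * b * c) := colsub asc 1%:M.
Definition ascmx' : 'M[F]_(a * b * c, a * (b * c)) := colsub asc' 1%:M.

Lemma ascmxE m (X : 'M[F]_(m, _)) : X *m ascmx = colsub asc X.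
Proof. by rewrite mulmx_colsub mulmx1. Qed.
Lemma mul_ascmxE m (X : 'M[F]_(_, m)) : ascmx *m X = rowsub asc' X.
Proof.
have -> : ascmx = rowsub asc' 1%:M.
  by apply/matrixP=> i j; rewrite !mxE (can2_eq asc'K ascK).
by rewrite mul_rowsub_mx mul1mx.
Qed.
Lemma ascmxV : ascmx *m ascmx' = 1%:M.
Proof. by rewrite mulmx_colsub mulmx1; apply/matrixP=> i j; rewrite !mxE asc'K. Qed.
Lemma ascmx'V : ascmx' *m ascmx = 1%:M.
Proof. by rewrite mulmx_colsub mulmx1; apply/matrixP=> i j; rewrite !mxE ascK. Qed.
End AssocMatrix.

Lemma kronA a b c a' b' c' (f : 'M[F]_(a, a')) (g : 'M[F]_(b, b')) (h : 'M[F]_(c, c')) :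
  kron f (kron g h) *m ascmx a' b' c' = ascmx a b c *m kron (kron f g) h.
Proof.
rewrite ascmxE mul_ascmxE; apply/matrixP=> k l; rewrite [LHS]mxE [RHS]mxE.
case/mxvec_indexP: k => i k; case/mxvec_indexP: k => j k.
case/mxvec_indexP: l => l l'; case/mxvec_indexP: l => i' j'.
by rewrite ascE asc'E !kron_entry mulrA.
Qed.

Lemma tprojE (d e : 'S_n -> nat) x : tproj F d e x =
  \sum_y kron (gproj d y) (gproj e (y^-1%g *c x)).
Proof.
rewrite /tproj (eq_bigl (fun p => predT p.1 && (p.2 == p.1^-1%g *c x))); last first.
  move=> p /=; apply/eqP/eqP => [<-|->]; first by rewrite pcompK.
  by rewrite pcompVK.
rewrite -(pair_big_dep predT (fun y z => z == y^-1%g *c x)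
   (fun y z => kron (gproj (F:=F) d y) (gproj e z))) /=.
by apply: eq_bigr => y _; rewrite big_pred1_eq.
Qed.

Section Assoc.
Variables (nu mu la ka : part n).
Variables (A : sheaf F nu mu) (B : sheaf F mu la) (C : sheaf F la ka).
Let a := sdimT A.
Let b := sdimT B.
Let c := sdimT C.
Let X := conv A B.
Let Y := conv B C.
Let R := ascmx a b c.

Let G1 : 'M[F]_(a * b * c) := kron (avg A B) 1%:M.
Let G2 : 'M[F]_(a * b * c) :=
  #|young la|%:R^-1 *: \sum_(h in young la) kron (kron 1%:M (ract B h^-1%g)) (lact C h).
Let G1' : 'M[F]_(a * (b * c)) :=
  #|young mu|%:R^-1 *: \sum_(w in young mu) kron (ract A w^-1%g) (kron (lact B w) 1%:M).
Let G2' : 'M[F]_(a * (b * c)) := kron 1%:M (avg B C).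

Lemma kronZl p q p' q' (k : F) (f : 'M_(p, p')) (g : 'M_(q, q')) :
  kron (k *: f) g = k *: kron f g.
Proof. by apply: mxvec_ext => M; rewrite -scalemxAr !kronE linearZ /= -!scalemxAl linearZ. Qed.
Lemma kronZr p q p' q' (k : F) (f : 'M_(p, p')) (g : 'M_(q, q')) :
  kron f (k *: g) = k *: kron f g.
Proof. by apply: mxvec_ext => M; rewrite -scalemxAr !kronE -!scalemxAr linearZ. Qed.

Lemma kron_mull p q r m (f : 'M[F]_(p, q)) (g : 'M_(q, r)) :
  kron (f *m g) (1%:M : 'M_m) = kron f 1%:M *m kron g 1%:M.
Proof. by rewrite kron_mul mulmx1. Qed.
Lemma kron_mulr p q r m (f : 'M[F]_(p, q)) (g : 'M_(q, r)) :
  kron (1%:M : 'M_m) (f *m g) = kron 1%:M f *m kron 1%:M g.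
Proof. by rewrite kron_mul mulmx1. Qed.

Lemma G1R : G1' *m R = R *m G1.
Proof.
rewrite /G1' /G1 /avg kronZl kron_suml -scalemxAr -scalemxAl; congr (_ *: _).
rewrite mulmx_suml mulmx_sumr; apply: eq_bigr => w _.
by rewrite /tact -kronA.
Qed.
Lemma G2R : G2' *m R = R *m G2.
Proof.
rewrite /G2' /G2 /avg kronZr kron_sumr -scalemxAr -scalemxAl; congr (_ *: _).
rewrite mulmx_suml mulmx_sumr; apply: eq_bigr => w _.
by rewrite /tact -kronA.
Qed.

Lemma G12C : G1 *m G2 = G2 *m G1.
Proof.
rewrite /G1 /G2 /avg kronZl kron_suml -!scalemxAr -!scalemxAl !scalerA mulrC; congr (_ *: _).
rewrite mulmx_suml mulmx_sumr.
apply: eq_bigr => w wm; rewrite mulmx_suml mulmx_sumr; apply: eq_bigr => h hl.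
rewrite /tact !kron_mul !mulmx1 !mul1mx.
by rewrite lractC ?groupV.
Qed.

Let e1 := cbasis X C *m kron (cbasis A B) 1%:M.
Let e2 := cbasis A Y *m kron 1%:M (cbasis B C) *m R.

Lemma avg_e1 : avg X C *m kron (cbasis A B) 1%:M = kron (cbasis A B) 1%:M *m G2.
Proof.
rewrite /avg /G2 -scalemxAl -scalemxAr; congr (_ *: _).
rewrite mulmx_suml mulmx_sumr; apply: eq_bigr => h hl.
rewrite /tact !kron_mul mul1mx mulmx1 /= /comp_ract cmapE //.
by apply: comp_rst; rewrite groupV.
Qed.

Lemma avg_e2 : avg A Y *m kron 1%:M (cbasis B C) = kron 1%:M (cbasis B C) *m G1'.
Proof.
rewrite /avg /G1' -scalemxAl -scalemxAr; congr (_ *: _).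
rewrite mulmx_suml mulmx_sumr; apply: eq_bigr => h hl.
rewrite /tact !kron_mul mul1mx mulmx1 /= /comp_lact cmapE //.
exact: comp_lst.
Qed.

Lemma e1_G : (e1 <= G1 *m G2)%MS.
Proof.
rewrite /e1 -(cbasis_avg X C) -mulmxA avg_e1 mulmxA -{1}(cbasis_avg A B).
rewrite kron_mull -!mulmxA; do 2!apply: mulmx_sub; exact: submx_refl.
Qed.

Lemma G_e1 : (G1 *m G2 <= e1)%MS.
Proof.
have /submxP[D dD] := avg_cbasis A B; rewrite /G1 dD.
rewrite kron_mull -mulmxA -avg_e1.
have /submxP[D' ->] := avg_cbasis X C.
by rewrite -mulmxA; do 2!apply: mulmx_sub.
Qed.

Lemma e2_G : (e2 <= G1 *m G2)%MS.
Proof.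
rewrite /e2 -(cbasis_avg A Y) -(mulmxA (cbasis A Y)) avg_e2 mulmxA -{1}(cbasis_avg B C).
rewrite kron_mulr -!mulmxA G1R (mulmxA (kron _ (avg _ _))) G2R.
rewrite -mulmxA -G12C; do 3!apply: mulmx_sub; exact: submx_refl.
Qed.

Lemma G_e2 : (G1 *m G2 <= e2)%MS.
Proof.
have -> : G1 *m G2 = ascmx' _ _ _ *m (G2' *m G1' *m R).
  rewrite -mulmxA G1R (mulmxA G2') G2R -mulmxA -G12C.
  by rewrite [RHS]mulmxA ascmx'V mul1mx.
apply: mulmx_sub; have /submxP[D dD] := avg_cbasis B C; rewrite /G2' dD.
rewrite kron_mulr -!mulmxA (mulmxA (kron _ (cbasis _ _))) -avg_e2.
have /submxP[D' ->] := avg_cbasis A Y.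
by rewrite /e2 -!mulmxA; do 2!apply: mulmx_sub.
Qed.

Lemma ascmx_free : row_free R.
Proof. by apply/row_freeP; exists (ascmx' _ _ _); exact: ascmxV. Qed.

Lemma row_freeM p q r (f : 'M[F]_(p, q)) (g : 'M_(q, r)) :
  row_free f -> row_free g -> row_free (f *m g).
Proof. by move=> ff gf; rewrite /row_free mxrankMfree. Qed.

Let P x := \sum_(p : 'S_n * 'S_n | p.1 *c p.2 == x)
   kron (tproj F (sdim A) (sdim B) p.1) (gproj (sdim C) p.2).
Let P' x := \sum_(p : 'S_n * 'S_n | p.1 *c p.2 == x)
   kron (gproj (sdim A) p.1) (tproj F (sdim B) (sdim C) p.2).

Lemma P'R x : P' x *m R = R *m P x.
Proof.
have PE : P x = \sum_y kron (tproj F (sdim A) (sdim B) y) (gproj (sdim C) (y^-1%g *c x)).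
  rewrite /P (eq_bigl (fun p => predT p.1 && (p.2 == p.1^-1%g *c x))); last first.
    move=> p /=; apply/eqP/eqP => [<-|->]; first by rewrite pcompK.
    by rewrite pcompVK.
  rewrite -(pair_big_dep predT (fun y z => z == y^-1%g *c x)
     (fun y z => kron (tproj F (sdim A) (sdim B) y) (gproj (sdim C) z))) /=.
  by apply: eq_bigr => y _; rewrite big_pred1_eq.
have P'E : P' x = \sum_y kron (gproj (sdim A) y) (tproj F (sdim B) (sdim C) (y^-1%g *c x)).
  rewrite /P' (eq_bigl (fun p => predT p.1 && (p.2 == p.1^-1%g *c x))); last first.
    move=> p /=; apply/eqP/eqP => [<-|->]; first by rewrite pcompK.
    by rewrite pcompVK.
  rewrite -(pair_big_dep predT (fun y z => z == y^-1%g *c x)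
     (fun y z => kron (gproj (sdim A) y) (tproj F (sdim B) (sdim C) z))) /=.
  by apply: eq_bigr => y _; rewrite big_pred1_eq.
rewrite PE P'E mulmx_suml mulmx_sumr.
transitivity (\sum_y \sum_z R *m kron (kron (gproj (sdim A) y) (gproj (sdim B) z))
    (gproj (F := F) (sdim C) (z^-1%g *c (y^-1%g *c x)))).
  apply: eq_bigr => y _; rewrite tprojE kron_sumr mulmx_suml.
  by apply: eq_bigr => z _; rewrite kronA.
transitivity (\sum_y \sum_z R *m kron (kron (gproj (sdim A) z) (gproj (sdim B) (z^-1%g *c y)))
    (gproj (F := F) (sdim C) (y^-1%g *c x))); last first.
  by apply: eq_bigr => y _; rewrite tprojE kron_suml mulmx_sumr.
rewrite [RHS]exchange_big; apply: eq_bigr => y _ /=.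
rewrite [RHS](reindex_inj (@pcompI _ y)) /=; apply: eq_bigr => z _.
by rewrite pcompK pcompA pinvM.
Qed.

Lemma comp_assoc : cls (conv A (conv B C)) = cls (conv (conv A B) C).
Proof.
apply: (@cls_embed _ _ (conv A (conv B C)) (conv (conv A B) C) _ P (fun g => kron (kron (lact A g) 1%:M) 1%:M)
   (fun g => kron (kron 1%:M 1%:M) (ract C g)) e2 e1).
- apply: row_freeM ascmx_free; apply: row_freeM (cbasis_free _ _) _.
  exact: kron_free (row_free1 _ _) (cbasis_free _ _).
- apply: row_freeM (cbasis_free _ _) _.
  exact: kron_free (cbasis_free _ _) (row_free1 _ _).
- exact: submx_trans e2_G G_e1.
- exact: submx_trans e1_G G_e2.
- move=> x; rewrite /e2 !mulmxA -cbasis_proj -!mulmxA -P'R; congr (_ *m _).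
  rewrite !mulmxA; congr (_ *m _).
  rewrite /tproj /P' mulmx_suml mulmx_sumr; apply: eq_bigr => p _.
  by rewrite !kron_mul mulmx1 mul1mx cbasis_proj.
- move=> x; rewrite /e1 !mulmxA -cbasis_proj -!mulmxA; congr (_ *m _).
  rewrite /tproj /P mulmx_suml mulmx_sumr; apply: eq_bigr => p _.
  by rewrite !kron_mul mulmx1 mul1mx cbasis_proj.
- move=> g gn; rewrite /e2 /= /comp_lact !mulmxA cmapE; last exact: comp_lst.
  rewrite -!mulmxA; congr (_ *m _); rewrite -kronA !mulmxA; congr (_ *m _).
  by rewrite !kron_mul !mul1mx !mulmx1 kron11 mulmx1.
- move=> g gn; rewrite /e1 /= /comp_lact !mulmxA cmapE; last exact: comp_lst.
  rewrite -!mulmxA; congr (_ *m _).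
  rewrite !kron_mul !mul1mx -cmapE //; exact: comp_lst.
- move=> g gn; rewrite /e2 /= /comp_ract !mulmxA cmapE; last exact: comp_rst.
  rewrite -!mulmxA; congr (_ *m _); rewrite -kronA !mulmxA; congr (_ *m _).
  rewrite !kron_mul !mul1mx -cmapE //; exact: comp_rst.
- move=> g gn; rewrite /e1 /= /comp_ract !mulmxA cmapE; last exact: comp_rst.
  rewrite -!mulmxA; congr (_ *m _).
  by rewrite !kron_mul !mul1mx !mulmx1 kron11 mulmx1.
Qed.
End Assoc.
End Isomorphisms.

Section Constant.
Variables (F : numFieldType) (n : nat).
Implicit Types nu mu la : part n.

Section Sheaf.
Variables (nu mu : part n) (D : {set 'S_n}).

(* The union of the double cosets meeting D; it is D itself when D is stable. *)
Definition csupp : {set 'S_n} := \bigcup_(w in D) dcoset (young nu) w (young mu).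

Lemma csuppP x : reflect (exists g w h, [/\ g \in young nu, w \in D, h \in young mu &
  x = g *c w *c h]) (x \in csupp).
Proof.
apply: (iffP bigcupP) => [[w wD /imset2P[g h gn hm ->]]|[g [w [h [gn wD hm ->]]]]].
  by exists g, w, h.
by exists w => //; apply/imset2P; exists g h.
Qed.

Lemma csupp_l g x : g \in young nu -> (g *c x \in csupp) = (x \in csupp).
Proof.
have st y z : y \in young nu -> z \in csupp -> y *c z \in csupp.
  move=> yn /csuppP[g' [w [h [g'n wD hm ->]]]]; apply/csuppP.
  by exists (y *c g'), w, h; rewrite youngM ?pcompA.
move=> gn; apply/idP/idP => [h|]; last exact: st.
by rewrite -(pcompK g x); apply: st h; rewrite groupV.
Qed.

Lemma csupp_r h x : h \in young mu -> (x *c h \in csupp) = (x \in csupp).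
Proof.
have st y z : y \in young mu -> z \in csupp -> z *c y \in csupp.
  move=> yn /csuppP[g' [w [k [g'n wD hm ->]]]]; apply/csuppP.
  by exists g', w, (k *c y); rewrite youngM ?pcompA.
move=> gn; apply/idP/idP => [hh|]; last exact: st.
by rewrite -(pcomp1 x) -(pcompV h) pcompA; apply: st hh; rewrite groupV.
Qed.

Definition cst_dim (x : 'S_n) : nat := x \in csupp.

Lemma cst_deg (i : 'I_(tdim cst_dim)) : deg i \in csupp.
Proof.
rewrite /deg; case: (enum_val i) => x /= k.
have : (0 < cst_dim x)%N by apply: leq_ltn_trans (ltn_ord k).
by rewrite lt0b.
Qed.

Lemma cst_deg_inj : injective (@deg n cst_dim).
Proof.
move=> i j; rewrite /deg => ij; apply: enum_val_inj.
move: (enum_val i) (enum_val j) ij => [x k] [y l] /= xy; subst y; congr existT.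
have k0 (m : 'I_(cst_dim x)) : m = 0%N :> nat.
  apply/eqP; rewrite -leqn0 -ltnS; apply: leq_trans (ltn_ord m) _.
  exact: leq_b1.
by apply: val_inj; rewrite /= !k0.
Qed.

Lemma cst_idx x : x \in csupp -> exists i : 'I_(tdim cst_dim), deg i = x.
Proof.
move=> xs; have h : (0 < cst_dim x)%N by rewrite /cst_dim xs.
exists (enum_rank (Tagged (fun x => 'I_(cst_dim x)) (Ordinal h) : gbasis cst_dim)).
by rewrite /deg enum_rankK.
Qed.

Definition cst_lact (g : 'S_n) : 'M[F]_(tdim cst_dim) :=
  \matrix_(i, j) (deg j == g *c deg i)%:R.
Definition cst_ract (h : 'S_n) : 'M[F]_(tdim cst_dim) :=
  \matrix_(i, j) (deg j == deg i *c h)%:R.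

Lemma cst_mul (r s t : 'S_n -> 'S_n) (f g : 'M[F]_(tdim cst_dim)) :
  (forall x, x \in csupp -> r x \in csupp) ->
  f = \matrix_(i, j) (deg j == r (deg i))%:R ->
  g = \matrix_(i, j) (deg j == s (deg i))%:R ->
  f *m g = \matrix_(i, j) (deg j == s (r (deg i)))%:R.
Proof.
move=> rs -> ->; apply/matrixP=> i j; rewrite !mxE.
have [k kE] := cst_idx (rs _ (cst_deg i)).
rewrite (bigD1 k) //= !mxE kE eqxx mul1r big1 ?addr0 // => l lk.
by rewrite !mxE -kE (inj_eq cst_deg_inj) (negPf lk) mul0r.
Qed.

Fact cst_lact1 : cst_lact 1%g = 1%:M.
Proof. by apply/matrixP=> i j; rewrite !mxE p1comp (inj_eq cst_deg_inj) eq_sym. Qed.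
Fact cst_ract1 : cst_ract 1%g = 1%:M.
Proof. by apply/matrixP=> i j; rewrite !mxE pcomp1 (inj_eq cst_deg_inj) eq_sym. Qed.
Fact cst_lactM : {in young nu &, forall g h,
  cst_lact (g *c h) = cst_lact h *m cst_lact g}.
Proof.
move=> g h gn hn; rewrite (@cst_mul (pcomp h) (pcomp g) id) // => [|x].
  by apply/matrixP=> i j; rewrite !mxE pcompA.
by rewrite csupp_l.
Qed.
Fact cst_ractM : {in young mu &, forall g h,
  cst_ract (g *c h) = cst_ract g *m cst_ract h}.
Proof.
move=> g h gn hn; rewrite (@cst_mul (fun x => x *c g) (fun x => x *c h) id) // => [|x].
  by apply/matrixP=> i j; rewrite !mxE pcompA.
by rewrite csupp_r.
Qed.
Fact cst_lractC : {in young nu & young mu, forall g h,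
  cst_lact g *m cst_ract h = cst_ract h *m cst_lact g}.
Proof.
move=> g h gn hm; rewrite (@cst_mul (pcomp g) (fun x => x *c h) id) // => [|x]; last first.
  by rewrite csupp_l.
rewrite (@cst_mul (fun x => x *c h) (pcomp g) id) // => [|x]; last by rewrite csupp_r.
by apply/matrixP=> i j; rewrite !mxE pcompA.
Qed.
Fact cst_lact_homog : {in young nu, forall g,
  homog (fun x => g *c x) (cst_lact g)}.
Proof. by move=> g _ i j; rewrite mxE; case: (deg j =P _) => // _; rewrite eqxx. Qed.
Fact cst_ract_homog : {in young mu, forall h,
  homog (fun x => x *c h) (cst_ract h)}.
Proof. by move=> g _ i j; rewrite mxE; case: (deg j =P _) => // _; rewrite eqxx. Qed.

(* C on every element of csupp, 0 elsewhere, with actions by identity maps. *)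
Definition cst_sheaf : sheaf F nu mu :=
  Sheaf cst_lact1 cst_lactM cst_ract1 cst_ractM cst_lractC
        cst_lact_homog cst_ract_homog.
End Sheaf.

Lemma csupp_stable nu mu (D : {set 'S_n}) :
  {in young nu & D, forall g w, g *c w \in D} ->
  {in D & young mu, forall w h, w *c h \in D} -> csupp nu mu D = D.
Proof.
move=> Dl Dr; apply/setP=> x; apply/csuppP/idP => [[g [w [h [gn wD hm ->]]]]|xD].
  by apply: Dr => //; apply: Dl.
by exists 1%g, x, 1%g; rewrite !group1 p1comp pcomp1.
Qed.

Lemma tproj_vec (d e : 'S_n -> nat) (M : 'M[F]_(tdim d, tdim e)) x :
  mxvec M *m tproj F d e x =
  mxvec (\matrix_(i, j) (M i j *+ (deg i *c deg j == x))).
Proof.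
rewrite tprojE mulmx_sumr.
have -> : (\matrix_(i, j) (M i j *+ (deg i *c deg j == x))) =
    \sum_y (gproj d y)^T *m M *m gproj e (y^-1%g *c x).
  apply/matrixP=> i j; rewrite !mxE summxE (bigD1 (deg i)) //= big1 ?addr0.
    rewrite mul_gprojE tr_diag_mx gproj_mulE eqxx mul1r mulr_natr.
    by rewrite -(inj_eq (@pcompI _ (deg i)^-1%g)) pcompK.
  move=> y yi; rewrite mul_gprojE tr_diag_mx gproj_mulE eq_sym (negPf yi).
  by rewrite !mul0r.
by rewrite linear_sum /=; apply: eq_bigr => y _; rewrite kronE.
Qed.

Section UnitLeft.
Variables (nu mu : part n) (A : sheaf F nu mu).
Let U := cst_sheaf nu nu (young nu).

Lemma csupp_young : csupp nu nu (young nu) = young nu.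
Proof. by apply: csupp_stable => g h gn hn; rewrite youngM. Qed.

Lemma deg_young (i : 'I_(sdimT U)) : deg i \in young nu.
Proof. by rewrite -csupp_young; apply: cst_deg. Qed.

Definition unl_fun (v : 'rV[F]_(sdimT A)) : 'rV[F]_(sdimT U * sdimT A) :=
  mxvec (\matrix_(i < sdimT U) (v *m lact A (deg i)^-1%g)).

Fact unl_linear : linear unl_fun.
Proof.
move=> k u v; rewrite /unl_fun -linearP; congr mxvec; apply/row_matrixP=> i.
by rewrite linearP /= !rowK mulmxDl -scalemxAl.
Qed.
HB.instance Definition _ := GRing.isLinear.Build F _ _ *:%R unl_fun unl_linear.

Let E := lin1_mx unl_fun.

Lemma unlE (v : 'rV[F]_(sdimT A)) :
  v *m E = mxvec (\matrix_(i < sdimT U) (v *m lact A (deg i)^-1%g)).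
Proof. by rewrite mul_rV_lin1. Qed.

Lemma ex_one : exists i : 'I_(sdimT U), deg i = 1%g.
Proof. by apply: cst_idx; rewrite csupp_young group1. Qed.

Lemma unl_free : row_free E.
Proof.
apply: inj_row_free => v; rewrite unlE => /(congr1 vec_mx); rewrite mxvecK linear0.
have [i i1] := ex_one; move/(congr1 (row i)); rewrite rowK row0 i1 invg1 lact1.
by rewrite mulmx1.
Qed.

Lemma row_lact_tr m (M : 'M[F]_(sdimT U, m)) g i j : g \in young nu ->
  deg i = g *c deg j -> row i ((lact U g)^T *m M) = row j M.
Proof.
move=> gn ij; rewrite row_mul; have -> : row i (lact U g)^T = delta_mx 0 j.
  apply/rowP=> k; rewrite !mxE ij (inj_eq (@pcompI _ g)) (inj_eq (@cst_deg_inj _ _ _)).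
  by rewrite eq_sym eqxx.
by rewrite -rowE.
Qed.
Lemma row_ract_tr m (M : 'M[F]_(sdimT U, m)) h i j :
  deg i = deg j *c h -> row i ((ract U h)^T *m M) = row j M.
Proof.
move=> ij; rewrite row_mul; have -> : row i (ract U h)^T = delta_mx 0 j.
  apply/rowP=> k; rewrite !mxE ij (inj_eq (@pcompIr _ h)) (inj_eq (@cst_deg_inj _ _ _)).
  by rewrite eq_sym eqxx.
by rewrite -rowE.
Qed.

Lemma idx_young x : x \in young nu -> exists i : 'I_(sdimT U), deg i = x.
Proof. by move=> xn; apply: cst_idx; rewrite csupp_young. Qed.

Lemma unl_tact w : w \in young nu -> E *m tact U A w = E.
Proof.
move=> wn; apply/row_matrixP=> r; rewrite row_mul rowE unlE kronE.
congr mxvec; apply/row_matrixP=> i; set M := \matrix_i _.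
have [j jE] : exists j : 'I_(sdimT U), deg j = deg i *c w.
  by apply: idx_young; rewrite youngM ?deg_young.
rewrite row_mul (@row_ract_tr _ _ _ i j); last first.
  by rewrite jE -pcompA pcompV pcomp1.
rewrite !rowK jE pinvM lactM ?groupV ?deg_young // -!mulmxA -lactM ?groupV //.
by rewrite pcompV lact1 mulmx1.
Qed.

Lemma unl_sub : (E <= cbasis U A)%MS.
Proof. by rewrite sub_cbasis avg_fix // => w; apply: unl_tact. Qed.

Lemma sub_unl : (cbasis U A <= E)%MS.
Proof.
apply/row_subP=> r; set u := row r _.
have uE w : w \in young nu -> u *m tact U A w = u.
  by move=> wn; rewrite -row_mul cbasis_tact.
have [i0 i0E] := ex_one.
rewrite -(vec_mxK u); move: uE; rewrite -{1 2}(vec_mxK u); move: (vec_mx u) => M ME.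
suff -> : mxvec M = row i0 M *m E by apply: submxMl.
rewrite unlE; congr mxvec; apply/row_matrixP=> i; rewrite rowK.
have /ME : (deg i)^-1%g \in young nu by rewrite groupV deg_young.
rewrite kronE => /(can_inj mxvecK) /(congr1 (row i)) <-.
rewrite row_mul (@row_ract_tr _ _ _ i i0) // i0E.
by rewrite invgK p1comp.
Qed.

Lemma comp_unl : cls A = cls (conv U A).
Proof.
apply: (@cls_embed _ _ _ _ A (conv U A) _ (tproj F (sdim U) (sdim A))
   (fun g => kron (lact U g) 1%:M) (fun g => kron 1%:M (ract A g)) E (cbasis U A)).
- exact: unl_free.
- exact: cbasis_free.
- exact: unl_sub.
- exact: sub_unl.
- move=> x; apply/row_matrixP=> r; rewrite !row_mul !(rowE r) !unlE tproj_vec.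
  congr mxvec; apply/row_matrixP=> i; apply/rowP=> k; rewrite rowK.
  have /(homogP _ (@pcompI _ _)) h : homog (fun x => (deg i)^-1%g *c x) (lact A (deg i)^-1%g).
    by apply: lact_homog; rewrite groupV deg_young.
  rewrite -mulmxA h mulmxA mul_gprojE !mxE mulr_natr; congr (_ *+ _).
  by rewrite -(inj_eq (@pcompI _ (deg i))) pcompVK.
- move=> x; exact: esym (cbasis_proj _ _ _).
- move=> g gn; apply/row_matrixP=> r; rewrite !row_mul !(rowE r) !unlE kronE mulmx1.
  congr mxvec; apply/row_matrixP=> i; rewrite rowK.
  have [j jE] : exists j : 'I_(sdimT U), deg j = g^-1%g *c deg i.
    by apply: idx_young; rewrite youngM ?groupV ?deg_young.
  rewrite (@row_lact_tr _ _ _ i j) //; last by rewrite jE pcompVK.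
  rewrite rowK jE pinvM invgK lactM ?groupV ?deg_young //.
  by rewrite mulmxA.
- by move=> g gn; rewrite /= /comp_lact cmapE //; apply: comp_lst.
- move=> g gn; apply/row_matrixP=> r; rewrite !row_mul !(rowE r) !unlE kronE trmx1 mul1mx.
  congr mxvec; apply/row_matrixP=> i; rewrite row_mul !rowK -!mulmxA lractC //.
  by rewrite groupV deg_young.
- by move=> g gn; rewrite /= /comp_ract cmapE //; apply: comp_rst.
Qed.
End UnitLeft.

Section UnitRight.
Variables (nu mu : part n) (A : sheaf F nu mu).
Let U := cst_sheaf mu mu (young mu).

Definition unr_fun (v : 'rV[F]_(sdimT A)) : 'rV[F]_(sdimT A * sdimT U) :=
  mxvec (\matrix_(j < sdimT U) (v *m ract A (deg j)^-1%g))^T.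

Fact unr_linear : linear unr_fun.
Proof.
move=> k u v; rewrite /unr_fun -!linearP; congr (mxvec _^T); apply/row_matrixP=> i.
by rewrite linearP /= !rowK mulmxDl -scalemxAl.
Qed.
HB.instance Definition _ := GRing.isLinear.Build F _ _ *:%R unr_fun unr_linear.

Let E := lin1_mx unr_fun.

Lemma unrE (v : 'rV[F]_(sdimT A)) :
  v *m E = mxvec (\matrix_(i < sdimT U) (v *m ract A (deg i)^-1%g))^T.
Proof. by rewrite mul_rV_lin1. Qed.

Lemma unr_free : row_free E.
Proof.
apply: inj_row_free => v; rewrite unrE => /(congr1 vec_mx); rewrite mxvecK linear0.
have [i i1] := ex_one mu; move/(congr1 trmx); rewrite trmxK trmx0.
by move/(congr1 (row i)); rewrite rowK row0 i1 invg1 ract1 mulmx1.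
Qed.

Lemma unr_tact w : w \in young mu -> E *m tact A U w = E.
Proof.
move=> wn; apply/row_matrixP=> r; rewrite row_mul rowE unrE kronE.
congr mxvec; apply: trmx_inj; rewrite !trmx_mul !trmxK.
apply/row_matrixP=> i; set M := \matrix_i _.
have [j jE] : exists j : 'I_(sdimT U), deg j = w^-1%g *c deg i.
  by apply: idx_young; rewrite youngM ?groupV ?deg_young.
rewrite (@row_lact_tr _ _ _ _ i j) //; last by rewrite jE pcompVK.
rewrite row_mul !rowK jE pinvM invgK ractM ?groupV ?deg_young // -!mulmxA -ractM ?groupV //.
by rewrite pcompV ract1 mulmx1.
Qed.

Lemma unr_sub : (E <= cbasis A U)%MS.
Proof. by rewrite sub_cbasis avg_fix // => w; apply: unr_tact. Qed.

Lemma sub_unr : (cbasis A U <= E)%MS.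
Proof.
apply/row_subP=> r; set u := row r _.
have uE w : w \in young mu -> u *m tact A U w = u.
  by move=> wn; rewrite -row_mul cbasis_tact.
have [i0 i0E] := ex_one mu.
rewrite -(vec_mxK u); move: uE; rewrite -{1 2}(vec_mxK u); move: (vec_mx u) => M ME.
suff -> : mxvec M = row i0 M^T *m E by apply: submxMl.
rewrite unrE; congr mxvec; apply: trmx_inj; rewrite trmxK.
apply/row_matrixP=> i; rewrite rowK.
have /ME : deg i \in young mu by rewrite deg_young.
rewrite kronE => /(can_inj mxvecK) /(congr1 trmx) /(congr1 (row i)) <-.
rewrite !trmx_mul trmxK (@row_lact_tr _ _ _ _ i i0) ?deg_young ?i0E ?pcomp1 //.
by rewrite row_mul.
Qed.

Lemma comp_unr : cls A = cls (conv A U).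
Proof.
apply: (@cls_embed _ _ _ _ A (conv A U) _ (tproj F (sdim A) (sdim U))
   (fun g => kron (lact A g) 1%:M) (fun g => kron 1%:M (ract U g)) E (cbasis A U)).
- exact: unr_free.
- exact: cbasis_free.
- exact: unr_sub.
- exact: sub_unr.
- move=> x; apply/row_matrixP=> r; rewrite !row_mul !(rowE r) !unrE tproj_vec.
  congr mxvec; apply: trmx_inj; rewrite trmxK.
  apply/row_matrixP=> i; apply/rowP=> k; rewrite rowK.
  have /(homogP _ (@pcompIr _ _)) h : homog (fun x => x *c (deg i)^-1%g) (ract A (deg i)^-1%g).
    by apply: ract_homog; rewrite groupV deg_young.
  rewrite -mulmxA h mulmxA mul_gprojE !mxE mulr_natr; congr (_ *+ _).
  by rewrite -(inj_eq (@pcompIr _ (deg i))) -pcompA pVcomp pcomp1.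
- move=> x; exact: esym (cbasis_proj _ _ _).
- move=> g gn; apply/row_matrixP=> r; rewrite !row_mul !(rowE r) !unrE kronE mulmx1.
  congr mxvec; apply: trmx_inj; rewrite trmx_mul !trmxK.
  apply/row_matrixP=> i; rewrite row_mul !rowK -!mulmxA lractC //.
  by rewrite groupV deg_young.
- by move=> g gn; rewrite /= /comp_lact cmapE //; apply: comp_lst.
- move=> g gn; apply/row_matrixP=> r; rewrite !row_mul !(rowE r) !unrE kronE trmx1 mul1mx.
  congr mxvec; apply: trmx_inj; rewrite trmx_mul !trmxK.
  apply/row_matrixP=> i; rewrite rowK.
  have [j jE] : exists j : 'I_(sdimT U), deg j = deg i *c g^-1%g.
    by apply: idx_young; rewrite youngM ?groupV ?deg_young.
  rewrite (@row_ract_tr _ _ _ _ i j) //; last by rewrite jE -pcompA pVcomp pcomp1.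
  rewrite rowK jE pinvM invgK ractM ?groupV ?deg_young //.
  by rewrite mulmxA.
- by move=> g gn; rewrite /= /comp_ract cmapE //; apply: comp_rst.
Qed.
End UnitRight.
End Constant.

Section Ring.
Variables (F : numFieldType) (n : nat).
Implicit Types nu mu la ka : part n.

Section ProductTheory.
Lemma kmulDl nu mu la (y : groth F mu la) : {morph (fun x : groth F nu mu => kmul x y) : x x' / x + x'}.
Proof.
move=> x x'; have k0 : kmul 0 y = 0 :> groth F nu la.
  by have := kmulBl y (0 : groth F nu mu) 0; rewrite !subrr.
have kN z : kmul (- z) y = - kmul z y :> groth F nu la.
  by have := kmulBl y (0 : groth F nu mu) z; rewrite !sub0r k0 sub0r.
by have := kmulBl y x (- x'); rewrite /= opprK kN opprK.
Qed.
Lemma kmulDr nu mu la (x : groth F nu mu) : {morph (fun y : groth F mu la => kmul x y) : y y' / y + y'}.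
Proof.
move=> y y'; have k0 : kmul x 0 = 0 :> groth F nu la.
  by have := kmulBr x (0 : groth F mu la) 0; rewrite !subrr.
have kN z : kmul x (- z) = - kmul x z :> groth F nu la.
  by have := kmulBr x (0 : groth F mu la) z; rewrite !sub0r k0 sub0r.
by have := kmulBr x y (- y'); rewrite /= opprK kN opprK.
Qed.
Lemma kmul0l nu mu la (y : groth F mu la) : kmul 0 y = 0 :> groth F nu la.
Proof. by have := kmulBl y (0 : groth F nu mu) 0; rewrite !subrr. Qed.
Lemma kmul0r nu mu la (x : groth F nu mu) : kmul x 0 = 0 :> groth F nu la.
Proof. by have := kmulBr x (0 : groth F mu la) 0; rewrite !subrr. Qed.

Lemma kmulA nu mu la ka (x : groth F nu mu) (y : groth F mu la) (z : groth F la ka) :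
  kmul x (kmul y z) = kmul (kmul x y) z.
Proof.
move: x; apply: groth_ext => [x x'|x x'|A]; first exact: kmulBl.
  by rewrite !kmulBl.
move: y; apply: groth_ext => [y y'|y y'|B]; first by rewrite !(kmulBl, kmulBr).
  by rewrite !(kmulBl, kmulBr).
move: z; apply: groth_ext => [z z'|z z'|C]; first by rewrite !kmulBr.
  by rewrite !kmulBr.
by rewrite !kmul_cls comp_assoc.
Qed.

Lemma kmul1l nu mu (x : groth F nu mu) : kmul (cls (cst_sheaf F nu nu (young nu))) x = x.
Proof.
move: x; apply: groth_ext => [x x'|x x'|A] //; first by rewrite kmulBr.
by rewrite kmul_cls -comp_unl.
Qed.
Lemma kmul1r nu mu (x : groth F nu mu) : kmul x (cls (cst_sheaf F mu mu (young mu))) = x.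
Proof.
move: x; apply: groth_ext => [x x'|x x'|A] //; first by rewrite kmulBl.
by rewrite kmul_cls -comp_unr.
Qed.
End ProductTheory.

(* R_[n]: the (nu, la) entry is the component in the Grothendieck group of
   Sh([S_nu \ S_n / S_la]), and the product is the product of matrices. *)
Definition partring : Type := {dffun forall p : part n * part n, groth F p.1 p.2}.
HB.instance Definition _ := Choice.on partring.
Implicit Types x y z : partring.

Definition entry x nu la : groth F nu la := x (nu, la).

Definition pr_zero : partring := [ffun p => 0].
Definition pr_opp x : partring := [ffun p => - x p].
Definition pr_add x y : partring := [ffun p => x p + y p].
Definition pr_one : partring :=
  [ffun p => if p.1 == p.2 then cls (cst_sheaf F p.1 p.2 (young p.1)) else 0].
Definition pr_mul x y : partring :=
  [ffun p => \sum_mu kmul (entry x p.1 mu) (entry y mu p.2)].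

Fact pr_addA : associative pr_add.
Proof. by move=> x y z; apply/ffunP=> p; rewrite !ffunE addrA. Qed.
Fact pr_addC : commutative pr_add.
Proof. by move=> x y; apply/ffunP=> p; rewrite !ffunE addrC. Qed.
Fact pr_add0 : left_id pr_zero pr_add.
Proof. by move=> x; apply/ffunP=> p; rewrite !ffunE add0r. Qed.
Fact pr_addN : left_inverse pr_zero pr_opp pr_add.
Proof. by move=> x; apply/ffunP=> p; rewrite !ffunE addNr. Qed.
HB.instance Definition _ := GRing.isZmodule.Build partring pr_addA pr_addC pr_add0 pr_addN.

Fact pr_mulA : associative pr_mul.
Proof.
move=> x y z; apply/ffunP=> -[nu ka]; rewrite !ffunE /=.
transitivity (\sum_mu \sum_la kmul (entry x nu mu) (kmul (entry y mu la) (entry z la ka))).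
  apply: eq_bigr => mu _; rewrite /entry ffunE /=.
  by elim/big_rec2: _ => [|la u v _ <-]; rewrite (kmul0r, kmulDr).
rewrite exchange_big; apply: eq_bigr => la _; rewrite /entry ffunE /=.
transitivity (\sum_mu kmul (kmul (entry x nu mu) (entry y mu la)) (entry z la ka)).
  by apply: eq_bigr => mu _; rewrite kmulA.
by elim/big_rec2: _ => [|mu u v _ ->]; rewrite (kmul0l, kmulDl).
Qed.
Fact pr_mul1l : left_id pr_one pr_mul.
Proof.
move=> x; apply/ffunP=> -[nu la]; rewrite !ffunE /= (bigD1 nu) //= big1 ?addr0.
  by rewrite /entry ffunE /= eqxx kmul1l.
by move=> mu mn; rewrite /entry ffunE /= eq_sym (negPf mn) kmul0l.
Qed.
Fact pr_mul1r : right_id pr_one pr_mul.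
Proof.
move=> x; apply/ffunP=> -[nu la]; rewrite !ffunE /= (bigD1 la) //= big1 ?addr0.
  by rewrite /entry ffunE /= eqxx kmul1r.
by move=> mu mn; rewrite /entry ffunE /= (negPf mn) kmul0r.
Qed.
Fact pr_mulDl : left_distributive pr_mul +%R.
Proof.
move=> x y z; apply/ffunP=> -[nu la]; rewrite !ffunE /= -big_split /=.
by apply: eq_bigr => mu _; rewrite /entry ffunE kmulDl.
Qed.
Fact pr_mulDr : right_distributive pr_mul +%R.
Proof.
move=> x y z; apply/ffunP=> -[nu la]; rewrite !ffunE /= -big_split /=.
by apply: eq_bigr => mu _; rewrite /entry ffunE kmulDr.
Qed.
HB.instance Definition _ := GRing.Zmodule_isPzRing.Build partring
  pr_mulA pr_mul1l pr_mul1r pr_mulDl pr_mulDr.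

Definition summand nu la (x : partring) : Prop := forall p, p != (nu, la) -> x p = 0.

(* The class in the summand (nu, mu) of the sheaf C on csupp nu mu D. *)
Definition cst_class nu mu (D : {set 'S_n}) : partring :=
  [ffun p => if p == (nu, mu) then cls (cst_sheaf F p.1 p.2 D) else 0].

(* Meaningful when nu and mu are part_comparable, the support being then the larger
   of the two Young subgroups: see pone_supp. *)
Definition pone nu mu : partring :=
  cst_class nu mu (if refines mu nu then young nu else young mu).

(* The support of each term is the double coset of w, see pstar_supp. *)
Definition pstar (w : 'S_n) : partring := \sum_la cst_class (pact w la) la [set w].

End Ring.

Arguments partring F n : clear implicits.
Arguments pone F {n} nu mu.
Arguments pstar F {n} w.

Section Supports.
Variable n : nat.
Implicit Types nu mu la : part n.

Lemma youngS mu nu : refines mu nu -> young mu \subset young nu.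
Proof.
move=> /forall_inP mn; apply/subsetP=> s; rewrite !inE => /forall_inP sm.
apply/forall_inP=> B nB; rewrite eqEcard card_imset ?leqnn ?andbT; last exact: perm_inj.
apply/subsetP=> _ /imsetP[i iB ->].
have [C mC iC] := part_ex mu i; have /exists_inP[B' nB' /subsetP CB] := mn C mC.
rewrite (part_eq nB nB' iB (CB _ iC)); apply: CB.
by rewrite -(eqP (sm C mC)) imset_f.
Qed.

Lemma pone_supp nu mu : part_comparable nu mu ->
  let G := if refines mu nu then young nu else young mu in
  [/\ young nu \subset G, young mu \subset G & csupp nu mu G = G].
Proof.
move=> c /=; case: ifP c => [mn _|mn].
  split=> //; first exact: youngS.
  apply: csupp_stable => g h gn hn; rewrite youngM //.
  exact: (subsetP (youngS mn)).
rewrite /part_comparable mn orbF => nm; split=> //; first exact: youngS.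
apply: csupp_stable => g h gn hn; rewrite youngM //.
exact: (subsetP (youngS nm)).
Qed.

Lemma pstar_supp (w : 'S_n) la :
  csupp (pact w la) la [set w] = dcoset (young (pact w la)) w (young la).
Proof. by rewrite /csupp big_set1. Qed.
End Supports.

Definition zbasis (V : zmodType) (U : V -> Prop) (I : finType) (J : {set I})
    (b : I -> V) : Prop :=
  [/\ forall i, i \in J -> U (b i),
      forall x, U x -> exists c : I -> int, x = \sum_(i in J) b i *~ c i &
      forall c : I -> int, \sum_(i in J) b i *~ c i = 0 ->
        forall i, i \in J -> c i = 0].

Section Presentation.
Variable n : nat.
Implicit Types la mu nu : part n.

(* The relations between elements o nu mu and s w of a ring, up to the relation
   eqA; Z mu nu la is the set of representatives of S_mu \ S_nu / S_la over which
   the sums in the Mackey-type relation are taken. *)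
Record relations (A : pzRingType) (eqA : A -> A -> Prop)
    (o : part n -> part n -> A) (s : 'S_n -> A)
    (Z : part n -> part n -> part n -> {set 'S_n}) : Prop := Relations {
  rel_trans : forall la mu nu,
    (refines la mu && refines mu nu) || (refines nu mu && refines mu la) ->
    eqA (o nu mu * o mu la) (o nu la);
  rel_orth : forall la mu, mu != la -> eqA (o la la * o mu mu) 0;
  rel_starM : forall w z, eqA (s w * s z) (s (w *c z));
  rel_star1 : eqA (s 1%g) (\sum_la o la la);
  rel_conj : forall w mu nu, part_comparable mu nu ->
    eqA (s w * o nu mu) (o (pact w nu) (pact w mu) * s w);
  rel_absl : forall w mu nu, part_comparable mu nu -> w \in young nu ->
    eqA (s w * o nu mu) (o nu mu);
  rel_absr : forall w mu nu, part_comparable mu nu -> w \in young mu ->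
    eqA (o nu mu * s w) (o nu mu);
  rel_mackey : forall la mu nu, refines la nu -> refines mu nu ->
    eqA (o mu nu * o nu la)
        (\sum_(z in Z mu nu la) o mu (pmeet mu (pact z la)) * s z *
                                o (pmeet (pact z^-1%g mu) la) la);
  rel_mackey' : forall la mu nu, refines la nu -> refines mu nu ->
    eqA (\sum_(z in Z mu nu la) o mu (pmeet mu (pact z la)) * s z *
                                o (pmeet (pact z^-1%g mu) la) la)
        (\sum_(z in Z mu nu la) o mu (pmeet mu (pact z la)) *
                                o (pmeet mu (pact z la)) (pact z la) * s z)
}.

Definition gen : choiceType :=
  ({p : part n * part n | part_comparable p.1 p.2} + 'S_n)%type.

(* The free unital ring on gen; the free ring without unit is its ideal of
   elements p with p@_1 = 0. *)
Local Notation freering := {malg int[{fmonom gen}]}.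

(* Only used for part_comparable nu and mu. *)
Definition gen_one nu mu : freering :=
  if insub (nu, mu) is Some p then << fmu (inl p : gen) >> else 0.

Definition gen_star (w : 'S_n) : freering := << fmu (inr w : gen) >>.

Definition two_sided_ideal (A : pzRingType) (I : {pred A}) : Prop :=
  zmod_closed I /\ forall a x, x \in I -> a * x \in I /\ x * a \in I.

Variable F : numFieldType.

Definition gen_val (g : gen) : partring F n :=
  match g with inl p => pone F (val p).1 (val p).2 | inr w => pstar F w end.

Definition free_eval : freering -> partring F n :=
  zlift (fun m : {fmonom gen} => \prod_(g <- m) gen_val g).

(* Every relation among the generators follows from the relations above: it lies
   in every two-sided ideal modulo which these hold. Rings without unit are meant:
   no relation identifies s 1 with the unit of the free unital ring, of which only
   the elements without constant term are considered. *)
Definition complete_relations (Z : part n -> part n -> part n -> {set 'S_n}) : Prop :=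
  forall p : freering, p@_(fmone gen) = 0 -> free_eval p = 0 ->
  forall I : {pred freering}, two_sided_ideal I ->
  relations (fun x y => x - y \in I) gen_one gen_star Z -> p \in I.
End Presentation.

(* Main.v *)
Require Import Defs.
From HB Require Import structures.
From mathcomp Require Import all_boot all_order all_fingroup all_algebra.
From mathcomp Require Import reals complex.
From mathcomp Require Import boolp finmap monalg.
(* Again, as [ract] and others are shadowed by the group action library. *)
Require Import Defs.

Set Implicit Arguments.
Unset Strict Implicit.
Unset Printing Implicit Defensive.

Import Order.TTheory GRing.Theory Num.Theory.
Local Open Scope ring_scope.

(* A class in the Grothendieck group is determined by its character, the trace of
   (g, h) on the stalk F_x for g x h = x: when two sums of sheaves have the same
   character, averaging produces a nonzero morphism from a term of one to a term of
   the other, its image can be split off both, and one concludes by induction on the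
   dimension. All relations then become identities between numbers.

   The stalks at double coset representatives w identify the (nu, la) summand with
   a sum of representation rings of the Young subgroups S_ka, ka = nu /\ w la, and
   the alleged basis with the characters Ind_mu induced from the trivial characters
   of the S_mu, mu <= ka. Pair them with the characters induced from the signs of
   the S_mu: the pairings with an actual representation are integers, and they
   determine it, since a class function on S_ka whose sum over every S_mu vanishes is
   zero. The pairing of la and mu counts the double cosets S_mu y S_la with
   mu /\ y la = 0. Its matrix is unitriangular: such a y forces mu to have at most
   as many pairs of equivalent points as the conjugate of la, with equality only
   when mu and y la are the columns and the rows of Young diagrams, which then
   happens for a single double coset. So the Ind_mu form a Z-basis.

   Finally the relations suffice to write every product of generators as a
   combination of basis elements, so an element of the free ring that vanishes in
   R_[n] is a consequence of them. *)


(** * Set partitions and their Young subgroups *)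

(** Characters induced from trivial characters always pair positively with each other, so their Gram
    matrix has no triangular shape; it is the sign on one side that creates zeros. The classical
    order for the resulting matrix is dominance. A single number replaces it here: [npairs], the sum
    of the squares of the block sizes. Among the partitions inside [ka] that meet [la] trivially it
    is largest exactly at the conjugates of [la], so descending induction on a number solves the
    system over the integers. For completeness, an element of the free ring has to be reduced with
    the same coefficients in its quotient by an ideal and in [partring]. Both rings satisfy the
    relations, hence so does their product, and one reduction there yields both expansions:
    independence in the second component kills the coefficients, and the first component vanishes
    with them. The reduction only ever multiplies normal forms by generators on the left, so no
    formula for the product of two normal forms is required. *)

Section SameBlock.
Variable n : nat.
Implicit Types (la mu nu ka : part n) (i j k : 'I_n) (w g : 'S_n).

(** Partitions are handled through their equivalence relations: refinement becomes implication, the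
    meet a conjunction, and the action a relabelling of points. *)
Definition same la i j := pblock la i == pblock la j.

Lemma same_refl la i : same la i i. Proof. exact: eqxx. Qed.
Lemma same_sym la i j : same la i j = same la j i. Proof. exact: eq_sym. Qed.
Lemma same_trans la j i k : same la i j -> same la j k -> same la i k.
Proof. by move=> /eqP h /eqP h'; apply/eqP; rewrite h. Qed.
Lemma same_eql la i j k : same la i j -> same la i k = same la j k.
Proof. by rewrite /same => /eqP->. Qed.
Lemma same_eqr la i j k : same la i j -> same la k i = same la k j.
Proof. by rewrite /same => /eqP->. Qed.

Lemma part_triv la : trivIset la.
Proof. by case/and3P: (partP la). Qed.

Lemma mem_block la i j : (j \in pblock la i) = same la i j.
Proof.
rewrite /same eq_pblock ?(cover_partition (partP la)) ?inE //; exact: part_triv.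
Qed.

Lemma mem_block_self la i : i \in pblock la i.
Proof. by rewrite mem_block same_refl. Qed.

Lemma block_mem la B i : B \in blocks la -> i \in B -> pblock la i = B.
Proof. by move=> lB iB; apply: def_pblock iB => //; exact: part_triv. Qed.

Lemma same_in la B i j : B \in blocks la -> i \in B -> same la i j = (j \in B).
Proof. by move=> lB iB; rewrite -mem_block (block_mem lB iB). Qed.

Lemma part_same_inj la mu : same la =2 same mu -> la = mu.
Proof.
move=> lm; apply: val_inj => /=.
have sub (l m : part n) : same l =2 same m -> blocks l \subset blocks m.
  move=> e; apply/subsetP=> B lB.
  have /set0Pn[i iB] := part_neq0 lB.
  suff -> : B = pblock m i by apply: part_of_pblock.
  by rewrite -(block_mem lB iB); apply/setP=> j; rewrite !mem_block e.
by apply/eqP; rewrite eqEsubset !sub // => i j; rewrite lm.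
Qed.

Lemma refinesP la mu :
  reflect (forall i j, same la i j -> same mu i j) (refines la mu).
Proof.
apply: (iffP forall_inP) => [h i j|h B lB].
  rewrite -mem_block => ij.
  have /exists_inP[C mC /subsetP BC] := h _ (part_of_pblock la i).
  rewrite (same_in _ mC); first exact: BC.
  by apply: BC; exact: mem_block_self.
have /set0Pn[i iB] := part_neq0 lB.
apply/exists_inP; exists (pblock mu i); first exact: part_of_pblock.
by apply/subsetP=> j; rewrite -(same_in j lB iB) mem_block => /h.
Qed.

Lemma refines_refl la : refines la la.
Proof. exact/refinesP. Qed.
Lemma refines_trans mu la nu : refines la mu -> refines mu nu -> refines la nu.
Proof. by move=> /refinesP h /refinesP h'; apply/refinesP=> i j /h /h'. Qed.
Lemma refines_anti la mu : refines la mu -> refines mu la -> la = mu.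
Proof.
move=> /refinesP h /refinesP h'; apply: part_same_inj => i j.
by apply/idP/idP; [exact: h | exact: h'].
Qed.

Lemma same_meet la mu i j : same (pmeet la mu) i j = same la i j && same mu i j.
Proof.
have [B lB iB] := part_ex la i; have [C mC iC] := part_ex mu i.
have BC : B :&: C \in blocks (pmeet la mu).
  rewrite !inE imset2_f // andbT; apply/set0Pn; exists i; by rewrite inE iB.
rewrite (same_in j BC) ?inE ?iB //.
by rewrite (same_in j lB iB) (same_in j mC iC).
Qed.

Lemma same_act w la i j : same (pact w la) (w i) (w j) = same la i j.
Proof.
have [B lB iB] := part_ex la i.
have wB : w @: B \in blocks (pact w la) by apply: imset_f.
rewrite (same_in (w j) wB (imset_f w iB)) mem_imset ?(same_in j lB iB) //; exact: perm_inj.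
Qed.

Lemma same_actV w la i j : same (pact w la) i j = same la (w^-1%g i) (w^-1%g j).
Proof. by rewrite -[RHS](same_act w) !permKV. Qed.

Lemma same_bot i j : same pbot i j = (i == j).
Proof.
have Bi : [set i] \in blocks (@pbot n) by apply: imset_f.
by rewrite (same_in j Bi) ?inE // eq_sym.
Qed.

Lemma refines_bot la : refines pbot la.
Proof. by apply/refinesP=> i j; rewrite same_bot => /eqP->; apply: same_refl. Qed.

Lemma refines_meet ka la mu :
  refines ka (pmeet la mu) = refines ka la && refines ka mu.
Proof.
apply/refinesP/andP => [h|[/refinesP h1 /refinesP h2] i j ij].
  by split; apply/refinesP=> i j /h; rewrite same_meet => /andP[].
by rewrite same_meet h1 ?h2.
Qed.
Lemma pmeet_l la mu : refines (pmeet la mu) la.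
Proof. by have := refines_refl (pmeet la mu); rewrite refines_meet => /andP[]. Qed.
Lemma pmeet_r la mu : refines (pmeet la mu) mu.
Proof. by have := refines_refl (pmeet la mu); rewrite refines_meet => /andP[]. Qed.

Lemma refines_act w la mu : refines (pact w la) (pact w mu) = refines la mu.
Proof.
apply/refinesP/refinesP => h i j; first by have := h (w i) (w j); rewrite !same_act.
by rewrite !same_actV; apply: h.
Qed.

Lemma pact1 la : pact 1%g la = la.
Proof. by apply: part_same_inj => i j; rewrite same_actV invg1 !perm1. Qed.
Lemma pactM w g la : pact (w *c g) la = pact w (pact g la).
Proof.
by apply: part_same_inj => i j; rewrite !same_actV pinvM !pcompE.
Qed.
Lemma pactK w : cancel (pact w) (pact w^-1%g).
Proof. by move=> la; rewrite -pactM pVcomp pact1. Qed.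
Lemma pactVK w : cancel (pact w^-1%g) (pact w).
Proof. by move=> la; rewrite -pactM pcompV pact1. Qed.
Lemma pact_inj w : injective (pact w).
Proof. exact: can_inj (pactK w). Qed.
Lemma pact_meet w la mu : pact w (pmeet la mu) = pmeet (pact w la) (pact w mu).
Proof.
by apply: part_same_inj => i j; rewrite same_actV !same_meet !same_actV.
Qed.

Lemma part_comparable_act w la mu :
  part_comparable (pact w la) (pact w mu) = part_comparable la mu.
Proof. by rewrite /part_comparable !refines_act. Qed.
Lemma part_comparableC la mu : part_comparable la mu = part_comparable mu la.
Proof. exact: orbC. Qed.
Lemma part_comparable_refl la : part_comparable la la.
Proof. by rewrite /part_comparable refines_refl. Qed.

Lemma youngP la w : reflect (forall i, same la i (w i)) (w \in young la).
Proof.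
rewrite inE; apply: (iffP forall_inP) => [h i|h B lB].
  have [B lB iB] := part_ex la i; rewrite (same_in _ lB iB).
  by rewrite -(eqP (h B lB)) imset_f.
rewrite eqEcard card_imset ?leqnn ?andbT; last exact: perm_inj.
apply/subsetP=> _ /imsetP[i iB ->]; by rewrite -(same_in _ lB iB).
Qed.

Lemma young_meet la mu : young (pmeet la mu) = young la :&: young mu.
Proof.
apply/setP=> w; rewrite in_setI; apply/youngP/andP => [h|[/youngP h1 /youngP h2] i].
  by split; apply/youngP=> i; have := h i; rewrite same_meet => /andP[].
by rewrite same_meet h1 h2.
Qed.

Lemma young_act w la g : (g \in young (pact w la)) = (w^-1%g *c g *c w \in young la).
Proof.
apply/youngP/youngP => h i.
  by have := h (w i); rewrite same_actV permK !pcompE.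
by rewrite same_actV; have := h (w^-1%g i); rewrite !pcompE permKV.
Qed.

Lemma pact_young w la mu : refines la mu -> w \in young la -> pact w mu = mu.
Proof.
move=> /refinesP lm /youngP h; apply: part_same_inj => i j.
rewrite same_actV; have e k : same mu (w^-1%g k) k.
  by apply: lm; have := h (w^-1%g k); rewrite permKV.
by rewrite (same_eql _ (e i)) (same_eqr _ (e j)).
Qed.

Lemma pact_young_id w la : w \in young la -> pact w la = la.
Proof. by apply: pact_young; apply: refines_refl. Qed.

Lemma young_bot : young pbot = [1 'S_n]%g.
Proof.
apply/setP=> w; rewrite [RHS]inE; apply/youngP/eqP => [h|-> i].
  by apply/permP=> i; have := h i; rewrite same_bot perm1 => /eqP<-.
by rewrite perm1 same_refl.
Qed.

Lemma tperm_young la i j : same la i j -> tperm i j \in young la.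
Proof. by move=> ij; apply/youngP=> k; case: tpermP => [->|->|] //; rewrite ?same_refl // same_sym. Qed.

(** The transpositions in [young la] recover the relation [same la], so a partition can be read off
    its Young subgroup. *)
Lemma refines_young la mu : refines la mu = (young la \subset young mu).
Proof.
apply/idP/idP; first exact: youngS.
move=> /subsetP h; apply/refinesP=> i j ij.
by have /youngP/(_ i) := h _ (tperm_young ij); rewrite tpermL.
Qed.

Section OfEquivalence.
Variable e : rel 'I_n.
Hypothesis eP : equivalence_rel e.

Fact part_of_subproof : partition (equivalence_partition e setT) [set: 'I_n].
Proof. by apply: equivalence_partitionP => i j k _ _ _; exact: eP. Qed.
Definition part_of := MkPart part_of_subproof.

Lemma same_part_of i j : same part_of i j = e i j.
Proof.
by rewrite -mem_block /= pblock_equivalence_partition ?inE.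
Qed.
End OfEquivalence.

End SameBlock.

(** * Young diagrams of pairs of partitions *)

Section Rank.
Variables (n : nat) (o : 'I_n -> nat).
Implicit Types (S : {set 'I_n}) (i j : 'I_n).

Definition rank_in S i := #|[set k in S | (o k < o i)%N]|.

Lemma rank_in_lt S i : i \in S -> (rank_in S i < #|S|)%N.
Proof.
move=> iS; apply: proper_card; apply/properP; split.
  by apply/subsetP=> k; rewrite inE => /andP[].
by exists i => //; rewrite inE ltnn andbF.
Qed.

Lemma rank_in_mono S i j : i \in S -> (o i < o j)%N -> (rank_in S i < rank_in S j)%N.
Proof.
move=> iS ij; apply: proper_card; apply/properP; split.
  apply/subsetP=> k; rewrite !inE => /andP[-> /= /ltn_trans]; exact.
by exists i; rewrite inE iS ?ij // ltnn.
Qed.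

Variable S : {set 'I_n}.
Hypothesis o_inj : {in S &, injective o}.

Lemma rank_in_inj : {in S &, injective (rank_in S)}.
Proof.
move=> i j iS jS e; apply: o_inj => //; case: (ltngtP (o i) (o j)) => // h.
  by have := rank_in_mono iS h; rewrite e ltnn.
by have := rank_in_mono jS h; rewrite e ltnn.
Qed.

Lemma rank_in_onto m : (m < #|S|)%N -> exists2 i, i \in S & rank_in S i = m.
Proof.
(* The extra value [ord_max] makes the target type nonempty, as [inord] requires. It is never taken,
   and the injection [f] fills all the other values by counting. *)
move=> mS; pose f i : 'I_#|S|.+1 := inord (rank_in S i).
have fE i : i \in S -> f i = rank_in S i :> nat.
  by move=> iS; rewrite inordK // ltnW // ltnS rank_in_lt.
have sub : f @: S \subset [set~ ord_max].
  apply/subsetP=> _ /imsetP[i iS ->]; rewrite !inE -val_eqE /= fE //.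
  by rewrite ltn_eqF // rank_in_lt.
have card : #|f @: S| = #|[set~ (ord_max : 'I_#|S|.+1)]|.
  rewrite card_in_imset ?cardsC1 ?card_ord // => i j iS jS /(congr1 val) /=.
  by rewrite !fE //; apply: rank_in_inj.
have /setP/(_ (inord m)) : f @: S = [set~ ord_max].
  by apply/eqP; rewrite eqEcard sub card leqnn.
rewrite !inE -val_eqE /= inordK ?(ltn_eqF mS); last exact: ltnW.
case/imsetP=> i iS /(congr1 val) /=; rewrite fE // inordK; last exact: ltnW.
by move=> ->; exists i.
Qed.
End Rank.

Section Ferrers.
Variable n : nat.
Implicit Types (la mu nu ka : part n) (i j k : 'I_n) (w y g : 'S_n).

(* The blocks of la and mu inside each block of ka are the rows and the columns of
   a Young diagram: they meet in at most one point, and two cells always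
   determine a third one. *)
Definition ferrers ka la mu : Prop :=
  [/\ refines la ka, refines mu ka,
      forall i j, same la i j -> same mu i j -> i = j &
      forall i j, same ka i j ->
        exists k, same la k i && same mu k j || same la k j && same mu k i].

Lemma meet_botP la mu :
  (forall i j, same la i j -> same mu i j -> i = j) <-> pmeet la mu = pbot.
Proof.
split=> [h | h i j li mi]; last by apply/eqP; rewrite -same_bot -h same_meet li.
apply: part_same_inj => i j; rewrite same_meet same_bot.
by apply/andP/eqP => [[]|->]; [exact: h | rewrite !same_refl].
Qed.

Lemma ferrersC ka la mu : ferrers ka la mu -> ferrers ka mu la.
Proof.
case=> h1 h2 h3 h4; split=> // [i j hi hj|i j /h4[k h]]; first exact: h3.
by exists k; rewrite andbC orbC andbC.
Qed.

Lemma ferrers_act ka la mu w : w \in young ka ->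
  ferrers ka la mu -> ferrers ka (pact w la) (pact w mu).
Proof.
move=> wk [h1 h2 h3 h4]; have e := pact_young_id wk.
split=> [||i j|i j].
- by rewrite -e refines_act.
- by rewrite -e refines_act.
- by rewrite !same_actV => a b; apply: (@perm_inj _ w^-1%g); apply: h3.
- rewrite -e same_actV => /h4[k h]; exists (w k).
  by rewrite !same_actV permK.
Qed.

(** For every [d] in the row of [j], the third cell determined by [i] and [d] cannot lie in the row
    of [j] and the column of [i], so it lies in the row of [i] and the column of [d]. This injects
    the row of [j] into the row of [i], and [i] itself is missed. *)
Lemma ferrers_lt ka la mu i j : ferrers ka la mu -> same ka i j ->
  ~ (exists k, same la k j && same mu k i) -> (#|pblock la j| < #|pblock la i|)%N.
Proof.
case=> h1 h2 h3 h4 ij no.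
pose f d := odflt d [pick k | same la k i && same mu k d].
have fP d : d \in pblock la j -> same la (f d) i && same mu (f d) d.
  rewrite mem_block => jd; rewrite /f; case: pickP => //= nok.
  have id : same ka i d.
    by apply: same_trans ij _; move/refinesP: h1; apply.
  have [k] := h4 _ _ id; rewrite nok /= => /andP[kd ki]; case: no; exists k.
  by rewrite ki andbT (same_eqr _ jd).
have f_inj : {in pblock la j &, injective f}.
  move=> d d' hd hd' e; have /andP[_ m1] := fP _ hd; have /andP[_ m2] := fP _ hd'.
  apply: h3; first by rewrite -(same_eql _ (_ : same la j d)) -mem_block.
  by rewrite same_sym in m1; apply: same_trans m1 _; rewrite e.
rewrite -(card_in_imset f_inj) (leq_ltn_trans (n := #|pblock la i :\ i|)) //.
  apply/subset_leq_card/subsetP=> _ /imsetP[d hd ->].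
  have /andP[m1 m2] := fP _ hd; rewrite !inE mem_block same_sym m1 andbT.
  apply/eqP=> e; case: no; exists d.
  by rewrite (same_sym la) -mem_block hd same_sym -e.
by rewrite [X in (_ < X)%N](cardsD1 i) mem_block_self.
Qed.

Lemma ferrers_chain ka la mu i j : ferrers ka la mu -> same ka i j ->
  (#|pblock la i| <= #|pblock la j|)%N -> exists k, same la k j && same mu k i.
Proof.
move=> fe ij le; case: (pickP (fun k => same la k j && same mu k i)) => [k h|no].
  by exists k.
suff : (#|pblock la j| < #|pblock la i|)%N by rewrite ltnNge le.
by apply: (ferrers_lt fe ij) => -[k]; rewrite no.
Qed.

(** The blocks of [la] are left-aligned: the column of a point is its position in its row, within
    its block of [ka]. A position occurring in the shorter of two rows also occurs in the longer
    one. *)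
Lemma ferrers_exists ka la : refines la ka -> exists mu, ferrers ka la mu.
Proof.
move=> lk; pose c i := rank_in (@nat_of_ord n) (pblock la i) i.
have o_inj (S : {set 'I_n}) : {in S &, injective (@nat_of_ord n)} by move=> ? ? _ _; exact: val_inj.
pose e i j := same ka i j && (c i == c j).
have eP : equivalence_rel e.
  move=> i j k; split=> [|/andP[ij /eqP cij]]; first by rewrite /e same_refl eqxx.
  by rewrite /e cij (same_eql _ ij).
exists (part_of eP); split=> // [|i j lij|i j kij].
- by apply/refinesP=> i j; rewrite same_part_of => /andP[].
- rewrite same_part_of => /andP[_ /eqP]; rewrite /c (eqP lij).
  by apply: rank_in_inj; rewrite ?mem_block_self // mem_block same_sym.
wlog le : i j kij / (#|pblock la i| <= #|pblock la j|)%N => [H|].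
  case/orP: (leq_total #|pblock la i| #|pblock la j|) => [/(H i j kij)//|].
  by rewrite same_sym in kij; move=> /(H j i kij)[k h]; exists k; rewrite orbC.
have ci : (c i < #|pblock la j|)%N.
  by apply: leq_trans le; apply: rank_in_lt; apply: mem_block_self.
have [k kj ck] := rank_in_onto (o_inj _) ci.
rewrite mem_block in kj; exists k; rewrite !same_part_of /e.
have -> : c k == c i by rewrite -ck /c (eqP kj).
rewrite (same_sym la k j) kj andbT /= orbC same_sym (same_trans kij) //.
by move/refinesP: lk; apply.
Qed.

(** * The bound on the number of pairs of equivalent points *)

Section Pairs.
Definition npairs mu := #|[set p : 'I_n * 'I_n | same mu p.1 p.2]|.

Definition meets mu (B C : {set 'I_n}) :=
  [set p : 'I_n * 'I_n | [&& p.1 \in B, p.2 \in C & same mu p.1 p.2]].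

Lemma npairs_act w mu : npairs (pact w mu) = npairs mu.
Proof.
pose f (p : 'I_n * 'I_n) := (w p.1, w p.2).
have f_inj : injective f by move=> [a b] [c d] [/perm_inj-> /perm_inj->].
rewrite /npairs -[RHS](card_imset _ f_inj); apply: eq_card => -[a b].
rewrite inE /=; apply/idP/imsetP => [h|[[c d]]].
  exists (w^-1%g a, w^-1%g b); last by rewrite /f !permKV.
  by rewrite inE -same_actV.
by rewrite inE => h [-> ->]; rewrite same_act.
Qed.

(** Sorting the pairs by the rows of their two points reduces the extremal problem for [npairs] to
    each pair of rows separately. *)
Lemma npairs_sum la mu :
  npairs mu = (\sum_(Q in setX (blocks la) (blocks la)) #|meets mu Q.1 Q.2|)%N.
Proof.
pose f (p : 'I_n * 'I_n) := (pblock la p.1, pblock la p.2).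
rewrite /npairs -sum1_card (partition_big f [in setX (blocks la) (blocks la)]) /=; last first.
  by move=> p _; rewrite inE /= !part_of_pblock.
apply: eq_bigr => -[B C] /=; rewrite inE => /andP[/= lB lC].
rewrite -sum1_card; apply: eq_bigl => -[a b]; rewrite !inE /= andbC xpair_eqE.
have e D x : D \in blocks la -> (pblock la x == D) = (x \in D).
  move=> lD; apply/eqP/idP => [<-|]; first exact: mem_block_self.
  exact: block_mem.
by rewrite !e // andbA.
Qed.

Lemma card_meetsC mu B C : #|meets mu B C| = #|meets mu C B|.
Proof.
pose f (p : 'I_n * 'I_n) := (p.2, p.1).
have f_inj : injective f by move=> [a b] [c d] [-> ->].
rewrite -[RHS](card_imset _ f_inj); apply: eq_card => -[a b].
rewrite inE /=; apply/and3P/imsetP => [[h1 h2 h3]|[[c d]]].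
  by exists (b, a) => //; rewrite inE /= h1 h2 same_sym.
by rewrite inE /= => /and3P[h1 h2 h3] [-> ->]; rewrite same_sym.
Qed.

Section Bound.
Variables (la mu : part n) (B C : {set 'I_n}).
Hypotheses (lam : pmeet la mu = pbot) (lB : B \in blocks la) (lC : C \in blocks la).

(** A point of [B] has at most one partner in the row [C], since two of them would share both their
    row and their column. *)
Let fst_inj : {in meets mu B C &, injective (@fst 'I_n 'I_n)}.
Proof.
move=> [a b] [c d]; rewrite !inE /= => /and3P[aB bC ab] /and3P[_ dC cd] e.
subst c; congr pair; have [_ /(_ lam) h] := meet_botP la mu.
apply: h; first by rewrite (same_in _ lC).
by apply: same_trans cd; rewrite same_sym.
Qed.

Let fst_sub : fst @: meets mu B C \subset B.
Proof. by apply/subsetP=> _ /imsetP[p + ->]; rewrite inE => /and3P[]. Qed.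

Lemma card_meets_le : (#|meets mu B C| <= #|B|)%N.
Proof. by rewrite -(card_in_imset fst_inj) subset_leq_card. Qed.

Lemma card_meets_eq : (#|meets mu B C| == #|B|) =
  [forall a in B, exists b in C, same mu a b].
Proof.
rewrite -(card_in_imset fst_inj); apply/eqP/forall_inP => [h a aB|h].
  have /eqP e : fst @: meets mu B C == B by rewrite eqEcard fst_sub h /=.
  move: aB; rewrite -e => /imsetP[[a' b]]; rewrite inE /= => /and3P[_ bC ab] ->.
  by apply/exists_inP; exists b.
congr #|pred_of_set _|; apply/eqP; rewrite eqEsubset fst_sub /=; apply/subsetP=> a aB.
have /exists_inP[b bC ab] := h a aB.
by apply/imsetP; exists (a, b) => //; rewrite inE aB bC.
Qed.
End Bound.

(** Every column through a row also crosses the rows that are at least as long, so each point of the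
    shorter row has a partner and the bound is attained. *)
Lemma card_meets_ferrers ka la mu i j : ferrers ka la mu -> same ka i j ->
  (#|pblock la i| <= #|pblock la j|)%N ->
  #|meets mu (pblock la i) (pblock la j)| = #|pblock la i|.
Proof.
move=> fe kij le; case: (fe) => h1 h2 /meet_botP h3 _; apply/eqP.
rewrite (card_meets_eq _ h3) ?part_of_pblock //; apply/forall_inP=> a; rewrite mem_block => ia.
have aj : same ka a j.
  by rewrite same_sym in ia; apply: same_trans kij; move/refinesP: h1; apply.
rewrite (eqP ia) in le; have [k /andP[kj ka']] := ferrers_chain fe aj le.
by apply/exists_inP; exists k; rewrite ?mem_block same_sym.
Qed.

(** Two rows in different blocks of [ka] carry no pairs at all. Otherwise [kap] has at most as many
    pairs as the shorter row has points, which is the number reached by [mu]. *)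
Lemma card_meets_max ka la mu kap B C : ferrers ka la mu -> refines kap ka ->
  pmeet la kap = pbot -> B \in blocks la -> C \in blocks la ->
  (#|meets kap B C| <= #|meets mu B C|)%N.
Proof.
move=> fe kk lk lB lC; case: (fe) => h1 h2 /meet_botP h3 _.
have /set0Pn[i iB] := part_neq0 lB; have /set0Pn[j jC] := part_neq0 lC.
case kij: (same ka i j); last first.
  rewrite [X in (X <= _)%N](_ : _ = 0%N) //; apply/eqP; rewrite cards_eq0.
  apply/eqP/setP=> -[a b]; rewrite !inE /=; apply/negP=> /and3P[aB bC ab].
  move/negP: kij; apply; move/refinesP: h1 => h1; move/refinesP: kk => kk.
  apply: (same_trans (j := a)); first by apply: h1; rewrite (same_in _ lB).
  apply: (same_trans (j := b)); first exact: kk.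
  by apply: h1; rewrite (same_in _ lC).
rewrite -(block_mem lB iB) -(block_mem lC jC).
wlog le : i j B C lB lC iB jC kij / (#|pblock la i| <= #|pblock la j|)%N => [H|].
  case/orP: (leq_total #|pblock la i| #|pblock la j|) => le.
    exact: (H i j B C).
  by rewrite ![#|meets _ (pblock la i) _|]card_meetsC; apply: (H j i C B); rewrite // same_sym.
by rewrite (card_meets_ferrers fe) // (card_meets_le _ lk) ?part_of_pblock.
Qed.

Lemma npairs_max ka la mu kap : ferrers ka la mu -> refines kap ka ->
  pmeet la kap = pbot -> (npairs kap <= npairs mu)%N.
Proof.
move=> fe kk lk; rewrite !(npairs_sum la); apply: leq_sum => -[B C].
by rewrite inE => /andP[lB lC]; apply: (card_meets_max fe).
Qed.

(** Equality of the totals forces equality for each pair of rows. Then every point of a row has a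
    [kap]-partner in each row at least as long in the same block of [ka], and this partner is the
    third cell asked for by [ferrers]. *)
Lemma npairs_eq ka la mu kap : ferrers ka la mu -> refines kap ka ->
  pmeet la kap = pbot -> npairs kap = npairs mu -> ferrers ka la kap.
Proof.
move=> fe kk lk /eqP; case: (fe) => h1 h2 _ _.
have le (Q : {set 'I_n} * {set 'I_n}) : Q \in setX (blocks la) (blocks la) ->
    (#|meets kap Q.1 Q.2| <= #|meets mu Q.1 Q.2| ?= iff
      (#|meets kap Q.1 Q.2| == #|meets mu Q.1 Q.2|))%N.
  by rewrite inE => /andP[lB lC]; split=> //; apply: (card_meets_max fe).
rewrite !(npairs_sum la) (leqif_sum le) => /forall_inP eqm.
split=> // [|i j kij]; first exact/meet_botP.
wlog ij : i j kij / (#|pblock la i| <= #|pblock la j|)%N => [H|].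
  case/orP: (leq_total #|pblock la i| #|pblock la j|) => [/(H i j kij)//|].
  by rewrite same_sym in kij; move=> /(H j i kij)[k h]; exists k; rewrite orbC.
have /= := eqm (pblock la i, pblock la j); rewrite inE /= !part_of_pblock => /(_ isT).
rewrite (card_meets_ferrers fe) // (card_meets_eq _ lk) ?part_of_pblock //.
move=> /forall_inP/(_ i (mem_block_self _ _))/exists_inP[k]; rewrite mem_block => jk ik.
by exists k; rewrite (same_sym la k j) jk (same_sym kap k i) ik orbT.
Qed.
End Pairs.

(** The partition [pact y mu] gives columns for the rows [pact y la], and [mu] has as many pairs as
    it: this is the equality case of the bound. *)
Lemma ferrers_meet_act ka la mu y : ferrers ka la mu -> y \in young ka ->
  pmeet (pact y la) mu = pbot -> ferrers ka (pact y la) mu.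
Proof.
move=> fe yk e; apply: (npairs_eq (ferrers_act yk fe)) => //.
  by case: fe.
by rewrite npairs_act.
Qed.

(** It suffices to find, for each [i], a point [s i] in the row of [i] and the column of [y i]. Such
    an [s] is injective because rows and columns of the moved diagram meet in at most one point; it
    preserves rows, and [y] composed with its inverse preserves columns. *)
Lemma ferrers_dcoset ka la mu y : ferrers ka la mu -> ferrers ka (pact y la) mu ->
  y \in young ka -> exists t s, [/\ t \in young mu, s \in young la & y = t *c s].
Proof.
move=> fe fey yk; case: (fe) => h1 h2 h3 _; case: (fey) => h1' _ h3' _.
have ex i : exists k, same la k i && same mu k (y i).
  pose f b := odflt b [pick d | same (pact y la) d (y i) && same mu d b].
  (* If all columns through the row of [i] cross the moved row [y @: pblock la i], then [f] maps the
     one row bijectively onto the other, so [y i] is [f b] for some [b], and this [b] is the point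
     sought. *)
  case: (boolP [forall b in pblock la i, exists d, same (pact y la) d (y i) && same mu d b]).
    move=> /forall_inP hb.
    have fP b : same la i b -> same (pact y la) (f b) (y i) && same mu (f b) b.
      rewrite -mem_block => /hb /existsP[d h]; rewrite /f.
      by case: pickP => [//|/(_ d)]; rewrite h.
    have f_inj : {in pblock la i &, injective f}.
      move=> b b'; rewrite !mem_block => ib ib' e.
      have /andP[_ m1] := fP _ ib; have /andP[_ m2] := fP _ ib'.
      apply: h3; first by rewrite -(same_eql _ ib).
      by rewrite same_sym in m1; apply: same_trans m1 _; rewrite e.
    have fB : f @: pblock la i = y @: pblock la i.
      apply/eqP; rewrite eqEcard (card_in_imset f_inj) card_imset ?leqnn ?andbT; last exact: perm_inj.
      apply/subsetP=> _ /imsetP[b + ->]; rewrite mem_block => /fP/andP[+ _].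
      rewrite same_actV permK => h; apply/imsetP; exists (y^-1%g (f b)); last by rewrite permKV.
      by rewrite mem_block same_sym.
    have : y i \in f @: pblock la i by rewrite fB imset_f // mem_block_self.
    case/imsetP=> b; rewrite mem_block => ib e; have /andP[_ m] := fP _ ib.
    by exists b; rewrite same_sym ib same_sym e.
  rewrite negb_forall_in => /exists_inP[b]; rewrite mem_block => ib no.
  case: (pickP (fun k => same la k i && same mu k (y i))) => [k h|no']; first by exists k.
  have kb : same ka b (y i).
    apply: (same_trans (j := i)); last by move/youngP: yk; apply.
    by rewrite same_sym; move/refinesP: h1; apply.
  have kb' : same ka (y i) b by rewrite same_sym.
  (* Now the column of [b] misses the moved row, and the column of [y i] is assumed to miss the
     original one. The two diagrams then order the lengths of these two columns in opposite ways. *)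
  suff: (#|pblock mu (y i)| < #|pblock mu b| < #|pblock mu (y i)|)%N.
    by case/andP=> /ltn_trans h /h; rewrite ltnn.
  apply/andP; split.
    apply: (ferrers_lt (ferrersC fe) kb) => -[k]; rewrite andbC -(same_eqr _ ib).
    by rewrite no'.
  apply: (ferrers_lt (ferrersC fey) kb') => -[k h].
  by move/existsP: no; apply; exists k; rewrite andbC.
pose s i := odflt i [pick k | same la k i && same mu k (y i)].
have sP i : same la (s i) i && same mu (s i) (y i).
  rewrite /s; case: pickP => //= no; by have [k] := ex i; rewrite no.
have s_inj : injective s.
  move=> i j e; have /andP[a b] := sP i; have /andP[c d] := sP j.
  apply: (@perm_inj _ y); apply: h3'.
    by rewrite same_act -(same_eql _ a) e.
  by rewrite -(same_eql _ b) e.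
have yE : y = (y *c (perm s_inj)^-1%g) *c perm s_inj by rewrite -pcompA pVcomp pcomp1.
exists (y *c (perm s_inj)^-1%g), (perm s_inj); split=> //.
  apply/youngP=> k; rewrite pcompE -[k in same mu k](permKV (perm s_inj)).
  by rewrite permE; have /andP[] := sP ((perm s_inj)^-1%g k).
by apply/youngP=> i; rewrite permE same_sym; have /andP[] := sP i.
Qed.

(** * Row numbers of a Young diagram *)

Section Columns.
Variables (ka la mu : part n).
Hypothesis fe : ferrers ka la mu.

(* A total order on the blocks of la in which the larger ones come first. *)
Definition row_key i : nat :=
  (n - #|pblock la i|) * n.+1 + nat_of_ord (odflt i [pick k in pblock la i]).

Lemma row_key_eq i j : same la i j -> row_key i = row_key j.
Proof.
rewrite /row_key => /eqP ->; congr (_ + nat_of_ord _)%N.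
by case: pickP => // /(_ j); rewrite mem_block_self.
Qed.

Let pick_lt i : (odflt i [pick k in pblock la i] < n.+1)%N.
Proof. by rewrite ltnW // ltnS ltn_ord. Qed.

Lemma row_key_inj i j : row_key i = row_key j -> same la i j.
Proof.
(* Modulo [n.+1] only the chosen point of the block is left, and it determines the block. *)
move=> /(congr1 (modn^~ n.+1)); rewrite /row_key !modnMDl !modn_small //.
case: pickP => [k /= ik|/(_ i)]; last by rewrite mem_block_self.
case: pickP => [k' /= jk|/(_ j)]; last by rewrite mem_block_self.
rewrite !mem_block in ik jk => /val_inj e; rewrite e in ik.
by apply: same_trans ik _; rewrite same_sym.
Qed.

Lemma row_key_lt i j : (#|pblock la j| < #|pblock la i|)%N -> (row_key i < row_key j)%N.
Proof.
move=> h; rewrite /row_key; have hi : (#|pblock la i| <= n)%N.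
  by rewrite -[X in (_ <= X)%N]card_ord max_card.
apply: leq_trans (leq_addr _ _); apply: (@leq_trans ((n - #|pblock la i|).+1 * n.+1)).
  by rewrite mulSn addnC ltn_add2r.
by rewrite leq_mul2r ltn_sub2l ?orbT // (leq_trans h).
Qed.

(** The rank is taken inside the column of [i] alone, with long rows first; that it depends only on
    the row is the content of [row_of_le]. *)
Definition row_of i := rank_in row_key (pblock mu i) i.

Lemma row_key_injC i : {in pblock mu i &, injective row_key}.
Proof.
case: fe => _ _ h3 _ a b; rewrite !mem_block => ia ib /row_key_inj lab.
by apply: h3 => //; rewrite -(same_eql _ ia).
Qed.

Lemma row_of_inj i j : same mu i j -> row_of i = row_of j -> i = j.
Proof.
move=> ij; rewrite /row_of (eqP ij).
apply: (rank_in_inj (@row_key_injC j)); rewrite ?mem_block_self //.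
by rewrite mem_block same_sym.
Qed.

(** A row that comes before that of [i] in the column of [i] is not shorter, so it also crosses the
    column of [j]. Thus the cells above [i] inject into those above [j]. *)
Let row_of_le i j : same la i j -> (row_of i <= row_of j)%N.
Proof.
move=> lij; case: (fe) => /refinesP h1 /refinesP h2 h3 _.
pose A i := [set k in pblock mu i | (row_key k < row_key i)%N].
pose f k := odflt k [pick k' | same la k' k && same mu k' j].
have fP k : k \in A i -> same la (f k) k && same mu (f k) j.
  rewrite inE mem_block => /andP[ik lt]; rewrite /f; case: pickP => //= no.
  suff : (row_key i < row_key k)%N by rewrite ltnNge ltnW.
  apply: row_key_lt; rewrite (eqP lij); apply: (ferrers_lt fe); last first.
    by move=> [k']; rewrite no.
  by apply: (same_trans (j := i)); [apply: h1; rewrite same_sym | exact: h2].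
have f_inj : {in A i &, injective f}.
  move=> k k' hk hk' e; have /andP[m1 _] := fP _ hk; have /andP[m2 _] := fP _ hk'.
  move: hk hk'; rewrite !inE !mem_block => /andP[ik _] /andP[ik' _].
  apply: h3; last by rewrite -(same_eql _ ik).
  by rewrite same_sym in m1; apply: same_trans m1 _; rewrite e.
rewrite /row_of /rank_in -/(A i) -/(A j) -(card_in_imset f_inj).
apply/subset_leq_card/subsetP=> _ /imsetP[k hk ->]; have /andP[m1 m2] := fP _ hk.
move: hk; rewrite !inE !mem_block => /andP[_ lt].
by rewrite same_sym m2 (row_key_eq m1) -(row_key_eq lij).
Qed.

(** The third cell of [i] and [j] shares its row, hence its row number, with one of them and its
    column with the other; equal numbers in one column mean equal cells. So [la] is recovered from
    [ka], [mu] and the row numbers. *)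
Lemma same_row i j : same la i j = same ka i j && (row_of i == row_of j).
Proof.
case: (fe) => /refinesP h1 /refinesP h2 h3 h4; apply/idP/andP => [lij|[kij /eqP e]].
  split; first exact: h1.
  by rewrite eqn_leq !row_of_le // same_sym.
have rowE a b : same la a b -> row_of a = row_of b.
  by move=> ab; apply/eqP; rewrite eqn_leq !row_of_le // same_sym.
have [k /orP[] /andP[lk mk]] := h4 _ _ kij.
  suff <- : k = j by rewrite same_sym.
  by apply: row_of_inj mk _; rewrite (rowE _ _ lk).
suff <- : k = i by [].
by apply: row_of_inj mk _; rewrite (rowE _ _ lk).
Qed.

Lemma row_of_onto i m : (m < #|pblock mu i|)%N -> exists2 k, same mu i k & row_of k = m.
Proof.
move=> /(rank_in_onto (@row_key_injC i))[k]; rewrite mem_block => ik e.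
by exists k; rewrite // /row_of -(eqP ik).
Qed.

Lemma row_of_lt i : (row_of i < #|pblock mu i|)%N.
Proof. by apply: rank_in_lt; apply: mem_block_self. Qed.
End Columns.

(** Inside each column, the cell with a given row number for [la1] is sent to the cell with the same
    number for [la2]. By [same_row] this column permutation carries rows to rows. *)
Lemma ferrers_conj ka la1 la2 mu : ferrers ka la1 mu -> ferrers ka la2 mu ->
  exists2 y, y \in young mu & pact y la1 = la2.
Proof.
move=> f1 f2; have /refinesP mk : refines mu ka by case: f1.
have ex i : exists k, same mu i k && (row_of la2 mu k == row_of la1 mu i).
  have [k ik e] := row_of_onto f2 (row_of_lt la1 mu i).
  by exists k; rewrite ik e /=.
pose s i := odflt i [pick k | same mu i k && (row_of la2 mu k == row_of la1 mu i)].
have sP i : same mu i (s i) && (row_of la2 mu (s i) == row_of la1 mu i).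
  by rewrite /s; case: pickP => //= no; have [k] := ex i; rewrite no.
have s_inj : injective s.
  move=> i j e; have /andP[m1 /eqP r1] := sP i; have /andP[m2 /eqP r2] := sP j.
  apply: (row_of_inj f1); last by rewrite -r1 -r2 e.
  by rewrite same_sym in m2; apply: same_trans m2; rewrite -e.
exists (perm s_inj); first by apply/youngP=> i; rewrite permE; have /andP[] := sP i.
apply: part_same_inj => i j; rewrite same_actV.
rewrite -[i in RHS](permKV (perm s_inj)) -[j in RHS](permKV (perm s_inj)) [in RHS]permE [in RHS]permE.
set a := (perm s_inj)^-1%g i; set b := (perm s_inj)^-1%g j.
rewrite (same_row f1) (same_row f2).
have /andP[m1 /eqP r1] := sP a; have /andP[m2 /eqP r2] := sP b.
by rewrite r1 r2 (same_eql _ (mk _ _ m1)) (same_eqr _ (mk _ _ m2)).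
Qed.

End Ferrers.

(** * Permutation characters of Young subgroups *)

Section Cycles.
Variable n : nat.
Implicit Types (la mu nu ka : part n) (i j k : 'I_n) (w y g : 'S_n).

Fact cycles_equiv g : equivalence_rel (fun i j => porbit g i == porbit g j).
Proof. by move=> i j k; split=> // /eqP->. Qed.
Definition cycles g := part_of (cycles_equiv g).

Lemma same_cycles g i j : same (cycles g) i j = (i \in porbit g j).
Proof. by rewrite same_part_of eq_porbit_mem. Qed.

Lemma young_cycles g mu : (g \in young mu) = refines (cycles g) mu.
Proof.
apply/idP/refinesP => [gm i j|h]; last first.
  by apply/youngP=> i; apply: h; rewrite same_cycles porbit_sym (mem_porbit g 1).
rewrite same_cycles => /porbitP[m ->]; rewrite same_sym.
have /youngP : (g ^+ m)%g \in young mu by apply: groupX.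
exact.
Qed.

Lemma iter_porbit_mod g i m : iter m g i = iter (m %% #|porbit g i|) g i.
Proof.
rewrite {1}(divn_eq m #|porbit g i|) addnC iterD; congr (iter _ _ _).
by elim: (m %/ _)%N => //= q IH; rewrite mulSn iterD IH iter_porbit.
Qed.

Lemma iter_porbit_inj g i : {in gtn #|porbit g i| &, injective (fun m => iter m g i)}.
Proof.
move=> a b; rewrite !inE => ha hb /eqP.
by rewrite -!(nth_traject _ (n := #|porbit g i|)) // nth_uniq ?size_traject // ?uniq_traject_porbit // => /eqP.
Qed.

(** On each common orbit both permutations are single cycles. With a base point [r] chosen in the
    orbit, [s] sends the m-th iterate of [r] under [g] to its m-th iterate under [h]; this is well
    defined since exponents only matter modulo the common orbit length. *)
Lemma cycles_conj g h : cycles g = cycles h ->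
  exists2 s, s \in young (cycles g) & h = s *c g *c s^-1%g.
Proof.
move=> gh; have orb i : porbit g i = porbit h i.
  by apply/setP=> j; rewrite -!same_cycles gh.
pose r i := odflt i [pick k in porbit g i].
have rP i : r i \in porbit g i.
  by rewrite /r; case: pickP => //= _; apply: porbit_id.
have r_eq i j : porbit g i = porbit g j -> r i = r j.
  rewrite /r => ->; case: pickP => // /(_ j); by rewrite porbit_id.
pose d i := #|porbit g i|.
have dr i : #|porbit g (r i)| = d i.
  by congr #|pred_of_set _|; apply/eqP; rewrite eq_porbit_mem.
have ex i : exists m, iter m g (r i) == i.
  have : i \in porbit g (r i) by rewrite porbit_sym.
  by case/porbitP=> m e; exists m; rewrite -permX -e.
pose f i := xchoose (ex i).
have fP i : iter (f i) g (r i) = i by apply/eqP/(xchooseP (ex i)).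
pose s i := iter (f i) h (r i).
have s_porbit i : s i \in porbit g i.
  have : s i \in porbit h (r i) by rewrite /s -permX mem_porbit.
  by rewrite -orb -!eq_porbit_mem => /eqP->; rewrite eq_porbit_mem.
have iter_eq i a b : iter a g (r i) = iter b g (r i) -> iter a h (r i) = iter b h (r i).
  rewrite iter_porbit_mod [RHS]iter_porbit_mod => e.
  rewrite iter_porbit_mod [RHS]iter_porbit_mod -!orb.
  congr (iter _ _ _); apply: (iter_porbit_inj (g := g) (i := r i)) => //;
    by rewrite inE ltn_mod lt0n card_porbit_neq0.
have iter_eq' i a b : iter a h (r i) = iter b h (r i) -> iter a g (r i) = iter b g (r i).
  rewrite iter_porbit_mod [RHS]iter_porbit_mod => e.
  rewrite iter_porbit_mod [RHS]iter_porbit_mod !orb.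
  congr (iter _ _ _); apply: (iter_porbit_inj (g := h) (i := r i)) => //;
    by rewrite inE ltn_mod lt0n card_porbit_neq0.
have s_inj : injective s.
  move=> i j e; have rij : r i = r j.
    apply: r_eq; have /eqP <- : porbit g (s i) == porbit g i by rewrite eq_porbit_mem.
    by apply/eqP; rewrite eq_porbit_mem e.
  move: e; rewrite /s -rij => /iter_eq'; by rewrite fP {1}rij fP.
have sg i : s (g i) = h (s i).
  have rg : r (g i) = r i by apply: r_eq; rewrite -[g i]/((g ^+ 1)%g i) porbit_perm.
  rewrite /s rg -iterS; apply: iter_eq.
  by rewrite -[in LHS]rg fP /= fP.
exists (perm s_inj).
  by apply/youngP=> i; rewrite same_cycles permE porbit_sym.
apply/permP=> i; rewrite !pcompE permE sg; congr (h _).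
by rewrite -[s _](permE s_inj) permKV.
Qed.

End Cycles.

Section ClassFunctions.
Variables (F : numFieldType) (n : nat).
Implicit Types (la mu nu ka : part n) (w y g : 'S_n).

Definition sgn g : F := (-1) ^+ odd_perm g.

Lemma sgnM g h : sgn (g *c h) = sgn g * sgn h.
Proof. by rewrite /sgn odd_permM signr_addb mulrC. Qed.
Lemma sgnV g : sgn g^-1%g = sgn g.
Proof. by rewrite /sgn odd_permV. Qed.
Lemma sgn2 g : sgn g * sgn g = 1.
Proof. by rewrite /sgn -expr2 sqrr_sign. Qed.
Lemma sgnJ k g : sgn (k *c g *c k^-1%g) = sgn g.
Proof. by rewrite !sgnM sgnV mulrAC sgn2 mul1r. Qed.
Lemma sgn1 : sgn 1%g = 1.
Proof. by rewrite /sgn odd_perm1. Qed.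

(** Translation by a transposition of two distinct equivalent points reverses the sign of the
    sum. *)
Lemma sum_sgn_young mu : \sum_(g in young mu) sgn g = (mu == pbot)%:R.
Proof.
case: eqP => [->|mb].
  rewrite young_bot (eq_bigl (pred1 1%g)) => [|g]; last by rewrite inE.
  by rewrite big_pred1_eq sgn1.
have /existsP[i /existsP[j /andP[ij nij]]] : [exists i, exists j, same mu i j && (i != j)].
  apply: contra_notT mb => no; apply: part_same_inj => i j; rewrite same_bot.
  apply/idP/eqP => [ij|->]; last exact: same_refl.
  move: no; rewrite negb_exists => /forallP/(_ i); rewrite negb_exists.
  by move=> /forallP/(_ j); rewrite ij negbK => /eqP.
have tm := tperm_young ij; set S := LHS.
have : S = - S.
  rewrite {1}/S (reindex_inj (@pcompI _ (tperm i j))) /= -sumrN.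
  apply: eq_big => [g|g _]; first by rewrite /pcomp groupMr.
  by rewrite sgnM {1}/sgn odd_tperm nij mulN1r.
by move/eqP; rewrite -addr_eq0 -mulr2n mulrn_eq0 /= => /eqP.
Qed.

Section Orthogonality.
Variables (ka : part n) (f : 'S_n -> F).
Hypothesis f_class : {in young ka &, forall k g, f (k *c g *c k^-1%g) = f g}.

(** Induction on the order of [young mu]: elements whose orbits are strictly finer than [mu] lie in
    a smaller Young subgroup, where [f] is already zero. The remaining ones have orbit partition
    [mu], are conjugate under [young mu], and so share one value of [f], of which the sum is a
    positive multiple. *)
Lemma classfun_sum0 :
  (forall mu, refines mu ka -> \sum_(g in young mu) f g = 0) ->
  {in young ka, forall g, f g = 0}.
Proof.
move=> h; suff H m mu : (#|young mu| < m)%N -> refines mu ka ->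
    forall g, cycles g = mu -> f g = 0.
  by move=> g; rewrite young_cycles => gk; apply: (H _.+1 (cycles g)).
elim: m mu => // m IH mu; rewrite ltnS => mm mk g gmu.
have := h _ mk; rewrite (bigID (fun g' => cycles g' == mu)) /=.
rewrite [X in _ + X]big1 ?addr0 => [|g' /andP[g'm g'n]]; last first.
  move: g'm; rewrite young_cycles => g'm.
  apply: (IH (cycles g')) (refines_trans g'm mk) _ erefl.
  apply: leq_trans mm; apply: proper_card; rewrite properE -!refines_young g'm.
  by apply: contra g'n => /(refines_anti g'm)->.
rewrite (eq_bigr (fun=> f g)) => [|g' /andP[g'm /eqP g'mu]]; last first.
  have [s sm ->] : exists2 s, s \in young (cycles g) & g' = s *c g *c s^-1%g.
    by apply: cycles_conj; rewrite gmu g'mu.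
  rewrite gmu refines_young in mk sm *; apply: f_class.
    by move/subsetP: mk; apply.
  by move/subsetP: mk; apply; rewrite young_cycles gmu refines_refl.
rewrite sumr_const => /eqP; rewrite mulrn_eq0 => /orP[|/eqP//].
rewrite -leqn0 leqNgt => /negP[]; apply/card_gt0P; exists g.
by rewrite unfold_in young_cycles gmu refines_refl eqxx.
Qed.
End Orthogonality.

(* The character of the representation of young ka induced from the trivial one
   of young la. *)
Definition ind ka la g : F :=
  #|young la|%:R^-1 * #|[set y in young ka | g \in young (pact y la)]|%:R.

(* Its inner product with the representation induced from the sign of young mu. *)
Definition sgn_mult ka la mu : F :=
  #|young mu|%:R^-1 * \sum_(g in young mu) sgn g * ind ka la g.

Lemma card_young_neq0 la : #|young la|%:R != 0 :> F.
Proof. by rewrite pnatr_eq0 -lt0n cardG_gt0. Qed.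

(** After exchanging the sums, each [y] contributes the sum of the signs over the intersection of
    two Young subgroups, which is 1 when that intersection is trivial and 0 otherwise. *)
Lemma sgn_multE ka la mu : sgn_mult ka la mu = #|young mu|%:R^-1 *
  (#|young la|%:R^-1 * #|[set y in young ka | pmeet (pact y la) mu == pbot]|%:R).
Proof.
rewrite /sgn_mult; congr (_ * _).
transitivity (\sum_(g in young mu) #|young la|%:R^-1 *
   \sum_(y in young ka) sgn g * (g \in young (pact y la))%:R).
  apply: eq_bigr => g _; rewrite /ind mulrCA; congr (_ * _); rewrite -mulr_sumr; congr (_ * _).
  rewrite -sum1_card natr_sum big_mkcond /= [RHS]big_mkcond /=.
  by apply: eq_bigr => y _; rewrite [in LHS]in_set; case: (y \in young ka) => //=; case: (g \in _).
rewrite -mulr_sumr; congr (_ * _); rewrite exchange_big /=.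
rewrite -sum1_card natr_sum big_mkcond [RHS]big_mkcond /=; apply: eq_bigr => y _.
rewrite [in RHS]in_set; case: (y \in young ka) => //=.
transitivity (\sum_(g in young (pmeet (pact y la) mu)) sgn g).
  rewrite young_meet big_mkcond [RHS]big_mkcond; apply: eq_bigr => g _; rewrite in_setI.
  by case: (g \in young mu); rewrite ?andbT ?andbF //; case: (g \in _); rewrite ?mulr1 ?mulr0.
by rewrite sum_sgn_young; case: eqP.
Qed.

Lemma sgn_mult_neq0 ka la mu : sgn_mult ka la mu != 0 ->
  exists2 y, y \in young ka & pmeet (pact y la) mu = pbot.
Proof.
move=> h; case: (set_0Vmem [set y in young ka | pmeet (pact y la) mu == pbot]) => [e|[y]].
  by move: h; rewrite sgn_multE e cards0 !mulr0 eqxx.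
by rewrite in_set => /andP[yk /eqP e]; exists y.
Qed.

Lemma card_young_act w la : #|young (pact w la)| = #|young la|.
Proof.
pose f g := w *c g *c w^-1%g.
have f_inj : injective f by move=> a b /pcompIr/pcompI.
rewrite -[RHS](card_imset _ f_inj); apply: eq_card => g; apply/idP/imsetP => [|[h hl ->]].
  rewrite young_act => h; exists (w^-1%g *c g *c w) => //.
  by rewrite /f -!pcompA pcompV pcomp1 pcompVK.
by rewrite young_act /f -!pcompA pVcomp pcomp1 pcompK.
Qed.

Lemma sgn_mult_act ka la mu w : w \in young ka ->
  sgn_mult ka la (pact w mu) = sgn_mult ka la mu.
Proof.
move=> wk; rewrite !sgn_multE card_young_act; congr (_ * (_ * _%:R)).
rewrite -(card_imset _ (@pcompI _ w^-1%g)); apply: eq_card => y.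
apply/imsetP/idP => [[z]|].
  rewrite in_set => /andP[zk /eqP e] ->; rewrite in_set youngM ?groupV //=.
  rewrite pactM -[mu](pactK w) -pact_meet e; apply/eqP.
  by apply: part_same_inj => i j; rewrite same_actV !same_bot (inj_eq perm_inj).
rewrite in_set => /andP[yk /eqP e]; exists (w *c y); last by rewrite pcompK.
rewrite in_set youngM //= pactM -pact_meet e; apply/eqP.
by apply: part_same_inj => i j; rewrite same_actV !same_bot (inj_eq perm_inj).
Qed.

(** The contributing [y] are exactly the products of a column permutation and a row permutation. As
    the two subgroups meet trivially, their number is the product of the two orders and cancels the
    normalisation. *)
Lemma sgn_mult_ferrers ka la mu : ferrers ka la mu -> sgn_mult ka la mu = 1.
Proof.
move=> fe; case: (fe) => lk mk /meet_botP lm _; rewrite sgn_multE.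
have -> : [set y in young ka | pmeet (pact y la) mu == pbot] =
    [set t *c s | t in young mu, s in young la].
  apply/setP=> y; rewrite in_set; apply/andP/imset2P => [[yk /eqP e]|[t s tm sl ->]].
    by have [t [s [tm sl ->]]] := ferrers_dcoset fe (ferrers_meet_act fe yk e) yk; exists t s.
  rewrite refines_young in lk; rewrite refines_young in mk.
  split; first exact: youngM (subsetP mk _ tm) (subsetP lk _ sl).
  rewrite pactM (pact_young_id sl) -{1}(pact_young_id tm) -pact_meet lm; apply/eqP.
  by apply: part_same_inj => i j; rewrite same_actV !same_bot (inj_eq perm_inj).
have -> : [set t *c s | t in young mu, s in young la] = (young la * young mu)%g.
  apply/setP=> y; apply/imset2P/mulsgP => [[t s tm sl ->]|[s t sl tm ->]].
    by exists s t.
  by exists t s.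
have := mul_cardG [group of young la] [group of young mu]; rewrite -/(young la) /=.
rewrite -young_meet lm young_bot cards1 muln1 => <-.
rewrite natrM mulrA -invfM mulrC [X in _ / X]mulrC mulfV //.
by rewrite mulf_neq0 // card_young_neq0.
Qed.

End ClassFunctions.

(** * Integral inversion of the matrix of multiplicities *)

Section IntegralSolution.
Variables (n : nat) (ka : part n) (M : {set part n}).
Hypothesis M_sub : {in M, forall la, refines la ka}.
Hypothesis M_ex : forall la, refines la ka -> exists2 w, w \in young ka & pact w la \in M.
Hypothesis M_uniq : {in M &, forall la mu w, w \in young ka -> pact w la = mu -> la = mu}.

(** This stands for [sgn_mult], whose integrality only follows later, once its values are realised
    as multiplicities in sheaves. *)
Variables (N : part n -> part n -> int).
Hypothesis N_act : forall la mu w, w \in young ka -> refines la ka -> refines mu ka ->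
  N la (pact w mu) = N la mu.
Hypothesis N_neq0 : forall la mu, refines la ka -> refines mu ka -> N la mu != 0 ->
  exists2 y, y \in young ka & pmeet (pact y la) mu = pbot.
Hypothesis N_ferrers : forall la mu, ferrers ka la mu -> N la mu = 1.

Let conjugate_ex : exists P : part n -> part n,
  forall la, refines la ka -> ferrers ka la (P la).
Proof.
suff /choice[P hP] : forall la, exists mu, refines la ka -> ferrers ka la mu.
  by exists P.
move=> la; case: (boolP (refines la ka)) => [lk|_]; last by exists la.
by have [mu] := ferrers_exists lk; exists mu.
Qed.

Section Conjugate.
Variable P : part n -> part n.
Hypothesis PP : forall la, refines la ka -> ferrers ka la (P la).

Let P_sub la : refines la ka -> refines (P la) ka.
Proof. by case/PP. Qed.

(** A nonzero entry provides a [y] for which [mu] meets [pact y la] trivially, and the bound on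
    pairs applies. In the equality case [mu] and [pact y (P la)] are both columns for the rows
    [pact y la], hence conjugate by [ferrers_conj]. *)
Lemma unitriangular la mu : refines la ka -> refines mu ka -> N la mu != 0 ->
  (npairs mu <= npairs (P la))%N /\
  (npairs mu = npairs (P la) -> exists2 w, w \in young ka & mu = pact w (P la)).
Proof.
move=> lk mk /(N_neq0 lk mk)[y yk e]; have fe := ferrers_act yk (PP lk).
split; first by have := npairs_max fe mk e; rewrite npairs_act.
move=> h; have fm : ferrers ka (pact y la) mu.
  by apply: (npairs_eq fe) => //; rewrite npairs_act.
have [u uy um] := ferrers_conj (ferrersC fe) (ferrersC fm).
exists (u *c y); last by rewrite pactM.
have : refines (pact y la) ka by case: fe.
by rewrite refines_young => /subsetP h'; apply: youngM => //; apply: h'.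
Qed.

Lemma conjugate_inj : {in M &, forall la mu w, w \in young ka ->
  P mu = pact w (P la) -> la = mu}.
Proof.
move=> la mu lM mM w wk e.
have f1 := ferrers_act wk (PP (M_sub lM)); have f2 := PP (M_sub mM).
rewrite e in f2; have [u uy um] := ferrers_conj f1 f2.
apply: (M_uniq lM mM (w := u *c w)); last by rewrite pactM.
have : refines (pact w (P la)) ka by case: f1.
by rewrite refines_young => /subsetP h'; apply: youngM => //; apply: h'.
Qed.

Lemma N_same_height : {in M &, forall la mu,
  npairs (P la) = npairs (P mu) -> N la (P mu) = (la == mu)%:R}.
Proof.
move=> la mu lM mM h; have lk := M_sub lM; have mk := M_sub mM.
case: eqP => [<-|lm]; first by rewrite N_ferrers //; apply: PP.
apply/eqP/negP=> /negP /(unitriangular lk (P_sub mk))[_ /(_ (esym h))[w wk e]].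
exact/lm/(conjugate_inj lM mM wk).
Qed.

Lemma conjugate_onto mu : refines mu ka ->
  exists2 la, la \in M & exists2 w, w \in young ka & mu = pact w (P la).
Proof.
move=> mk; have [la0 fe0] := ferrers_exists mk.
have lk0 : refines la0 ka by case: fe0.
have [w wk lM] := M_ex lk0; exists (pact w la0) => //.
have f1 := PP (M_sub lM); have f2 := ferrersC (ferrers_act wk fe0).
have [u uy um] := ferrers_conj (ferrersC f1) (ferrersC f2).
have uk : u \in young ka.
  have : refines (pact w la0) ka by case: f1.
  by rewrite refines_young => /subsetP; apply.
exists (w^-1%g *c u); first by rewrite youngM ?groupV.
by rewrite pactM um pactK.
Qed.

(** Descending induction on the height [npairs (P la)]. In the equation at [P la], terms of smaller
    height have a zero entry, those of greater height a zero coefficient by induction, and at equal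
    height the matrix is the identity. *)
Lemma int_independent (c : part n -> int) :
  (forall mu, refines mu ka -> \sum_(la in M) N la mu * c la = 0) ->
  {in M, forall la, c la = 0}.
Proof.
move=> hc; suff H m la : la \in M -> (n * n - npairs (P la) < m)%N -> c la = 0.
  by move=> la lM; apply: (H _.+1).
elim: m la => // m IH la lM; rewrite ltnS => hm.
have := hc _ (P_sub (M_sub lM)); rewrite (bigD1 la) //= N_same_height // eqxx mul1r.
rewrite big1 ?addr0 // => mu /andP[mM ml].
have [->|nz] := eqVneq (N mu (P la)) 0; first by rewrite mul0r.
have [le eq] := unitriangular (M_sub mM) (P_sub (M_sub lM)) nz.
have [h|h] := eqVneq (npairs (P la)) (npairs (P mu)).
  by rewrite N_same_height // (negPf ml) mul0r.
rewrite (IH mu) ?mulr0 //; apply: leq_trans hm.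
rewrite ltn_sub2l //; last by rewrite ltn_neqAle h.
apply: (@leq_trans (npairs (P mu))); first by rewrite ltn_neqAle h.
rewrite /npairs; apply: leq_trans (max_card _) _.
by rewrite card_prod !card_ord.
Qed.

Lemma int_solvable (p : part n -> int) :
  (forall mu w, w \in young ka -> refines mu ka -> p (pact w mu) = p mu) ->
  exists c : part n -> int, forall mu, refines mu ka ->
    \sum_(la in M) N la mu * c la = p mu.
Proof.
(* Only the equations at heights of at least [(n * n).+1 - d] are imposed, and [d] grows by
   induction. For [d = 0] there are none, since there are only [n * n] pairs of points. *)
move=> p_act; suff [c hc] : exists c : part n -> int, forall mu, refines mu ka ->
    ((n * n).+1 - (n * n).+1 <= npairs mu)%N -> \sum_(la in M) N la mu * c la = p mu.
  by exists c => mu mk; rewrite hc // subnn.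
elim: {2}(n * n).+1 => [|d [c hc]].
  exists (fun=> 0) => mu _; rewrite subn0 ltnNge /npairs.
  by rewrite (leq_trans (max_card _)) // card_prod !card_ord.
set v := ((n * n).+1 - d.+1)%N.
(* The correction at height [v] leaves the equations of greater height untouched, their entries
   being zero there; at height [v] the matrix is the identity on representatives, so the defect
   itself is the right correction. *)
pose e la := if npairs (P la) == v then p (P la) - \sum_(l in M) N l (P la) * c l else 0.
exists (fun la => c la + e la) => mu mk; rewrite leq_eqVlt => vm.
under eq_bigr do rewrite mulrDr; rewrite big_split /=.
case/orP: vm => [/eqP vm|vm]; last first.
  rewrite hc //; last by apply: leq_trans vm; rewrite /v subnS leqSpred.
  rewrite big1 ?addr0 // => la lM; rewrite /e; case: eqP => h; last by rewrite mulr0.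
  have [->|nz] := eqVneq (N la mu) 0; first by rewrite mul0r.
  have [le _] := unitriangular (M_sub lM) mk nz.
  by move: vm; rewrite -h ltnNge le.
have [la0 lM0 [w wk muE]] := conjugate_onto mk.
have h0 : npairs (P la0) = v by rewrite vm muE npairs_act.
have Pk0 := P_sub (M_sub lM0).
rewrite [X in _ + X](bigD1 la0) //= [X in _ + (_ + X)]big1 ?addr0; last first.
  move=> la /andP[lM ll]; rewrite /e; case: eqP => h; last by rewrite mulr0.
  by rewrite muE (N_act wk (M_sub lM) Pk0) N_same_height ?h // (negPf ll) mul0r.
rewrite /e h0 eqxx {2}muE (N_act wk (M_sub lM0) Pk0) N_same_height // eqxx mul1r.
rewrite muE p_act // addrCA -[RHS]addr0; congr (_ + _); apply/eqP; rewrite subr_eq0.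
by apply/eqP; apply: eq_bigr => la lM; rewrite (N_act wk (M_sub lM) Pk0).
Qed.
End Conjugate.

Lemma young_independent (c : part n -> int) :
  (forall mu, refines mu ka -> \sum_(la in M) N la mu * c la = 0) ->
  {in M, forall la, c la = 0}.
Proof. by have [P PP] := conjugate_ex; apply: int_independent PP _. Qed.

Lemma young_solvable (p : part n -> int) :
  (forall mu w, w \in young ka -> refines mu ka -> p (pact w mu) = p mu) ->
  exists c : part n -> int, forall mu, refines mu ka ->
    \sum_(la in M) N la mu * c la = p mu.
Proof. by have [P PP] := conjugate_ex; apply: int_solvable PP _. Qed.

End IntegralSolution.

(** * Characters of sheaves *)

Section Traces.
Variable F : numFieldType.

Lemma mxtrace_kron p q (f : 'M[F]_p) (g : 'M[F]_q) : \tr (kron f g) = \tr f * \tr g.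
Proof.
rewrite /mxtrace (reindex _ (curry_mxvec_bij p q)) /= big_distrl /=.
rewrite (eq_bigr (fun i => \sum_j f i i * g j j)) => [|i _]; last by rewrite big_distrr.
rewrite pair_big /=; apply: eq_bigr => -[i j] _; exact: kron_entry.
Qed.

(** In the rank factorisation of an idempotent, the two factors multiply in the other order to the
    identity matrix, whose size is the rank. *)
Lemma mxtrace_idem p (f : 'M[F]_p) : f *m f = f -> \tr f = (\rank f)%:R.
Proof.
move=> ff; have cr := mulmx_base f; rewrite -{1}cr mxtrace_mulC.
suff -> : row_base f *m col_base f = 1%:M by rewrite mxtrace1.
apply: (row_free_inj (row_base_free f)); rewrite mul1mx -mulmxA cr.
apply: (row_full_inj (col_base_full f)).
by rewrite mulmxA cr ff.
Qed.
End Traces.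

Section GrothInd.
Variables (F : numFieldType) (n : nat) (nu mu : part n).
Local Open Scope quotient_scope.

Lemma groth_ind (P : groth F nu mu -> Prop) :
  P 0 -> (forall x y, P x -> P y -> P (x - y)) -> (forall A, P (cls A)) -> forall x, P x.
Proof.
move=> P0 PB Pc x; have PN y : P y -> P (- y) by move=> Py; rewrite -sub0r; apply: PB.
have PD y z : P y -> P z -> P (y + z) by move=> Py Pz; rewrite -[z]opprK; apply/PB/PN.
have PM (y : groth F nu mu) (m : nat) : P y -> P (y *+ m).
  by move=> Py; elim: m => [|m IH]; rewrite ?mulr0n // mulrS; apply: PD.
rewrite -[x]generic_quotient.reprK; set z : {malg (sheaf F nu mu)} := generic_quotient.repr _.
rewrite [z]monalgE raddf_sum.
elim/big_ind: _ => // A _.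
have -> : << z@_A *g A >> = << A >> *~ z@_A :> {malg (sheaf F nu mu)}.
  by rewrite -[in LHS](intz z@_A) (raddfMz (mkmalgU A)).
rewrite raddfMz; case: (z@_A) => m; rewrite ?NegzE ?mulrNz; first exact/PM/Pc.
exact/PN/PM/Pc.
Qed.
End GrothInd.

Section SheafCharacter.
Variables (F : numFieldType) (n : nat).
Implicit Types (la mu nu : part n) (x y g h a b w : 'S_n).

Section Objects.
Variables nu mu : part n.
Implicit Types A B C : sheaf F nu mu.

Definition sop A x g h : 'M[F]_(sdimT A) := gproj _ x *m lact A g *m ract A h.

(* The trace of (g, h) on the summand F_x, set to 0 outside of the group that acts. *)
Definition schar A x g h : F :=
  if (g \in young nu) && (h \in young mu) then \tr (sop A x g h) else 0.

Lemma gproj_lact A g x : g \in young nu ->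
  gproj _ x *m lact A g = lact A g *m gproj _ (g *c x).
Proof. by move=> gn; move: x; apply/homogP; [exact: pcompI | exact: lact_homog]. Qed.
Lemma gproj_ract A h x : h \in young mu ->
  gproj _ x *m ract A h = ract A h *m gproj _ (x *c h).
Proof. by move=> hm; move: x; apply/(homogP _ (@pcompIr _ h)); exact: ract_homog. Qed.

Lemma hom_gproj A B (f : 'M_(sdimT A, sdimT B)) x : is_hom f ->
  gproj _ x *m f = f *m gproj _ x.
Proof. by case=> hf _ _; move: x; apply/(homogP _ (@inj_id _)). Qed.

Lemma hom_sop A B (f : 'M_(sdimT A, sdimT B)) x g h : is_hom f ->
  g \in young nu -> h \in young mu -> sop A x g h *m f = f *m sop B x g h.
Proof.
move=> fh gn hm; case: (fh) => _ fl fr.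
by rewrite /sop -!mulmxA fr // (mulmxA _ f) fl // -mulmxA !mulmxA hom_gproj.
Qed.

(** A linear splitting of the sequence is enough: the operators commute with the two maps of the
    sequence, so the trace on [B] breaks up into the traces on [A] and [C]. *)
Lemma schar_ses x g h : @ses_additive F n nu mu _ (fun A => schar A x g h).
Proof.
move=> A B C f k [hf hk ff kf fk]; rewrite /schar; case: ifP => [/andP[gn hm]|_]; last first.
  by rewrite addr0.
have [fk0 [r [t [tk rt]]]] := exact_split ff kf fk.
have fr : f *m r = 1%:M.
  apply: (row_free_inj ff); rewrite mul1mx -mulmxA -[RHS]mulmx1 -rt mulmxDr.
  by rewrite (mulmxA f k) fk0 mul0mx addr0.
rewrite -[sop B x g h]mulmx1 -rt mulmxDr mxtraceD; congr (_ + _).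
  by rewrite mulmxA mxtrace_mulC mulmxA -hom_sop // -mulmxA fr mulmx1.
by rewrite mulmxA mxtrace_mulC hom_sop // mulmxA tk mul1mx.
Qed.

Lemma schar_conj A x g h a b : a \in young nu -> b \in young mu ->
  schar A (a *c x *c b) g h = schar A x (a^-1%g *c g *c a) (b *c h *c b^-1%g).
Proof.
move=> an bm; rewrite /schar.
have -> : (a^-1%g *c g *c a \in young nu) = (g \in young nu).
  by rewrite /pcomp groupMl // groupMr // groupV.
have -> : (b *c h *c b^-1%g \in young mu) = (h \in young mu).
  by rewrite /pcomp groupMl ?groupV // groupMr.
case: ifP => // /andP[gn hm].
have an' : a^-1%g \in young nu by rewrite groupV.
have bm' : b^-1%g \in young mu by rewrite groupV.
have LR : gproj _ x *m (lact A a *m ract A b) = lact A a *m ract A b *m gproj _ (a *c x *c b).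
  by rewrite mulmxA gproj_lact // -!mulmxA gproj_ract.
have inv : ract A b^-1%g *m lact A a^-1%g *m (lact A a *m ract A b) = 1%:M.
  rewrite mulmxA -(mulmxA (ract A _)) -lactM // pcompV lact1 mulmx1 -ractM //.
  by rewrite pVcomp ract1.
rewrite /sop -[gproj _ (a *c x *c b)]mul1mx -{1}inv.
rewrite -(mulmxA (_ *m _) (_ *m _)) -LR -!mulmxA mxtrace_mulC -!mulmxA mxtrace_mulC.
rewrite -!mulmxA; congr (\tr (_ *m _)).
rewrite lactM ?youngM // lactM // ractM ?youngM // ractM // -!mulmxA; congr (_ *m _).
rewrite -(lractC A an' bm') (mulmxA (ract A h)) -(lractC A an' hm) !mulmxA -(lractC A gn bm).
by rewrite -!mulmxA; congr (_ *m _); rewrite !mulmxA -(lractC A an' bm).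
Qed.

Lemma schar_supp A x g h : g *c x *c h != x -> schar A x g h = 0.
Proof.
move=> ne; rewrite /schar; case: ifP => // /andP[gn hm]; rewrite /sop.
have pp : gproj (sdim A) x = gproj (F := F) _ x *m gproj _ x by rewrite gproj_mul eqxx.
rewrite pp.
rewrite -!mulmxA (mulmxA (gproj _ x) (lact A g)) gproj_lact // -mulmxA gproj_ract //.
by rewrite mxtrace_mulC -!mulmxA gproj_mul (negPf ne) !mulmx0 mxtrace0.
Qed.

Lemma schar_cst (D : {set 'S_n}) x g h : g \in young nu -> h \in young mu ->
  schar (cst_sheaf F nu mu D) x g h = ((x \in csupp nu mu D) && (g *c x *c h == x))%:R.
Proof.
move=> gn hm; rewrite /schar gn hm /= /sop -mulmxA /=.
rewrite (@cst_mul F n nu mu D (pcomp g) (fun x => x *c h) id _ _ _ erefl erefl); last first.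
  by move=> y; rewrite csupp_l.
rewrite /mxtrace; case: (boolP (x \in csupp nu mu D)) => xD /=.
  have [i ix] := cst_idx xD; rewrite (bigD1 i) //= gproj_mulE mxE ix eqxx mul1r eq_sym.
  rewrite big1 ?addr0 // => j ji; rewrite gproj_mulE -ix (inj_eq (@cst_deg_inj _ _ _ _)).
  by rewrite (negPf ji) mul0r.
rewrite big1 // => i _; rewrite gproj_mulE; case: eqP => [e|_]; last by rewrite mul0r.
by rewrite -e cst_deg in xD.
Qed.
End Objects.

(** The convolution is the image of the projector [avg] on the tensor product, so a trace on it is
    the trace of the projector times the operator on the whole tensor product. There it expands into
    products of traces. *)
Lemma schar_conv nu mu la (A : sheaf F nu mu) (B : sheaf F mu la) x g h :
  schar (conv A B) x g h = #|young mu|%:R^-1 *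
    \sum_w \sum_y schar A y g w^-1%g * schar B (y^-1%g *c x) w h.
Proof.
rewrite {1}/schar; case: ifP => [/andP[gn hl]|no]; last first.
  rewrite big1 ?mulr0 // => w _; rewrite big1 // => y _; rewrite /schar.
  by move: no; case: (g \in _) => /= [->|]; rewrite ?andbF ?mulr0 // mul0r.
have /submxP[D avgE] := avg_cbasis A B.
have ED : cbasis A B *m D = 1%:M.
  by apply: (row_free_inj (cbasis_free A B)); rewrite mul1mx -mulmxA -avgE cbasis_avg.
have sopE : sop (conv A B) x g h *m cbasis A B =
    cbasis A B *m (tproj _ _ _ x *m kron (lact A g) (ract B h)).
  have L : lact (conv A B) g *m cbasis A B = cbasis A B *m kron (lact A g) 1%:M.
    by rewrite /= /comp_lact cmapE //; apply: comp_lst.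
  have R : ract (conv A B) h *m cbasis A B = cbasis A B *m kron 1%:M (ract B h).
    by rewrite /= /comp_ract cmapE //; apply: comp_rst.
  rewrite /sop -[LHS]mulmxA R mulmxA -(mulmxA _ (lact _ _)) L mulmxA -cbasis_proj.
  by rewrite -!mulmxA kron_mul mulmx1 mul1mx.
rewrite -[sop _ _ _ _]mulmx1 -{1}ED mulmxA sopE -mulmxA mxtrace_mulC -mulmxA -avgE.
rewrite /avg -scalemxAr mxtraceZ; congr (_ * _).
rewrite mulmx_sumr raddf_sum big_mkcond /=; apply: eq_bigr => w _.
case: ifP => wm; last first.
  by rewrite big1 // => y _; rewrite /schar groupV wm /= andbF mul0r.
rewrite tprojE -mulmxA mulmx_suml raddf_sum; apply: eq_bigr => y _ /=.
rewrite /tact !kron_mul mxtrace_kron /schar gn hl groupV wm /= /sop !mulmxA.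
by rewrite -!(mulmxA (gproj (sdim B) _)) lractC.
Qed.

End SheafCharacter.

(** * Averaging and idempotents *)

Section Averaging.
Variables (F : numFieldType) (n : nat) (nu mu : part n).
Implicit Types (A B C : sheaf F nu mu) (x y g h k : 'S_n).

(** The inverse of [sop A x g h]: it brings the stalk at [g *c x *c h] back to the stalk at [x]. *)
Definition sopV A x g h : 'M[F]_(sdimT A) :=
  ract A h^-1%g *m lact A g^-1%g *m gproj _ x.

Definition order_inv : F := (#|young nu| * #|young mu|)%:R^-1.

(** The sum over [x] keeps only the blocks between stalks at the same point, and the other two sums
    average over the groups: this projects all linear maps onto the morphisms. *)
Definition hom_avg A B (f : 'M[F]_(sdimT A, sdimT B)) : 'M[F]_(sdimT A, sdimT B) :=
  order_inv *: \sum_(g in young nu) \sum_(h in young mu) \sum_x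
    sopV A x g h *m f *m sop B x g h.

Definition hom_avg_mx A B : 'M[F]_(sdimT A * sdimT B) :=
  order_inv *: \sum_(g in young nu) \sum_(h in young mu) \sum_x
    kron (sopV A x g h)^T (sop B x g h).

Lemma hom_avg_mxE A B f : mxvec f *m hom_avg_mx A B = mxvec (hom_avg f).
Proof.
rewrite /hom_avg_mx /hom_avg [RHS]linearZ -scalemxAr; congr (_ *: _).
rewrite mulmx_sumr linear_sum; apply: eq_bigr => g _.
rewrite mulmx_sumr linear_sum; apply: eq_bigr => h _.
rewrite mulmx_sumr linear_sum; apply: eq_bigr => x _.
by rewrite kronE trmxK.
Qed.

Lemma gproj_sopV A x y g h : g \in young nu -> h \in young mu ->
  gproj _ y *m sopV A x g h = if y == g *c x *c h then sopV A x g h else 0.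
Proof.
move=> gn hm; rewrite /sopV !mulmxA gproj_ract ?groupV // -[_ *m lact _ _ *m _]mulmxA.
rewrite -mulmxA mulmxA -(mulmxA (ract _ _)) gproj_lact ?groupV // -!mulmxA gproj_mul.
have <- : (g^-1%g *c (y *c h^-1%g) == x) = (y == g *c x *c h).
  rewrite -(inj_eq (@pcompI _ g)) pcompVK -(inj_eq (@pcompIr _ h)).
  by rewrite -pcompA pVcomp pcomp1.
by case: eqP => [->|_]; rewrite ?mulmx0.
Qed.

Lemma sop_gproj B x y g h : g \in young nu -> h \in young mu ->
  sop B x g h *m gproj _ y = if y == g *c x *c h then sop B x g h else 0.
Proof.
move=> gn hm; rewrite /sop gproj_lact // -(mulmxA (lact _ _)) gproj_ract // -!mulmxA gproj_mul.
by rewrite eq_sym; case: eqP => _; rewrite ?mulmx0.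
Qed.

Lemma hom_avg_hom A B f : @is_hom F n nu mu A B (hom_avg f).
Proof.
split=> [|k kn|k km].
- apply/(homogP _ (@inj_id _)) => y; rewrite /hom_avg -scalemxAr -scalemxAl; congr (_ *: _).
  rewrite mulmx_sumr mulmx_suml; apply: eq_bigr => g gn.
  rewrite mulmx_sumr mulmx_suml; apply: eq_bigr => h hm.
  rewrite mulmx_sumr mulmx_suml; apply: eq_bigr => x _.
  rewrite mulmxA (mulmxA (gproj _ y) (sopV A x g h)) gproj_sopV //.
  rewrite -[RHS](mulmxA _ (sop B x g h)) sop_gproj //.
  by case: eqP; rewrite ?mulmx0 ?mul0mx.
- rewrite /hom_avg -scalemxAr -scalemxAl; congr (_ *: _).
  rewrite mulmx_sumr mulmx_suml (reindex_inj (@pcompI _ k)) /=.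
  rewrite (eq_bigl (fun g => g \in young nu)) => [|g]; last by rewrite /pcomp groupMr.
  apply: eq_bigr => g gn; rewrite mulmx_sumr mulmx_suml; apply: eq_bigr => h hm.
  rewrite mulmx_sumr mulmx_suml; apply: eq_bigr => x _.
  rewrite mulmxA (mulmxA (lact A k) (sopV A x (k *c g) h)).
  have -> : lact A k *m sopV A x (k *c g) h = sopV A x g h.
    rewrite /sopV !mulmxA lractC ?groupV // -(mulmxA (ract _ _)) -lactM ?groupV ?youngM //.
    by rewrite pinvM -pcompA pVcomp pcomp1.
  rewrite -[RHS]mulmxA; congr (_ *m _).
  by rewrite /sop -!mulmxA -lractC // (mulmxA (lact B g)) -lactM.
- rewrite /hom_avg -scalemxAr -scalemxAl; congr (_ *: _).
  rewrite mulmx_sumr mulmx_suml; apply: eq_bigr => g gn.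
  rewrite mulmx_sumr mulmx_suml (reindex_inj (@pcompIr _ k)) /=.
  rewrite (eq_bigl (fun h => h \in young mu)) => [|h]; last by rewrite /pcomp groupMl.
  apply: eq_bigr => h hm.
  rewrite mulmx_sumr mulmx_suml; apply: eq_bigr => x _.
  rewrite mulmxA (mulmxA (ract A k) (sopV A x g (h *c k))).
  have -> : ract A k *m sopV A x g (h *c k) = sopV A x g h.
    rewrite /sopV !mulmxA -ractM ?groupV ?youngM //.
    by rewrite pinvM pcompA pcompV p1comp.
  rewrite -[RHS]mulmxA; congr (_ *m _).
  by rewrite /sop -!mulmxA -ractM.
Qed.

Lemma order_inv_sum (V : lmodType F) (v : V) :
  order_inv *: (\sum_(g in young nu) \sum_(h in young mu) v) = v.
Proof.
rewrite !sumr_const -mulrnA -scaler_nat scalerA mulnC /order_inv mulVf ?scale1r //.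
by rewrite pnatr_eq0 -lt0n muln_gt0 !cardG_gt0.
Qed.

Lemma hom_avg_id A B f : @is_hom F n nu mu A B f -> hom_avg f = f.
Proof.
move=> fh; rewrite /hom_avg -[RHS]order_inv_sum; congr (_ *: _).
apply: eq_bigr => g gn; apply: eq_bigr => h hm.
transitivity (\sum_x (ract A h^-1%g *m lact A g^-1%g) *m gproj _ x *m (lact A g *m ract A h) *m f).
  apply: eq_bigr => x _; rewrite -mulmxA -(hom_sop _ fh) // mulmxA; congr (_ *m _).
  by rewrite /sopV /sop -!mulmxA; do 2![congr (_ *m _)]; rewrite !mulmxA gproj_mul eqxx.
rewrite -!mulmx_suml -mulmx_sumr gproj_sum mulmx1 -[X in X *m _]mulmxA.
rewrite (mulmxA (lact _ _)) -lactM ?groupV // pcompV lact1 mul1mx -ractM ?groupV //.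
by rewrite pVcomp ract1 mul1mx.
Qed.

Lemma hom_avg_mull A A' B (f : 'M_(sdimT A, sdimT A')) (M : 'M_(sdimT A', sdimT B)) :
  is_hom f -> f *m hom_avg M = hom_avg (f *m M).
Proof.
move=> fh; case: (fh) => _ fl fr; rewrite /hom_avg -scalemxAr; congr (_ *: _).
rewrite mulmx_sumr; apply: eq_bigr => g gn; rewrite mulmx_sumr; apply: eq_bigr => h hm.
rewrite mulmx_sumr; apply: eq_bigr => x _.
rewrite [LHS]mulmxA (mulmxA f (sopV A' x g h) M) (mulmxA (sopV A x g h) f M); congr (_ *m _ *m _).
rewrite /sopV !mulmxA -fr ?groupV // -(mulmxA _ f) -fl ?groupV //.
by rewrite -!mulmxA hom_gproj.
Qed.

Lemma hom_avg_mulr A B B' (f : 'M_(sdimT B, sdimT B')) (M : 'M_(sdimT A, sdimT B)) :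
  is_hom f -> hom_avg M *m f = hom_avg (M *m f).
Proof.
move=> fh; rewrite /hom_avg -scalemxAl; congr (_ *: _).
rewrite mulmx_suml; apply: eq_bigr => g gn; rewrite mulmx_suml; apply: eq_bigr => h hm.
rewrite mulmx_suml; apply: eq_bigr => x _.
by rewrite -[LHS]mulmxA (hom_sop x fh gn hm) [LHS]mulmxA -(mulmxA (sopV A x g h)).
Qed.

Definition hom_dim A B := \rank (hom_avg_mx A B).

(** The dimension of the space of morphisms is the rank of the projector, hence its trace, which is
    a product of characters term by term. In particular it depends on [B] only through the character
    of [B]. *)
Lemma hom_dimE A B : (hom_dim A B)%:R =
  order_inv * \sum_g \sum_h \sum_x schar A x g^-1%g h^-1%g * schar B x g h.
Proof.
rewrite /hom_dim -mxtrace_idem; last first.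
  by apply: mxvec_ext => M; rewrite mulmxA !hom_avg_mxE hom_avg_id //; apply: hom_avg_hom.
rewrite /hom_avg_mx mxtraceZ; congr (_ * _); rewrite raddf_sum big_mkcond /=.
apply: eq_bigr => g _; case: ifP => gn; last first.
  by rewrite big1 // => h _; rewrite big1 // => x _; rewrite /schar gn mulr0.
rewrite raddf_sum big_mkcond /=; apply: eq_bigr => h _; case: ifP => hm; last first.
  by rewrite big1 // => x _; rewrite /schar hm andbF mulr0.
rewrite raddf_sum; apply: eq_bigr => x _ /=; rewrite mxtrace_kron /schar !groupV gn hm /=.
congr (_ * _); rewrite mxtrace_tr /sopV /sop mxtrace_mulC -!mulmxA.
by rewrite lractC ?groupV.
Qed.

Lemma hom_dim_neq0 A B : hom_dim A B != 0%N ->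
  exists2 f : 'M_(sdimT A, sdimT B), is_hom f & f != 0.
Proof.
rewrite /hom_dim mxrank_eq0 => nz.
have [i nzi] : exists i, row i (hom_avg_mx A B) != 0.
  apply/existsP; apply: contraR nz; rewrite negb_exists => /forallP h.
  by apply/eqP/row_matrixP=> i; rewrite row0; move: (h i); rewrite negbK => /eqP.
exists (hom_avg (vec_mx (delta_mx 0 i))); first exact: hom_avg_hom.
apply: contraNneq nzi => e; rewrite rowE -[delta_mx _ _]vec_mxK hom_avg_mxE e.
by rewrite linear0.
Qed.

Lemma hom_dim_self A : (0 < sdimT A)%N -> hom_dim A A != 0%N.
Proof.
move=> A0; rewrite /hom_dim mxrank_eq0; apply/eqP=> e.
have := hom_avg_mxE (1%:M : 'M_(sdimT A)).
rewrite e mulmx0 hom_avg_id; last exact: is_hom1.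
move/(congr1 vec_mx); rewrite mxvecK linear0 => /esym/matrixP/(_ (Ordinal A0) (Ordinal A0)).
by rewrite !mxE eqxx => /eqP; rewrite oner_eq0.
Qed.

(** Averaging commutes with composition with a morphism, so the average of a linear pseudo-inverse
    is still a pseudo-inverse. *)
Lemma hom_pinv A B (f : 'M_(sdimT A, sdimT B)) : is_hom f ->
  exists2 f' : 'M_(sdimT B, sdimT A), is_hom f' & f *m f' *m f = f.
Proof.
move=> fh; exists (hom_avg (pinvmx f)); first exact: hom_avg_hom.
by rewrite hom_avg_mull // hom_avg_mulr // mulmxKpV // hom_avg_id.
Qed.
End Averaging.

Section IdempotentImage.
Variables (F : numFieldType) (n : nat) (nu mu : part n) (A : sheaf F nu mu).
Variable p : 'M[F]_(sdimT A).
Hypotheses (p_hom : is_hom p) (p_idem : p *m p = p).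

Let W x := gproj (sdim A) x *m p.

Let p_gproj x : gproj (sdim A) x *m p = p *m gproj _ x.
Proof. exact: hom_gproj. Qed.

Let W_proj x : W x *m gproj (sdim A) x = W x.
Proof. by rewrite /W -mulmxA -p_gproj mulmxA gproj_mul eqxx. Qed.
Let W_proj0 x y : x != y -> W x *m gproj (sdim A) y = 0.
Proof. by move=> xy; rewrite /W -mulmxA -p_gproj mulmxA gproj_mul (negPf xy) mul0mx. Qed.

Definition im_basis := hbasis W.
Definition im_coord := locked (p *m pinvmx im_basis).

Lemma im_basis_free : row_free im_basis.
Proof. exact: (hbasis_free W_proj W_proj0). Qed.

Lemma im_basis_gproj x : im_basis *m gproj _ x = gproj _ x *m im_basis.
Proof. exact: (hbasis_proj W_proj W_proj0). Qed.

Lemma im_basis_id : im_basis *m p = im_basis.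
Proof.
apply/row_matrixP=> i; rewrite row_mul.
have /submxP[D ->] := hbasis_sub (W := W) i.
by rewrite -mulmxA /W -[_ *m p *m p]mulmxA p_idem.
Qed.

Lemma im_coordK : im_coord *m im_basis = p.
Proof.
rewrite /im_coord -lock mulmxKpV // -[p]mul1mx -(gproj_sum F (sdim A)) mulmx_suml.
apply: summx_sub => x _; exact: hbasis_sup.
Qed.

Lemma im_basisK : im_basis *m im_coord = 1%:M.
Proof.
apply: (row_free_inj im_basis_free).
by rewrite mul1mx -mulmxA im_coordK im_basis_id.
Qed.

Lemma im_coord_id : p *m im_coord = im_coord.
Proof. by rewrite /im_coord -lock mulmxA p_idem. Qed.

Definition im_map (f : 'M[F]_(sdimT A)) := im_basis *m f *m im_coord.

Lemma im_map1 : im_map 1%:M = 1%:M.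
Proof. by rewrite /im_map mulmx1 im_basisK. Qed.
Lemma im_mapM f g : f *m p = p *m f -> im_map f *m im_map g = im_map (f *m g).
Proof.
move=> fp; rewrite /im_map -!mulmxA.
rewrite (mulmxA im_coord) im_coordK (mulmxA f p) fp -(mulmxA p f).
by rewrite (mulmxA im_basis p) im_basis_id.
Qed.
Lemma im_map_basis f : f *m p = p *m f -> im_map f *m im_basis = im_basis *m f.
Proof.
by move=> fp; rewrite /im_map -!mulmxA im_coordK fp (mulmxA im_basis p) im_basis_id.
Qed.
Lemma im_coord_map f : f *m p = p *m f -> im_coord *m im_map f = f *m im_coord.
Proof.
by move=> fp; rewrite /im_map !mulmxA im_coordK -fp -mulmxA im_coord_id.
Qed.

Lemma im_map_homog f s : injective s -> f *m p = p *m f -> homog s f -> homog s (im_map f).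
Proof.
move=> s_inj fp /(homogP _ s_inj) fs; apply/(homogP _ s_inj) => x.
apply: (row_free_inj im_basis_free).
rewrite -[LHS]mulmxA im_map_basis // [LHS]mulmxA -im_basis_gproj -[LHS]mulmxA fs [LHS]mulmxA.
by rewrite -[RHS]mulmxA -im_basis_gproj [RHS]mulmxA im_map_basis.
Qed.

Let lp g : g \in young nu -> lact A g *m p = p *m lact A g.
Proof. by case: p_hom => _ + _; apply. Qed.
Let rp g : g \in young mu -> ract A g *m p = p *m ract A g.
Proof. by case: p_hom => _ _; apply. Qed.

Definition im_lact g := im_map (lact A g).
Definition im_ract g := im_map (ract A g).

Fact im_lact1 : im_lact 1%g = 1%:M. Proof. by rewrite /im_lact lact1 im_map1. Qed.
Fact im_ract1 : im_ract 1%g = 1%:M. Proof. by rewrite /im_ract ract1 im_map1. Qed.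
Fact im_lactM : {in young nu &, forall g h, im_lact (g *c h) = im_lact h *m im_lact g}.
Proof. by move=> g h gn hn; rewrite /im_lact im_mapM ?lp // lactM. Qed.
Fact im_ractM : {in young mu &, forall g h, im_ract (g *c h) = im_ract g *m im_ract h}.
Proof. by move=> g h gn hn; rewrite /im_ract im_mapM ?rp // ractM. Qed.
Fact im_lractC : {in young nu & young mu, forall g h,
  im_lact g *m im_ract h = im_ract h *m im_lact g}.
Proof. by move=> g h gn hn; rewrite /im_lact /im_ract !im_mapM ?rp ?lp // lractC. Qed.
Fact im_lact_homog : {in young nu, forall g, homog (fun x => g *c x) (im_lact g)}.
Proof.
move=> g gn; apply: im_map_homog; [exact: pcompI | exact: lp | exact: lact_homog].
Qed.
Fact im_ract_homog : {in young mu, forall h, homog (fun x => x *c h) (im_ract h)}.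
Proof.
move=> g gn; apply: im_map_homog; [exact: pcompIr | exact: rp | exact: ract_homog].
Qed.

Definition im_sheaf : sheaf F nu mu :=
  Sheaf im_lact1 im_lactM im_ract1 im_ractM im_lractC im_lact_homog im_ract_homog.

Lemma im_basis_hom : @is_hom F n nu mu im_sheaf A im_basis.
Proof.
split=> [|g gn|g gm]; last 2 first.
- by rewrite /= /im_lact im_map_basis ?lp.
- by rewrite /= /im_ract im_map_basis ?rp.
by apply/(homogP _ (@inj_id _)) => x; rewrite im_basis_gproj.
Qed.

Lemma im_coord_hom : @is_hom F n nu mu A im_sheaf im_coord.
Proof.
split=> [|g gn|g gm]; last 2 first.
- by rewrite /= /im_lact im_coord_map ?lp.
- by rewrite /= /im_ract im_coord_map ?rp.
apply/(homogP _ (@inj_id _)) => x; apply: (row_free_inj im_basis_free).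
by rewrite -[LHS]mulmxA im_coordK -[RHS]mulmxA -im_basis_gproj [RHS]mulmxA im_coordK p_gproj.
Qed.

Lemma im_dim : sdimT im_sheaf = \rank p.
Proof.
have -> : sdimT im_sheaf = \rank im_basis by apply/esym/eqP/im_basis_free.
apply/eqP; rewrite eqn_leq; apply/andP; split.
  by rewrite -im_basis_id mxrankM_maxr.
by rewrite -[X in (\rank X <= _)%N]im_coordK mxrankM_maxr.
Qed.
End IdempotentImage.

(** * A class is determined by its character *)

Section CharacterInjectivity.
Variables (F : numFieldType) (n : nat) (nu mu : part n).
Implicit Types (A B C : sheaf F nu mu) (x y g h k : 'S_n).

Lemma cls_dim0 A : sdimT A = 0%N -> cls A = 0.
Proof.
move=> A0; have : cls A = cls A + cls A.
  apply: (@cls_ses F n nu mu A A A 1%:M 0); split.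
  - exact: is_hom1.
  - by split=> [i j|g _|g _]; rewrite ?mxE ?eqxx ?mulmx0 ?mul0mx.
  - exact: row_free1.
  - by rewrite /row_full mxrank0 A0.
  - by rewrite kermx0 submx_refl submx1.
by move/eqP; rewrite -subr_eq subrr eq_sym => /eqP.
Qed.

Lemma is_homB A B (f f' : 'M_(sdimT A, sdimT B)) : is_hom f -> is_hom f' -> is_hom (f - f').
Proof.
move=> fh fh'; case: (fh) => _ fl fr; case: (fh') => _ fl' fr'; split=> [|g gn|g gn].
- by apply/(homogP _ (@inj_id _)) => x; rewrite mulmxBr mulmxBl !hom_gproj.
- by rewrite mulmxBr mulmxBl fl ?fl'.
- by rewrite mulmxBr mulmxBl fr ?fr'.
Qed.

Lemma is_homM A B C (f : 'M_(sdimT A, sdimT B)) (f' : 'M_(sdimT B, sdimT C)) :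
  is_hom f -> is_hom f' -> is_hom (f *m f').
Proof.
move=> fh fh'; case: (fh) => _ fl fr; case: (fh') => _ fl' fr'; split=> [|g gn|g gn].
- by apply/(homogP _ (@inj_id _)) => x; rewrite [LHS]mulmxA (hom_gproj _ fh) -[LHS]mulmxA (hom_gproj _ fh') [LHS]mulmxA.
- by rewrite [LHS]mulmxA fl // -[LHS]mulmxA fl' // [LHS]mulmxA.
- by rewrite [LHS]mulmxA fr // -[LHS]mulmxA fr' // [LHS]mulmxA.
Qed.

Lemma idemC A (p : 'M[F]_(sdimT A)) : p *m p = p -> (1%:M - p) *m (1%:M - p) = 1%:M - p.
Proof. by move=> pp; rewrite mulmxBr mulmx1 mulmxBl mul1mx pp subrr subr0. Qed.

Lemma is_homC A (p : 'M_(sdimT A)) : @is_hom F n nu mu A A p -> @is_hom F n nu mu A A (1%:M - p).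
Proof. by move=> ph; apply: is_homB => //; apply: is_hom1. Qed.

Lemma cls_im A (p : 'M_(sdimT A)) (ph : @is_hom F n nu mu A A p) (pp : p *m p = p) :
  cls A = cls (im_sheaf (is_homC ph) (idemC pp)) + cls (im_sheaf ph pp).
Proof.
pose q := 1%:M - p; pose qq := idemC pp; pose qh := is_homC ph.
refine (@cls_ses F n nu mu (im_sheaf qh qq) A (im_sheaf ph pp) (im_basis q) (im_coord p) _).
split.
- exact: im_basis_hom.
- exact: im_coord_hom.
- exact: im_basis_free.
- by apply/row_fullP; exists (im_basis p); apply: im_basisK.
- have pq : im_basis q *m p = 0.
    by rewrite -(im_basis_id qq) -mulmxA mulmxBl mul1mx pp subrr mulmx0.
  apply/andP; split.
    apply/sub_kermxP; apply: (row_free_inj (im_basis_free ph)).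
    by rewrite -mulmxA im_coordK // mul0mx.
  set u := kermx _; have u0 : u *m p = 0.
    by rewrite -(im_coordK p) mulmxA mulmx_ker mul0mx.
  apply/submxP; exists (u *m im_coord q).
  by rewrite -mulmxA im_coordK // mulmxBr mulmx1 u0 subr0.
Qed.

(** Both images are compared inside [B], the first one being carried there by [f]. *)
Lemma cls_im_iso A B (f : 'M_(sdimT A, sdimT B)) (f' : 'M_(sdimT B, sdimT A))
    (ph : @is_hom F n nu mu A A (f *m f')) (pp : f *m f' *m (f *m f') = f *m f')
    (qh : @is_hom F n nu mu B B (f' *m f)) (qq : f' *m f *m (f' *m f) = f' *m f) :
  is_hom f -> cls (im_sheaf ph pp) = cls (im_sheaf qh qq).
Proof.
move=> fh; have e1 := im_basis_id pp; have e2 := im_basis_id qq.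
have E1 : im_basis (f *m f') *m f *m (f' *m f) = im_basis (f *m f') *m f.
  have e : im_basis (f *m f') *m f *m (f' *m f) = im_basis (f *m f') *m (f *m f') *m f.
    by rewrite !mulmxA.
  by rewrite e e1.
have E2 : im_basis (f' *m f) *m f' *m (f *m f') *m f = im_basis (f' *m f).
  have e : im_basis (f' *m f) *m (f' *m f) *m (f' *m f) =
      im_basis (f' *m f) *m f' *m (f *m f') *m f by rewrite !mulmxA.
  by rewrite -e !e2.
have [_ bl br] := im_basis_hom ph pp; have [_ bl' br'] := im_basis_hom qh qq.
case: (fh) => _ fl fr.
apply: (@cls_embed F n nu mu (im_sheaf ph pp) (im_sheaf qh qq) _ (gproj (sdim B)) (lact B) (ract B)
   (im_basis (f *m f') *m f) (im_basis (f' *m f))).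
- apply: inj_row_free => v v0; apply: (row_free_inj (im_basis_free ph)).
  have e : v *m (im_basis (f *m f') *m f) *m f' = v *m (im_basis (f *m f') *m (f *m f')).
    by rewrite !mulmxA.
  by rewrite mul0mx -[RHS](mul0mx _ f') -v0 e e1.
- exact: im_basis_free.
- by rewrite -E1 -[X in (_ *m X <= _)%MS]im_coordK mulmxA submxMl.
- rewrite -{1}E2; apply: submxMr.
  by rewrite -[X in (_ *m X <= _)%MS]im_coordK mulmxA submxMl.
- by move=> x; rewrite [LHS]mulmxA -im_basis_gproj // -[LHS]mulmxA (hom_gproj _ fh) [LHS]mulmxA.
- by move=> x; rewrite im_basis_gproj.
- by move=> g gn; rewrite [LHS]mulmxA bl // -[LHS]mulmxA fl // [LHS]mulmxA.
- exact: bl'.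
- by move=> g gn; rewrite [LHS]mulmxA br // -[LHS]mulmxA fr // [LHS]mulmxA.
- exact: br'.
Qed.

Definition gchar x g h : groth F nu mu -> F := groth_lift (fun A => schar A x g h).

Lemma gcharB x g h : {morph gchar x g h : X Y / X - Y}.
Proof. exact: groth_liftB (@schar_ses F n nu mu x g h). Qed.
HB.instance Definition _ x g h :=
  GRing.isZmodMorphism.Build (groth F nu mu) F (gchar x g h) (gcharB x g h).

Lemma gchar_cls A x g h : gchar x g h (cls A) = schar A x g h.
Proof. exact: groth_lift_cls (@schar_ses F n nu mu x g h) A. Qed.

Lemma schar_dim A : \sum_x schar A x 1%g 1%g = (sdimT A)%:R.
Proof.
under eq_bigr do rewrite /schar !group1 /= /sop lact1 ract1 !mulmx1.
by rewrite -raddf_sum gproj_sum /= mxtrace1.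
Qed.

Definition csum (s : seq (sheaf F nu mu)) : groth F nu mu := \sum_(A <- s) cls A.

Lemma gchar_csum x g h s : gchar x g h (csum s) = \sum_(A <- s) schar A x g h.
Proof.
by rewrite /csum (raddf_sum (gchar x g h)); apply: eq_bigr => A _; apply: gchar_cls.
Qed.

Lemma gchar_dim (s : seq (sheaf F nu mu)) :
  \sum_x gchar x 1%g 1%g (csum s) = (\sum_(A <- s) sdimT A)%:R.
Proof.
rewrite (eq_bigr (fun x => \sum_(A <- s) schar A x 1%g 1%g)) => [|x _].
  by rewrite exchange_big natr_sum; apply: eq_bigr => A _; apply: schar_dim.
exact: gchar_csum.
Qed.

Lemma csum_dim0 s : (\sum_(A <- s) sdimT A)%N = 0%N -> csum s = 0.
Proof.
move=> /eqP; rewrite sum_nat_seq_eq0 => /allP h; rewrite /csum big_seq big1 // => A As.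
by apply/cls_dim0/eqP/h.
Qed.

(** Lists are needed because a nonzero morphism relates just one term of each sum; splitting off its
    image leaves two lists to which the induction applies. *)
Lemma csum_inj s t : (forall x g h, gchar x g h (csum s) = gchar x g h (csum t)) ->
  csum s = csum t.
Proof.
elim: {s}_.+1 {-2}s (ltnSn (\sum_(A <- s) sdimT A)) t => // m IH s; rewrite ltnS => sm t st.
have dims : (\sum_(A <- s) sdimT A = \sum_(A <- t) sdimT A)%N.
  apply/eqP; rewrite -(eqr_nat F) -!gchar_dim; apply/eqP/eq_bigr => x _; exact: st.
case: (boolP (all (fun A => sdimT A == 0%N) s)) => [s0|].
  have d0 : (\sum_(A <- s) sdimT A = 0)%N by apply/eqP; rewrite sum_nat_seq_eq0.
  by rewrite !csum_dim0 // -dims.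
rewrite -has_predC => /hasP[A As]; rewrite /= -lt0n => A0.
have : (\sum_(B <- t) hom_dim A B)%N != 0%N.
  have <- : (\sum_(B <- s) hom_dim A B = \sum_(B <- t) hom_dim A B)%N.
    have form r : (\sum_(B <- r) hom_dim A B)%:R = order_inv F nu mu *
        \sum_g \sum_h \sum_x schar A x g^-1%g h^-1%g * gchar x g h (csum r).
      rewrite natr_sum; under eq_bigr do rewrite hom_dimE.
      rewrite -mulr_sumr; congr (_ * _); rewrite exchange_big; apply: eq_bigr => g _ /=.
      rewrite exchange_big; apply: eq_bigr => h _ /=; rewrite exchange_big.
      by apply: eq_bigr => x _ /=; rewrite -mulr_sumr gchar_csum.
    apply/eqP; rewrite -(eqr_nat F) !form; apply/eqP; congr (_ * _).
    apply: eq_bigr => g _; apply: eq_bigr => h _; apply: eq_bigr => x _.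
    by rewrite st.
  rewrite (perm_big _ (perm_to_rem As)) big_cons addn_eq0 negb_and.
  by rewrite hom_dim_self.
rewrite sum_nat_seq_eq0 => /allPn[B Bt] /hom_dim_neq0[f fh f0].
have [f' fh' ff] := hom_pinv fh.
have ph := is_homM fh fh'; have qh := is_homM fh' fh.
have pp : f *m f' *m (f *m f') = f *m f' by rewrite mulmxA ff.
have qq : f' *m f *m (f' *m f) = f' *m f by rewrite -mulmxA (mulmxA f) ff.
have eA := cls_im ph pp; have eB := cls_im qh qq.
have eAB := cls_im_iso ph pp qh qq fh.
set A' := im_sheaf (is_homC ph) _ in eA; set B' := im_sheaf (is_homC qh) _ in eB.
have sE : csum s = csum (A' :: rem A s) + cls (im_sheaf ph pp).
  by rewrite /csum (perm_big _ (perm_to_rem As)) !big_cons eA addrAC.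
have tE : csum t = csum (B' :: rem B t) + cls (im_sheaf ph pp).
  by rewrite eAB /csum (perm_big _ (perm_to_rem Bt)) !big_cons eB addrAC.
rewrite sE tE; congr (_ + _); apply: IH => [|x g h].
  apply: leq_trans sm; rewrite (perm_big _ (perm_to_rem As)) !big_cons ltn_add2r.
  (* If the complement had full dimension, the idempotent [f *m f'] would vanish, and with it
     [f = f *m f' *m f]. *)
  rewrite im_dim ltn_neqAle rank_leq_row andbT; apply/negP => /eqP e.
  have u : row_free (1%:M - f *m f') by rewrite /row_free e.
  have : f *m f' = 0.
    have full : row_full (1%:M - f *m f') by rewrite /row_full e.
    apply: (row_full_inj full); rewrite mulmx0 mulmxBl mul1mx.
    by rewrite mulmxA ff subrr.
  by move=> z; move: f0; rewrite -ff z mul0mx eqxx.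
by have := st x g h; rewrite sE tE !raddfD /= => /addIr.
Qed.

Lemma gchar_inj (X Y : groth F nu mu) :
  (forall x g h, gchar x g h X = gchar x g h Y) -> X = Y.
Proof.
move=> XY; apply/eqP; rewrite -subr_eq0; apply/eqP; set Z := X - Y.
have : forall x g h, gchar x g h Z = 0 by move=> x g h; rewrite /Z gcharB XY subrr.
have [s [t ->]] : exists s t, Z = csum s - csum t.
  elim/groth_ind: Z => [|x y [s [t ->]] [s' [t' ->]]|A].
  - by exists [::], [::]; rewrite subrr.
  - exists (s ++ t'), (t ++ s'); rewrite /csum !big_cat /=.
    by rewrite opprB !opprD addrACA [- _ - _]addrC addrACA.
  - by exists [:: A], [::]; rewrite /csum big_nil big_seq1 subr0.
move=> st; apply/eqP; rewrite subr_eq0; apply/eqP; apply: csum_inj => x g h.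
by apply/eqP; rewrite -subr_eq0 -gcharB st.
Qed.

(* The multiplicity of the sign of young ka in the stalk at x, on which g acts as
   (g, x^-1 g^-1 x). *)
Lemma gchar_int (X : groth F nu mu) x ka : refines ka nu -> refines ka (pact x mu) ->
  exists z : int, #|young ka|%:R^-1 *
    \sum_(g in young ka) sgn F g * gchar x g (x^-1%g *c g^-1%g *c x) X = z%:~R.
Proof.
rewrite !refines_young => /subsetP kn /subsetP km.
have kmu g : g \in young ka -> x^-1%g *c g^-1%g *c x \in young mu.
  by move=> gk; rewrite -young_act km ?groupV.
elim/groth_ind: X => [|X Y [a ea] [b eb]|A].
- by exists 0; rewrite big1 ?mulr0 // => g _; rewrite (raddf0 (gchar _ _ _)) mulr0.
- exists (a - b); rewrite intrB -ea -eb -mulrBr -sumrB; congr (_ * _).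
  by apply: eq_bigr => g _; rewrite gcharB mulrBr.
pose r g := lact A g *m ract A (x^-1%g *c g^-1%g *c x).
have rM g h : g \in young ka -> h \in young ka -> r (g *c h) = r h *m r g.
  move=> gk hk; rewrite /r lactM ?kn //.
  have -> : x^-1%g *c (g *c h)^-1%g *c x =
      (x^-1%g *c h^-1%g *c x) *c (x^-1%g *c g^-1%g *c x).
    by rewrite pinvM -!pcompA pcompVK.
  rewrite ractM ?kmu // !mulmxA -(mulmxA _ (lact A g)) lractC ?kmu ?kn //.
  by rewrite !mulmxA.
have rP g : g \in young ka -> gproj _ x *m r g = r g *m gproj _ x.
  move=> gk; rewrite /r mulmxA gproj_lact ?kn // -!mulmxA gproj_ract ?kmu //.
  by rewrite -!pcompA !pcompVK.
(* The projector onto the vectors on which [young ka] acts by the sign. It commutes with the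
   projection to the stalk at [x], and the rank of their product is the integer sought. *)
pose e := #|young ka|%:R^-1 *: \sum_(g in young ka) sgn F g *: r g.
have er g : g \in young ka -> e *m r g = sgn F g *: e.
  move=> gk; rewrite /e -scalemxAl scalerA mulrC -scalerA; congr (_ *: _).
  rewrite mulmx_suml scaler_sumr [RHS](reindex_inj (@pcompI _ g)) /=.
  apply: eq_big => [h|h hk]; first by rewrite /pcomp groupMr.
  by rewrite -scalemxAl -rM // scalerA sgnM mulrA sgn2 mul1r.
have ee : e *m e = e.
  rewrite {2}/e -scalemxAr mulmx_sumr (eq_bigr (fun=> e)) => [|g gk].
    by rewrite sumr_const -scaler_nat scalerA mulVf ?card_young_neq0 // scale1r.
  by rewrite -scalemxAr er // scalerA sgn2 scale1r.
have eP : gproj _ x *m e = e *m gproj _ x.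
  rewrite /e -scalemxAl -scalemxAr mulmx_suml mulmx_sumr; congr (_ *: _).
  by apply: eq_bigr => g gk; rewrite -scalemxAl -scalemxAr rP.
exists (\rank (gproj _ x *m e)); rewrite -pmulrn -mxtrace_idem; last first.
  by rewrite eP mulmxA -(mulmxA e _ e) eP mulmxA ee -mulmxA gproj_mul eqxx.
rewrite /e -scalemxAr mxtraceZ; congr (_ * _); rewrite mulmx_sumr raddf_sum.
apply: eq_bigr => g gk /=; rewrite gchar_cls /schar kn // kmu //=.
by rewrite -scalemxAr mxtraceZ /sop /r mulmxA.
Qed.

End CharacterInjectivity.

(** * Characters of elements of the ring *)

Section GrothCharacter.
Variables (F : numFieldType) (n : nat).
Implicit Types (nu mu la : part n) (x y g h k a b w : 'S_n).

Lemma gchar_out nu mu (X : groth F nu mu) x g h :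
  ~~ ((g \in young nu) && (h \in young mu)) -> gchar x g h X = 0.
Proof.
move=> no; elim/groth_ind: X => [|X Y eX eY|A].
- exact: (raddf0 (gchar x g h)).
- by rewrite gcharB eX eY subrr.
- by rewrite gchar_cls /schar (negPf no).
Qed.

Lemma gchar_supp nu mu (X : groth F nu mu) x g h :
  g *c x *c h != x -> gchar x g h X = 0.
Proof.
move=> no; elim/groth_ind: X => [|X Y eX eY|A].
- exact: (raddf0 (gchar x g h)).
- by rewrite gcharB eX eY subrr.
- by rewrite gchar_cls schar_supp.
Qed.

Lemma gchar_conj nu mu (X : groth F nu mu) x g h a b : a \in young nu -> b \in young mu ->
  gchar (a *c x *c b) g h X = gchar x (a^-1%g *c g *c a) (b *c h *c b^-1%g) X.
Proof.
move=> an bm; elim/groth_ind: X => [|X Y eX eY|A].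
- by rewrite (raddf0 (gchar _ _ _)) (raddf0 (gchar _ _ _)).
- by rewrite !gcharB eX eY.
- by rewrite !gchar_cls schar_conj.
Qed.

Lemma gchar_kmul nu mu la (X : groth F nu mu) (Y : groth F mu la) x g h :
  gchar x g h (kmul X Y) = #|young mu|%:R^-1 *
    \sum_w \sum_y gchar y g w^-1%g X * gchar (y^-1%g *c x) w h Y.
Proof.
elim/groth_ind: X => [|X X' eX eX'|A].
- rewrite kmul0l (raddf0 (gchar x g h)) big1 ?mulr0 // => w _; rewrite big1 // => y _.
  by rewrite (raddf0 (gchar _ _ _)) mul0r.
- rewrite kmulBl gcharB eX eX' -mulrBr -sumrB; congr (_ * _); apply: eq_bigr => w _.
  by rewrite -sumrB; apply: eq_bigr => y _; rewrite gcharB mulrBl.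
elim/groth_ind: Y => [|Y Y' eY eY'|B].
- rewrite kmul0r (raddf0 (gchar x g h)) big1 ?mulr0 // => w _; rewrite big1 // => y _.
  by rewrite (raddf0 (gchar _ _ _)) mulr0.
- rewrite kmulBr gcharB eY eY' -mulrBr -sumrB; congr (_ * _); apply: eq_bigr => w _.
  by rewrite -sumrB; apply: eq_bigr => y _; rewrite gcharB mulrBr.
rewrite kmul_cls gchar_cls schar_conv; congr (_ * _).
by apply: eq_bigr => w _; apply: eq_bigr => y _; rewrite !gchar_cls.
Qed.
End GrothCharacter.

Section RingCharacter.
Variables (F : numFieldType) (n : nat).
Implicit Types (nu mu la ka : part n) (x y g h k a b w z : 'S_n) (X Y : partring F n).

Definition chi nu la x g h X : F := gchar x g h (entry X nu la).

Lemma chiB nu la x g h : {morph chi nu la x g h : X Y / X - Y}.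
Proof. by move=> X Y; rewrite /chi /entry !ffunE gcharB. Qed.
HB.instance Definition _ nu la x g h :=
  GRing.isZmodMorphism.Build (partring F n) F (chi nu la x g h) (@chiB nu la x g h).

Lemma chi_inj X Y : (forall nu la x g h, chi nu la x g h X = chi nu la x g h Y) -> X = Y.
Proof.
by move=> XY; apply/ffunP=> -[nu la]; apply: gchar_inj => x g h; apply: XY.
Qed.

Lemma chi_sum nu la x g h (I : finType) (P : pred I) (f : I -> partring F n) :
  chi nu la x g h (\sum_(i | P i) f i) = \sum_(i | P i) chi nu la x g h (f i).
Proof. exact: (raddf_sum (chi nu la x g h)). Qed.

Lemma chi_out nu la x g h X :
  ~~ ((g \in young nu) && (h \in young la)) -> chi nu la x g h X = 0.
Proof. exact: gchar_out. Qed.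

Lemma chi_supp nu la x g h X : g *c x *c h != x -> chi nu la x g h X = 0.
Proof. exact: gchar_supp. Qed.

Lemma chi_conj nu la x g h a b X : a \in young nu -> b \in young la ->
  chi nu la (a *c x *c b) g h X = chi nu la x (a^-1%g *c g *c a) (b *c h *c b^-1%g) X.
Proof. exact: gchar_conj. Qed.

Lemma chi_conjr nu la x g h b X : b \in young la ->
  chi nu la (x *c b) g (b^-1%g *c h *c b) X = chi nu la x g h X.
Proof.
move=> bl; rewrite -[x]p1comp chi_conj ?group1 // invg1 !p1comp pcomp1.
by rewrite -!pcompA pcompV pcomp1 pcompVK.
Qed.

Lemma chi_conjl nu la x g h a X : a \in young nu ->
  chi nu la (a *c x) (a *c g *c a^-1%g) h X = chi nu la x g h X.
Proof.
move=> an; rewrite -[a *c x]pcomp1 chi_conj ?group1 // invg1 p1comp pcomp1.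
by rewrite -!pcompA pVcomp pcomp1 pcompK.
Qed.

Lemma chiM nu la x g h X Y : chi nu la x g h (X * Y) =
  \sum_mu #|young mu|%:R^-1 *
    \sum_k \sum_y chi nu mu y g k^-1%g X * chi mu la (y^-1%g *c x) k h Y.
Proof.
rewrite /chi /entry ffunE /= (raddf_sum (gchar x g h)); apply: eq_bigr => mu _ /=.
exact: gchar_kmul.
Qed.

Lemma chi_cst nu la D nu' la' x g h : chi nu' la' x g h (cst_class F nu la D) =
  ([&& nu' == nu, la' == la, g \in young nu, h \in young la, x \in csupp nu la D &
     g *c x *c h == x])%:R.
Proof.
rewrite /chi /entry ffunE xpair_eqE; case: eqP => [->|_] /=; last exact: (raddf0 (gchar x g h)).
case: eqP => [->|_] /=; last exact: (raddf0 (gchar x g h)).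
rewrite gchar_cls; case: (boolP (g \in young nu)) => [gn|no] /=; last first.
  by rewrite /schar (negPf no).
case: (boolP (h \in young la)) => [hl|no] /=; last by rewrite /schar (negPf no) andbF.
exact: schar_cst.
Qed.

Definition larger nu mu := if refines mu nu then young nu else young mu.

Lemma largerl nu mu : refines mu nu -> larger nu mu = young nu.
Proof. by rewrite /larger => ->. Qed.
Lemma largerr nu mu : refines nu mu -> larger nu mu = young mu.
Proof. by rewrite /larger => h; case: ifP => // /(refines_anti h)->. Qed.

Lemma chi_pone nu mu nu' mu' x g h : part_comparable nu mu ->
  chi nu' mu' x g h (pone F nu mu) =
  ([&& nu' == nu, mu' == mu, g \in young nu, h \in young mu, x \in larger nu mu &
     g *c x *c h == x])%:R.
Proof. by move=> c; rewrite chi_cst; have [_ _ ->] := pone_supp c. Qed.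

Lemma mem_dcoset_star w la x :
  (x \in dcoset (young (pact w la)) w (young la)) = (w^-1%g *c x \in young la).
Proof.
apply/imset2P/idP => [[g h gw hl ->]|xl].
  rewrite -pcompA (pcompA w^-1%g) pcompA; apply: youngM => //.
  by rewrite -young_act.
by exists 1%g (w^-1%g *c x); rewrite ?group1 // p1comp pcompVK.
Qed.

Lemma chi_pstar w nu la x g h : chi nu la x g h (pstar F w) =
  ([&& nu == pact w la, w^-1%g *c x \in young la, g \in young nu, h \in young la &
     g *c x *c h == x])%:R.
Proof.
rewrite /pstar chi_sum (bigD1 la) //= big1 ?addr0; last first.
  by move=> mu ml; rewrite chi_cst [la == mu]eq_sym (negPf ml) andbF.
rewrite chi_cst eqxx pstar_supp mem_dcoset_star /=; case: eqP => [->|] //=.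
by case: (w^-1%g *c x \in _); rewrite ?andbF.
Qed.

(** Only the middle index [pact w la] survives in [chiM]. There, as many [y] as [young mu] has
    elements contribute, each for a single [k], and conjugation invariance makes these contributions
    equal, which cancels the normalisation. *)
Lemma chi_mul_star nu la x g h X w : chi nu la x g h (X * pstar F w) =
  chi nu (pact w la) (x *c w^-1%g) g (w *c h *c w^-1%g) X.
Proof.
set mu := pact w la; rewrite chiM (bigD1 mu) //= [X in _ + X]big1 ?addr0; last first.
  move=> ka kn; rewrite big1 ?mulr0 // => k _; rewrite big1 // => y _.
  by rewrite chi_pstar (negPf kn) mulr0.
have hE : (w *c h *c w^-1%g \in young mu) = (h \in young la).
  by rewrite /mu young_act -!pcompA pVcomp pcomp1 pcompK.
case: (boolP (h \in young la)) => hl; last first.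
  rewrite [RHS]chi_out ?hE ?(negPf hl) ?andbF // big1 ?mulr0 // => k _; rewrite big1 // => y _.
  by rewrite chi_pstar (negPf hl) !andbF mulr0.
rewrite exchange_big (reindex_inj (h := fun u => x *c w^-1%g *c u^-1%g)) /=; last first.
  by move=> u v /pcompI/invg_inj.
rewrite (eq_bigr (fun u => if u \in young mu then
    chi nu mu (x *c w^-1%g) g (w *c h *c w^-1%g) X else 0)).
  rewrite -big_mkcond sumr_const -[X in _ * X]mulr_natl mulKf //.
  exact: card_young_neq0.
move=> u _; set y := x *c w^-1%g *c u^-1%g.
have yx : y^-1%g *c x = u *c w.
  by rewrite /y !pinvM !invgK -!pcompA pVcomp pcomp1.
have ul : (w^-1%g *c (u *c w) \in young la) = (u \in young mu).
  by rewrite /mu young_act pcompA.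
under eq_bigr do rewrite chi_pstar yx ul eqxx hl /=.
case: (boolP (u \in young mu)) => um /=; last by rewrite big1 // => k _; rewrite mulr0.
have uh : u *c (w *c h *c w^-1%g) *c u^-1%g \in young mu.
  by apply: youngM; rewrite ?groupV //; apply: youngM; rewrite ?hE.
rewrite (bigD1 (u *c (w *c h^-1%g *c w^-1%g) *c u^-1%g)) //= big1 ?addr0.
  have inv : (u *c (w *c h^-1%g *c w^-1%g) *c u^-1%g)^-1%g = u *c (w *c h *c w^-1%g) *c u^-1%g.
    by rewrite !pinvM !invgK !pcompA.
  rewrite inv -groupV inv uh /=.
  rewrite -!pcompA pcompK pcompA pcompK pVcomp pcomp1 eqxx mulr1.
  have := @chi_conjr nu mu (x *c w^-1%g) g (w *c h *c w^-1%g) u^-1%g X.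
  by rewrite groupV invgK /y -!pcompA => ->.
move=> k kn; case: (k \in young mu); rewrite ?mulr0 //=; case: eqP => [e|_]; last by rewrite mulr0.
case/eqP: kn; move: e; rewrite -!pcompA => e.
apply: (@pcompIr _ u); apply: (@pcompIr _ w); apply: (@pcompIr _ h).
by rewrite -!pcompA e !pcompK pVcomp pcomp1.
Qed.

Lemma chi_star_mul nu la x g h X w : chi nu la x g h (pstar F w * X) =
  chi (pact w^-1%g nu) la (w^-1%g *c x) (w^-1%g *c g *c w) h X.
Proof.
set mu := pact w^-1%g nu; have nuE : nu = pact w mu by rewrite /mu pactVK.
rewrite chiM (bigD1 mu) //= [X in _ + X]big1 ?addr0; last first.
  move=> ka kn; rewrite big1 ?mulr0 // => k _; rewrite big1 // => y _.
  by rewrite chi_pstar nuE (inj_eq (@pact_inj _ w)) eq_sym (negPf kn) mul0r.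
have gE : (w^-1%g *c g *c w \in young mu) = (g \in young nu) by rewrite nuE young_act.
case: (boolP (g \in young nu)) => gn; last first.
  rewrite [RHS]chi_out ?gE ?(negPf gn) // big1 ?mulr0 // => k _; rewrite big1 // => y _.
  by rewrite chi_pstar (negPf gn) !andbF mul0r.
rewrite exchange_big (reindex_inj (@pcompI _ w)) /=.
rewrite (eq_bigr (fun u => if u \in young mu then
    chi mu la (w^-1%g *c x) (w^-1%g *c g *c w) h X else 0)).
  rewrite -big_mkcond sumr_const -[X in _ * X]mulr_natl mulKf //.
  exact: card_young_neq0.
move=> u _.
under eq_bigr do rewrite chi_pstar pcompK -nuE eqxx gn groupV /=.
case: (boolP (u \in young mu)) => um /=; last by rewrite big1 // => k _; rewrite mul0r.
have uh : u^-1%g *c (w^-1%g *c g *c w) *c u \in young mu.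
  by apply: youngM => //; apply: youngM; rewrite ?groupV ?gE.
rewrite (bigD1 (u^-1%g *c (w^-1%g *c g *c w) *c u)) //= big1 ?addr0.
  have -> : g *c (w *c u) *c (u^-1%g *c (w^-1%g *c g *c w) *c u)^-1%g == w *c u.
    by rewrite !pinvM !invgK -!pcompA !pcompVK eqxx.
  rewrite uh mul1r pinvM -pcompA.
  have := @chi_conjl mu la (w^-1%g *c x) (w^-1%g *c g *c w) h u^-1%g X.
  by rewrite groupV invgK => ->.
move=> k kn; case: (k \in young mu); rewrite ?mul0r //=; case: eqP => [e|_]; last by rewrite mul0r.
case/eqP: kn; apply: (@pcompI _ u); apply: (@pcompI _ w).
have -> : w *c (u *c (u^-1%g *c (w^-1%g *c g *c w) *c u)) = g *c (w *c u).
  by rewrite -!pcompA pcompVK pcompVK.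
by rewrite [LHS]pcompA -{1}e -!pcompA pVcomp pcomp1.
Qed.

End RingCharacter.

(** * The relations *)

Section RingRelations.
Variables (F : numFieldType) (n : nat).
Implicit Types (nu mu la ka : part n) (x y g h k a b w z : 'S_n) (X Y : partring F n).
Local Notation one := (@pone F n).
Local Notation star := (@pstar F n).

(* The number of ways to write x = y z with y and z in the supports of the two
   factors and (g, h) fixing (y, z) up to the action of young mu. *)
Definition nfactor nu mu la x g := #|[set y in larger nu mu |
  (y^-1%g *c x \in larger mu la) && (y^-1%g *c g *c y \in young mu)]|.

Lemma chi_pone_mul nu mu la nu' la' x g h :
    part_comparable nu mu -> part_comparable mu la ->
  chi nu' la' x g h (one nu mu * one mu la) =
  ([&& nu' == nu, la' == la, g \in young nu, h \in young la & g *c x *c h == x])%:R *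
  (#|young mu|%:R^-1 * (nfactor nu mu la x g)%:R).
Proof.
move=> c1 c2; rewrite chiM (bigD1 mu) //= [X in _ + X]big1 ?addr0; last first.
  move=> ka km; rewrite big1 ?mulr0 // => k _; rewrite big1 // => y _.
  by rewrite chi_pone // (negPf km) andbF mul0r.
rewrite mulrCA; congr (_ * _); rewrite exchange_big /= /nfactor -sum1_card natr_sum.
rewrite [in RHS]big_mkcond [RHS]mulr_sumr /=; apply: eq_bigr => y _.
under eq_bigr do rewrite !chi_pone // -natrM mulnb groupV !eqxx /=.
(* The first factor vanishes unless [(g, k^-1)] fixes [y], which determines [k]. *)
rewrite (bigD1 (y^-1%g *c g *c y)) //= big1 ?addr0; last first.
  move=> k kn; case: (g *c y *c k^-1%g =P y) => [e|_]; last by rewrite !andbF.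
  case/eqP: kn; apply: (@pcompI _ y).
  by rewrite -{1}e -!pcompA pVcomp pcomp1 pcompVK.
have -> : g *c y *c (y^-1%g *c g *c y)^-1%g == y.
  by rewrite !pinvM invgK -!pcompA !pcompVK.
have -> : (y^-1%g *c g *c y *c (y^-1%g *c x) *c h == y^-1%g *c x) = (g *c x *c h == x).
  by rewrite -!pcompA pcompVK (inj_eq (@pcompI _ _)).
rewrite [X in if X then _ else _]in_set.
case: (nu' == nu); rewrite ?mul0r //=; case: (la' == la); rewrite ?andbF ?mul0r //=.
case: (g \in young nu); rewrite ?mul0r //=; case: (h \in young la); rewrite ?andbF ?mul0r //=.
case: (g *c x *c h == x); rewrite ?andbF ?mul0r //= mul1r !andbT.
case: (y \in larger nu mu); rewrite ?andbF //=.
by case: (y^-1%g *c g *c y \in young mu); rewrite ?andbF // andbT; case: (_ \in larger mu la).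
Qed.

Lemma conj_of_fix x y g h mu : g *c x *c h = x -> h \in young mu ->
  y^-1%g *c x \in young mu -> y^-1%g *c g *c y \in young mu.
Proof.
move=> e hm ym; have -> : y^-1%g *c g *c y = y^-1%g *c x *c h^-1%g *c (y^-1%g *c x)^-1%g.
  by rewrite -{1}e pinvM invgK -!pcompA !pcompVK.
by apply: youngM; rewrite ?groupV //; apply: youngM; rewrite ?groupV.
Qed.

Lemma card_pcompV (A : {set 'S_n}) x : #|[set y | y^-1%g *c x \in A]| = #|A|.
Proof.
have f_inj : injective (fun y => y^-1%g *c x) by move=> a b /pcompIr/invg_inj.
rewrite -(card_imset _ f_inj); apply: eq_card => u; apply/imsetP/idP => [[y]|uA].
  by rewrite in_set => h ->.
by exists (x *c u^-1%g); rewrite ?in_set pinvM invgK -pcompA pVcomp pcomp1.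
Qed.

(** In an ascending or descending chain one of the two factors of [x] runs freely over [young mu]
    and the other follows; the condition on the conjugate of [g] is then automatic. *)
Lemma nfactor_chain nu mu la x g h :
    (refines la mu && refines mu nu) || (refines nu mu && refines mu la) ->
    g \in young nu -> h \in young la -> g *c x *c h = x ->
  nfactor nu mu la x g = (#|young mu| * (x \in larger nu la))%N.
Proof.
move=> /orP[] /andP[c1 c2] gn hl e.
  have lm := subsetP (youngS c1); have mn := subsetP (youngS c2).
  rewrite /nfactor !largerl ?(refines_trans c1 c2) //.
  case: (boolP (x \in young nu)) => xn; rewrite ?muln1 ?muln0.
    rewrite -[RHS](card_pcompV _ x); apply: eq_card => y; rewrite [LHS]in_set [RHS]in_set.
    apply/and3P/idP => [[]//|yx]; split=> //; last exact: conj_of_fix e (lm _ hl) yx.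
    have -> : y = x *c (y^-1%g *c x)^-1%g by rewrite pinvM invgK pcompVK.
    by rewrite youngM ?groupV // mn.
  apply/eqP; rewrite cards_eq0; apply/eqP/setP=> y; rewrite [LHS]in_set [RHS]in_set0.
  apply/negP=> /and3P[yn yx _]; case/negP: xn.
  by rewrite -(pcompVK y x); apply: youngM => //; apply: mn.
have nm := subsetP (youngS c1); have ml := subsetP (youngS c2).
rewrite /nfactor !largerr ?(refines_trans c1 c2) //.
have -> : [set y in young mu | (y^-1%g *c x \in young la) && (y^-1%g *c g *c y \in young mu)] =
    if x \in young la then young mu else set0.
  apply/setP=> y; rewrite [LHS]in_set; case: (boolP (y \in young mu)) => ym /=; last first.
    by case: ifP => _; rewrite ?in_set0 // (negPf ym).
  have -> : (y^-1%g *c x \in young la) = (x \in young la).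
    by rewrite /pcomp groupMr // groupV ml.
  have -> : y^-1%g *c g *c y \in young mu.
    by apply: youngM => //; apply: youngM; [rewrite groupV | exact: nm].
  rewrite andbT.
  by case: ifP; rewrite ?ym ?in_set0.
by case: ifP => _; rewrite ?cards0 ?muln1 ?muln0.
Qed.

Lemma one_chain nu mu la :
    (refines la mu && refines mu nu) || (refines nu mu && refines mu la) ->
  one nu mu * one mu la = one nu la.
Proof.
move=> c; have [c1 c2 c3] : [/\ part_comparable nu mu, part_comparable mu la & part_comparable nu la].
  rewrite /part_comparable; case/orP: c => /andP[c1 c2].
    by rewrite c1 c2 (refines_trans c1 c2) !orbT.
  by rewrite c1 c2 (refines_trans c1 c2).
apply: chi_inj => nu' la' x g h; rewrite chi_pone_mul // chi_pone //.
case: (nu' == nu); rewrite ?mul0r //=; case: (la' == la); rewrite ?andbF ?mul0r //=.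
case: (boolP (g \in young nu)) => gn; rewrite ?mul0r //=.
case: (boolP (h \in young la)) => hl; rewrite ?andbF ?mul0r //=.
case: eqP => e; rewrite ?andbF ?mul0r //= mul1r andbT (nfactor_chain c gn hl e).
by rewrite natrM mulKf // card_young_neq0.
Qed.

Lemma one_orth la mu : mu != la -> one la la * one mu mu = 0.
Proof.
move=> ml; apply: chi_inj => nu' la' x g h; rewrite chiM (raddf0 (chi _ _ _ _ _)).
rewrite big1 // => ka _; rewrite big1 ?mulr0 // => k _; rewrite big1 // => y _.
rewrite !chi_pone ?part_comparable_refl // -natrM mulnb.
case: (ka =P la) => [->|_]; last by rewrite andbF.
by rewrite [la == mu]eq_sym (negPf ml) !andbF.
Qed.

Lemma starM w z : star w * star z = star (w *c z).
Proof.
apply: chi_inj => nu la x g h; rewrite chi_star_mul !chi_pstar pactM pinvM.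
rewrite (can2_eq (pactVK w) (pactK w)) pcompA.
by rewrite -young_act pactVK -!pcompA pcompVK (inj_eq (@pcompI _ _)).
Qed.

Lemma star1 : star 1%g = \sum_la one la la.
Proof.
apply: chi_inj => nu la x g h; rewrite chi_pstar chi_sum pact1 invg1 p1comp.
rewrite (bigD1 nu) //= big1 ?addr0 => [|mu mn]; last first.
  by rewrite chi_pone ?part_comparable_refl // eq_sym (negPf mn).
rewrite chi_pone ?part_comparable_refl // eqxx largerl ?refines_refl // [la == nu]eq_sym.
case: eqP => [->|] //=; congr (nat_of_bool _)%:R.
by case: (x \in _); rewrite ?andbF.
Qed.

Lemma mem_larger_act w nu mu x :
  (x \in larger (pact w nu) (pact w mu)) = (w^-1%g *c x *c w \in larger nu mu).
Proof. by rewrite /larger refines_act; case: ifP => _; rewrite young_act. Qed.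

Lemma star_one w mu nu : part_comparable mu nu ->
  star w * one nu mu = one (pact w nu) (pact w mu) * star w.
Proof.
rewrite part_comparableC => c; apply: chi_inj => nu' la x g h.
rewrite chi_star_mul chi_mul_star !chi_pone ?part_comparable_act // mem_larger_act.
rewrite (can2_eq (pactVK w) (pactK w)) (inj_eq (@pact_inj _ w)) !young_act.
have -> : w^-1%g *c (w *c h *c w^-1%g) *c w = h.
  by rewrite -!pcompA pVcomp pcomp1 pcompK.
have -> : w^-1%g *c (x *c w^-1%g) *c w = w^-1%g *c x.
  by rewrite -!pcompA pVcomp pcomp1.
rewrite -!pcompA pcompVK pcompK (inj_eq (@pcompI _ _)) !pcompA.
by rewrite (inj_eq (@pcompIr _ w^-1%g)).
Qed.

Lemma larger_mull nu mu w x : part_comparable nu mu -> w \in young nu ->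
  (w *c x \in larger nu mu) = (x \in larger nu mu).
Proof.
move=> /orP[c|c] wn; rewrite ?(largerl c) ?(largerr c) /pcomp groupMr //.
exact: subsetP (youngS c) _ wn.
Qed.

Lemma larger_mulr nu mu w x : part_comparable nu mu -> w \in young mu ->
  (x *c w \in larger nu mu) = (x \in larger nu mu).
Proof.
move=> /orP[c|c] wm; rewrite ?(largerl c) ?(largerr c) /pcomp groupMl //.
exact: subsetP (youngS c) _ wm.
Qed.

Lemma star_one_abs w mu nu : part_comparable mu nu -> w \in young nu ->
  star w * one nu mu = one nu mu.
Proof.
rewrite part_comparableC => c wn; apply: chi_inj => nu' la x g h.
have wn' : w^-1%g \in young nu by rewrite groupV.
rewrite chi_star_mul !chi_pone // larger_mull // (can2_eq (pactVK w) (pactK w)).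
rewrite pact_young_id // -young_act pact_young_id //.
by rewrite -!pcompA pcompVK (inj_eq (@pcompI _ _)).
Qed.

Lemma one_star_abs w mu nu : part_comparable mu nu -> w \in young mu ->
  one nu mu * star w = one nu mu.
Proof.
rewrite part_comparableC => c wm; apply: chi_inj => nu' la x g h.
have wm' : w^-1%g \in young mu by rewrite groupV.
rewrite chi_mul_star !chi_pone // larger_mulr //.
have -> : (pact w la == mu) = (la == mu).
  by rewrite -{1}(pact_young_id wm) (inj_eq (@pact_inj _ w)).
have -> : (w *c h *c w^-1%g \in young mu) = (h \in young mu).
  by rewrite /pcomp groupMl // groupMr.
by rewrite -!pcompA pcompK !pcompA (inj_eq (@pcompIr _ w^-1%g)).
Qed.

(** Any two factorisations of [x] differ by an element of the intersection of the two subgroups. *)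
Lemma card_factor_dcoset nu la ka x : young ka = young nu :&: young la ->
  #|[set y in young nu | y^-1%g *c x \in young la]| =
  (#|young ka| * (x \in dcoset (young nu) 1%g (young la)))%N.
Proof.
move=> kE; case: imset2P => [[a b an bl xE]|no]; last first.
  rewrite muln0; apply/eqP; rewrite cards_eq0; apply/eqP/setP=> y.
  rewrite [LHS]in_set in_set0; apply/negP=> /andP[yn yl]; apply: no.
  by exists y (y^-1%g *c x); rewrite // pcomp1 pcompVK.
rewrite pcomp1 in xE; rewrite muln1 -[RHS](card_imset _ (@pcompI _ a)).
apply: eq_card => y; rewrite [LHS]in_set; apply/andP/imsetP => [[yn yx]|[u]].
  exists (a^-1%g *c y); last by rewrite pcompVK.
  rewrite kE in_setI youngM ?groupV //= -groupV pinvM invgK.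
  have -> : y^-1%g *c a = y^-1%g *c x *c b^-1%g by rewrite xE -!pcompA pcompV pcomp1.
  by rewrite youngM ?groupV.
rewrite kE in_setI => /andP[un ul] ->; split; first exact: youngM.
by rewrite pinvM xE -pcompA pcompK youngM ?groupV.
Qed.

Lemma chi_one_meet nu la x g h nu' la' :
  chi nu' la' x g h (one nu (pmeet nu la) * one (pmeet nu la) la) =
  ([&& nu' == nu, la' == la, g \in young nu, h \in young la,
       x \in dcoset (young nu) 1%g (young la) & g *c x *c h == x])%:R.
Proof.
set ka := pmeet nu la.
have kn : refines ka nu by apply: pmeet_l.
have kl : refines ka la by apply: pmeet_r.
rewrite chi_pone_mul /part_comparable ?kn ?kl ?orbT //.
case: (nu' == nu); rewrite ?mul0r //=; case: (la' == la); rewrite ?andbF ?mul0r //=.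
case: (boolP (g \in young nu)) => gn; rewrite ?mul0r //=.
case: (boolP (h \in young la)) => hl; rewrite ?andbF ?mul0r //=.
case: eqP => e; rewrite ?andbF ?mul0r //= mul1r andbT.
suff -> : nfactor nu ka la x g = (#|young ka| * (x \in dcoset (young nu) 1%g (young la)))%N.
  by rewrite natrM mulKf // card_young_neq0.
rewrite -(card_factor_dcoset x (young_meet nu la)) /nfactor largerl // largerr //.
apply: eq_card => y; rewrite [LHS]in_set [RHS]in_set; apply/and3P/andP => [[]//|[yn yx]]; split=> //.
rewrite young_meet in_setI (conj_of_fix e hl yx) andbT.
by apply: youngM => //; apply: youngM; rewrite ?groupV.
Qed.

(** Disjointness and covering are packed into one sum of indicators, the form used both in the
    Mackey relation and for the representatives in the basis. *)
Lemma transversal_dcoset (G : {group 'S_n}) mu la (Z : {set 'S_n}) x :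
    young mu \subset G -> young la \subset G ->
    is_transversal Z (dcosets (young mu) G (young la)) G ->
  (\sum_(z in Z) (x \in dcoset (young mu) z (young la)) = (x \in G))%N.
Proof.
move=> /subsetP mG /subsetP lG /and3P[P_part /subsetP Zn /forall_inP Z1].
have GM a b : a \in G -> b \in G -> a *c b \in G by move=> aG bG; apply: groupM.
have dself w : w \in dcoset (young mu) w (young la).
  by apply/imset2P; exists 1%g 1%g; rewrite ?group1 // p1comp pcomp1.
have dmem w : w \in G -> dcoset (young mu) w (young la) \in
    dcosets (young mu) G (young la) by move=> wn; apply: imset_f.
case: (boolP (x \in G)) => xn; last first.
  rewrite big1 // => z zZ; case: imset2P => // -[a b am bl xE]; case/negP: xn.
  by rewrite xE (GM _ _ (GM _ _ (mG _ am) (Zn _ zZ)) (lG _ bl)).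
have /cards1P[z zE] := Z1 _ (dmem _ xn).
have /setIP[zZ zx] : z \in Z :&: dcoset (young mu) x (young la) by rewrite zE set11.
case/and3P: P_part => _ tI _.
have eqd a b : a \in G -> b \in G -> a \in dcoset (young mu) b (young la) ->
    dcoset (young mu) a (young la) = dcoset (young mu) b (young la).
  move=> an bn ab; rewrite -(def_pblock tI (dmem _ an) (dself a)).
  by rewrite -(def_pblock tI (dmem _ bn) ab).
rewrite (bigD1 z) //= -(eqd _ _ (Zn _ zZ) xn zx) in zE *.
rewrite (eqd _ _ (Zn _ zZ) xn zx) dself big1 ?addn0 // => z' /andP[z'Z z'z].
apply/eqP; rewrite eqb0; apply: contra z'z => xz'.
rewrite -in_set1 -zE inE z'Z (eqd _ _ (Zn _ zZ) xn zx) (eqd _ _ xn (Zn _ z'Z) xz').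
exact: dself.
Qed.

(** * The Mackey relation *)

Section Mackey.
Variables (la mu nu : part n) (Z : {set 'S_n}).
Hypotheses (ln : refines la nu) (mn : refines mu nu).
Hypothesis Z_trans :
  is_transversal Z (dcosets (young mu) (young nu) (young la)) (young nu).

(** Both sides have the character of the constant sheaf on [young nu]. On the right, by
    [chi_one_meet], each term is constant on the product set of [young mu] and [young (pact z la)],
    translated by [z] to the double coset of [z]. *)
Lemma mackey_star : one mu nu * one nu la =
  \sum_(z in Z) one mu (pmeet mu (pact z la)) *
    one (pmeet mu (pact z la)) (pact z la) * star z.
Proof.
apply: chi_inj => mu' la' x g h; rewrite chi_sum.
pose E : bool := [&& mu' == mu, la' == la, g \in young mu, h \in young la & g *c x *c h == x].
transitivity ((E && (x \in young nu))%:R : F).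
  rewrite chi_pone_mul /part_comparable ?ln ?mn ?orbT // -/E.
  case: (boolP E) => [|_]; last by rewrite mul0r.
  case/and5P=> _ _ gm hl /eqP e; rewrite mul1r /nfactor largerr // largerl //=.
  have -> : [set y in young nu | (y^-1%g *c x \in young nu) && (y^-1%g *c g *c y \in young nu)] =
      if x \in young nu then young nu else set0.
    apply/setP=> y; rewrite [LHS]in_set; case: (boolP (y \in young nu)) => yn /=; last first.
      by case: ifP => _; rewrite ?in_set0 // (negPf yn).
    have -> : (y^-1%g *c x \in young nu) = (x \in young nu).
      by rewrite /pcomp groupMr // groupV.
    have -> : y^-1%g *c g *c y \in young nu.
      by apply: youngM => //; apply: youngM; [rewrite groupV | exact: subsetP (youngS mn) _ gm].
    rewrite andbT.
    by case: ifP; rewrite ?yn ?in_set0.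
  by case: ifP => _; rewrite ?cards0 ?mulr0 // mulVf // card_young_neq0.
transitivity (\sum_(z in Z) (E && (x \in dcoset (young mu) z (young la)))%:R : F).
  case: E; last by rewrite big1.
  rewrite /= -(transversal_dcoset (G := [group of young nu]) x _ _ Z_trans) ?natr_sum //=;
    exact: youngS.
apply: eq_bigr => z zZ; rewrite chi_mul_star chi_one_meet.
rewrite (inj_eq (@pact_inj _ z)) young_act /E.
have -> : z^-1%g *c (z *c h *c z^-1%g) *c z = h.
  by rewrite -!pcompA pVcomp pcomp1 pcompK.
have -> : g *c (x *c z^-1%g) *c (z *c h *c z^-1%g) == x *c z^-1%g = (g *c x *c h == x).
  by rewrite -!pcompA pcompK !pcompA (inj_eq (@pcompIr _ z^-1%g)).
have -> : (x *c z^-1%g \in dcoset (young mu) 1%g (young (pact z la))) =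
    (x \in dcoset (young mu) z (young la)).
  apply/imset2P/imset2P => [[a b am bl xE]|[a b am bl xE]].
    exists a (z^-1%g *c b *c z); rewrite // -?young_act //.
    by rewrite -!pcompA pcompVK !pcompA -[a]pcomp1 -xE -pcompA pVcomp pcomp1.
  exists a (z *c b *c z^-1%g); rewrite // ?young_act -?pcompA ?pVcomp ?pcomp1 ?pcompK //.
  by rewrite xE p1comp !pcompA.
congr (nat_of_bool _)%:R; rewrite -!andbA; do 4!congr (_ && _).
exact: andbC.
Qed.

Lemma mackey_star' :
  \sum_(z in Z) one mu (pmeet mu (pact z la)) * star z *
    one (pmeet (pact z^-1%g mu) la) la =
  \sum_(z in Z) one mu (pmeet mu (pact z la)) *
    one (pmeet mu (pact z la)) (pact z la) * star z.
Proof.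
apply: eq_bigr => z _; rewrite -mulrA star_one.
  by rewrite pact_meet pactVK mulrA.
by rewrite /part_comparable pmeet_r orbT.
Qed.
End Mackey.

Lemma pone_relations (Z : part n -> part n -> part n -> {set 'S_n}) :
  (forall la mu nu, refines la nu -> refines mu nu ->
     is_transversal (Z mu nu la) (dcosets (young mu) (young nu) (young la)) (young nu)) ->
  relations eq one star Z.
Proof.
move=> HZ; split.
- by move=> la mu nu; apply: one_chain.
- exact: one_orth.
- exact: starM.
- exact: star1.
- by move=> w mu nu; apply: star_one.
- by move=> w mu nu; apply: star_one_abs.
- by move=> w mu nu; apply: one_star_abs.
- by move=> la mu nu ln mn; rewrite mackey_star' (mackey_star ln mn (HZ _ _ _ ln mn)).
- by move=> la mu nu ln mn; apply: mackey_star'.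
Qed.

End RingRelations.

(** * The basis *)

Section OrbitTransversal.
Variables (n : nat) (ka : part n) (M : {set part n}).
Hypothesis M_trans :
  is_transversal M (part_orbits (young ka) (pinterval pbot ka)) (pinterval pbot ka).

Let G := young ka.
Let orb (la : part n) : {set part n} := [set pact g la | g in G].

Let orb_self la : la \in orb la.
Proof. by apply/imsetP; exists 1%g; rewrite ?group1 // pact1. Qed.

Let mem_interval la : (la \in pinterval pbot ka) = refines la ka.
Proof. by rewrite in_set refines_bot. Qed.

Let orb_mem la : refines la ka -> orb la \in part_orbits G (pinterval pbot ka).
Proof. by move=> lk; apply: imset_f; rewrite mem_interval. Qed.

Let M_orb la : refines la ka -> exists mu, M :&: orb la = [set mu].
Proof.
by move=> lk; case/and3P: M_trans => _ _ /forall_inP/(_ _ (orb_mem lk))/cards1P.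
Qed.

Lemma orbit_transversal_sub : {in M, forall la, refines la ka}.
Proof.
by case/and3P: M_trans => _ /subsetP h _ la /h; rewrite mem_interval.
Qed.

Lemma orbit_transversal_ex la : refines la ka ->
  exists2 w, w \in young ka & pact w la \in M.
Proof.
move=> lk; have [mu e] := M_orb lk.
have /setIP[mM /imsetP[w wk mE]] : mu \in M :&: orb la by rewrite e set11.
by exists w; rewrite -?mE.
Qed.

Lemma orbit_transversal_uniq :
  {in M &, forall la mu w, w \in young ka -> pact w la = mu -> la = mu}.
Proof.
move=> la mu lM mM w wk e; have [z zE] := M_orb (orbit_transversal_sub lM).
have : la \in M :&: orb la by rewrite in_setI lM orb_self.
have : mu \in M :&: orb la by rewrite in_setI mM -e; apply/imsetP; exists w.
by rewrite zE => /set1P-> /set1P->.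
Qed.
End OrbitTransversal.

Section Summand.
Variables (F : numFieldType) (n : nat) (nu la : part n).
Implicit Types X Y : partring F n.

Lemma summand0 : summand nu la (0 : partring F n).
Proof. by move=> p _; rewrite ffunE. Qed.
Lemma summandB X Y : summand nu la X -> summand nu la Y -> summand nu la (X - Y).
Proof. by move=> sX sY p pn; rewrite !ffunE sX ?sY // subrr. Qed.
Lemma summandD X Y : summand nu la X -> summand nu la Y -> summand nu la (X + Y).
Proof. by move=> sX sY p pn; rewrite !ffunE sX ?sY // addr0. Qed.
Lemma summandMz X m : summand nu la X -> summand nu la (X *~ m).
Proof.
move=> sX; have sM k : summand nu la (X *+ k).
  elim: k => [|k IH]; first exact: summand0.
  by rewrite mulrS; apply: summandD.
case: m => k; first exact: sM.
by rewrite NegzE mulrNz -[- _]add0r; apply: summandB; [exact: summand0 | exact: sM].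
Qed.
End Summand.

Section Basis.
Variables (F : numFieldType) (n : nat) (nu la : part n).
Variables (W : {set 'S_n}) (M : 'S_n -> {set part n}).
Implicit Types (mu kap : part n) (w x g h k : 'S_n) (X : partring F n).
Local Notation one := (@pone F n).
Local Notation star := (@pstar F n).

Let ka w := pmeet nu (pact w la).

Hypothesis W_trans :
  is_transversal W (dcosets (young nu) [set: 'S_n] (young la)) [set: 'S_n].
Hypothesis M_trans : forall w, w \in W ->
  is_transversal (M w) (part_orbits (young (ka w)) (pinterval pbot (ka w)))
    (pinterval pbot (ka w)).

Lemma sum_dcoset x : (\sum_(w in W) (x \in dcoset (young nu) w (young la)) = 1)%N.
Proof.
have := transversal_dcoset (G := [group of [set: 'S_n]]) x (subsetT _) (subsetT _) W_trans.
by rewrite in_setT.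
Qed.

Lemma dcoset_rep x : exists2 w, w \in W &
  exists a b, [/\ a \in young nu, b \in young la & x = a *c w *c b].
Proof.
have [w /andP[wW xw]|no] := pickP (fun w => (w \in W) && (x \in dcoset (young nu) w (young la))).
  by exists w => //; case/imset2P: xw => a b an bl ->; exists a, b.
have := sum_dcoset x; rewrite big1 // => w wW.
by have := no w; rewrite wW /= => ->.
Qed.

Lemma dcoset_uniq w w' : w \in W -> w' \in W ->
  w \in dcoset (young nu) w' (young la) -> w = w'.
Proof.
move=> wW w'W ww'; apply/eqP; apply/negPn/negP => ne.
have := sum_dcoset w; rewrite (bigD1 w) //= (bigD1 w') /=; last by rewrite w'W eq_sym.
rewrite ww'; have -> : w \in dcoset (young nu) w (young la).
  by apply/imset2P; exists 1%g 1%g; rewrite ?group1 // p1comp pcomp1.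
by rewrite !add1n.
Qed.

(** The pairs [(g, w^-1 g^-1 w)] with [g] in [young (ka w)] are exactly those fixing [w], so the
    stalk at [w] becomes a representation of [young (ka w)]. *)
Definition stalk w g X := chi nu la w g (w^-1%g *c g^-1%g *c w) X.

Lemma young_kaP w g : g \in young (ka w) ->
  g \in young nu /\ w^-1%g *c g^-1%g *c w \in young la.
Proof.
by rewrite young_meet in_setI => /andP[-> gl]; rewrite -young_act groupV.
Qed.

Lemma stalk_class w X : {in young (ka w) &, forall k g,
  stalk w (k *c g *c k^-1%g) X = stalk w g X}.
Proof.
move=> k g kk gk; have [kn kl] := young_kaP kk.
rewrite /stalk; have wE : w = k *c w *c (w^-1%g *c k^-1%g *c w).
  by rewrite -!pcompA !pcompVK.
rewrite {1}wE chi_conj //; congr (chi _ _ _ _ _ _).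
  by rewrite -!pcompA pVcomp pcomp1 pcompK.
by rewrite !pinvM !invgK -!pcompA !pcompVK !pcompK.
Qed.

(** Conjugation moves any point to a representative of its double coset, and the character there is
    zero off the stabiliser. *)
Lemma stalk_eq0 X : summand nu la X ->
  (forall w, w \in W -> {in young (ka w), forall g, stalk w g X = 0}) -> X = 0.
Proof.
move=> sX X0; apply: chi_inj => nu' la' x g h; rewrite (raddf0 (chi _ _ _ _ _)).
have [/eqP|ne] := eqVneq (nu', la') (nu, la); last first.
  by rewrite /chi /entry (sX _ ne) (raddf0 (gchar _ _ _)).
rewrite xpair_eqE => /andP[/eqP-> /eqP->].
have [w wW [a [b [an bl ->]]]] := dcoset_rep x; rewrite chi_conj //.
move: (a^-1%g *c g *c a) (b *c h *c b^-1%g) => g' h'.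
case: (boolP ((g' \in young nu) && (h' \in young la))) => [/andP[gn hl]|]; last exact: chi_out.
case: (g' *c w *c h' =P w) => [e|/eqP]; last exact: chi_supp.
have hE : h' = w^-1%g *c g'^-1%g *c w.
  apply: (@pcompI _ w); apply: (@pcompI _ g').
  by rewrite [LHS]pcompA e -!pcompA !pcompVK.
rewrite hE -/(stalk w g' X) X0 // young_meet in_setI gn /= -groupV young_act.
by rewrite -hE.
Qed.

Definition basis_elt (p : 'S_n * part n) :=
  one nu p.2 * one p.2 (pact p.1 la) * star p.1.

(** At [w' = w] the factorisations counted by [nfactor] are the [y] counted by the induced character
    [ind]. At another representative there is none, as it would put both in one double coset. *)
Lemma stalk_basis w w' mu g : w \in W -> w' \in W -> refines mu (ka w') ->
  g \in young (ka w) ->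
  stalk w g (basis_elt (w', mu)) = if w' == w then ind F (ka w) mu g else 0.
Proof.
move=> wW w'W; rewrite refines_meet => /andP[mn ml] gk; have [gn gl] := young_kaP gk.
rewrite /stalk /basis_elt /= chi_mul_star chi_pone_mul /part_comparable ?mn ?ml ?orbT //.
rewrite /nfactor (largerl mn) (largerr ml); case: (w' =P w) => [ww|ww]; last first.
  rewrite [X in _ * (_ * X%:R)](_ : _ = 0%N) ?mulr0 //; apply/eqP; rewrite cards_eq0.
  apply/eqP/setP=> y; rewrite [LHS]in_set in_set0; apply/negP=> /and3P[yn yw _].
  case: ww; apply/esym/dcoset_uniq => //; apply/imset2P.
  exists y (w'^-1%g *c (y^-1%g *c (w *c w'^-1%g)) *c w'); rewrite // -?young_act //.
  by rewrite -!pcompA pVcomp pcomp1 !pcompVK.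
rewrite ww !eqxx gn /= pcompV.
have -> : w *c (w^-1%g *c g^-1%g *c w) *c w^-1%g = g^-1%g.
  by rewrite -!pcompA pcompV pcomp1 pcompVK.
rewrite pcomp1 pcompV eqxx groupV.
move: gk; rewrite young_meet in_setI => /andP[_ ->] /=; rewrite mul1r /ind.
congr (_ * _%:R); apply: eq_card => y; rewrite [LHS]in_set [RHS]in_set.
by rewrite young_meet in_setI pcomp1 groupV young_act andbA.
Qed.

Lemma basis_summand p : summand nu la (basis_elt p).
Proof.
case: p => w mu [nu' la'] ne; apply: gchar_inj => x g h.
rewrite (raddf0 (gchar x g h)) -/(entry _ nu' la') -/(chi nu' la' x g h _).
rewrite /basis_elt /= chi_mul_star chiM big1 // => kap _.
rewrite big1 ?mulr0 // => k _; rewrite big1 // => y _; rewrite /pone !chi_cst -natrM mulnb.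
move: ne; rewrite xpair_eqE (inj_eq (@pact_inj _ w)) negb_and => /orP[]/negPf->.
  by [].
by rewrite !andbF.
Qed.

(** By Frobenius reciprocity, the pairing of the stalk at [w] with the character induced from the
    sign of [young kap]. *)
Definition stalk_mult w kap X : F :=
  #|young kap|%:R^-1 * \sum_(g in young kap) sgn F g * stalk w g X.

Lemma stalk_multB w kap : {morph stalk_mult w kap : X Y / X - Y}.
Proof.
move=> X Y; rewrite /stalk_mult -mulrBr -sumrB; congr (_ * _).
by apply: eq_bigr => g _; rewrite /stalk chiB mulrBr.
Qed.
HB.instance Definition _ w kap :=
  GRing.isZmodMorphism.Build (partring F n) F (stalk_mult w kap) (@stalk_multB w kap).

Lemma stalk_mult_basis w w' mu kap : w \in W -> w' \in W -> refines mu (ka w') ->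
    refines kap (ka w) ->
  stalk_mult w kap (basis_elt (w', mu)) = if w' == w then sgn_mult F (ka w) mu kap else 0.
Proof.
move=> wW w'W mk kk; rewrite /stalk_mult; have /subsetP kS := youngS kk.
rewrite (eq_bigr (fun g => if w' == w then sgn F g * ind F (ka w) mu g else 0)) => [|g gk].
  by case: eqP => // _; rewrite big1 ?mulr0.
by rewrite stalk_basis ?kS //; case: eqP; rewrite ?mulr0.
Qed.

Lemma stalk_mult_int w kap X : refines kap (ka w) ->
  exists z : int, stalk_mult w kap X = z%:~R.
Proof.
by rewrite refines_meet => /andP[kn kl]; apply: (gchar_int (entry X nu la) kn kl).
Qed.

Lemma stalk_mult_act w kap X k : k \in young (ka w) -> refines kap (ka w) ->
  stalk_mult w (pact k kap) X = stalk_mult w kap X.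
Proof.
move=> kk ks; rewrite /stalk_mult card_young_act; congr (_ * _).
rewrite (reindex_inj (h := fun g => k *c g *c k^-1%g)) /=; last by move=> a b /pcompIr/pcompI.
apply: eq_big => g.
  by rewrite young_act -!pcompA pVcomp pcomp1 pcompK.
rewrite young_act -!pcompA pVcomp pcomp1 pcompK pcompA => gk.
rewrite stalk_class //; last exact: subsetP (youngS ks) _ gk.
by rewrite sgnJ.
Qed.

(** A basis element of [partring] realises the number as a multiplicity in a stalk, where
    integrality is known. *)
Lemma sgn_mult_int w mu kap : w \in W -> refines mu (ka w) -> refines kap (ka w) ->
  exists z : int, sgn_mult F (ka w) mu kap = z%:~R.
Proof.
move=> wW mk kk; have [z zE] := stalk_mult_int (basis_elt (w, mu)) kk.
by exists z; rewrite -zE stalk_mult_basis // eqxx.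
Qed.

(** The sign twist of the stalk character is again a class function, to which [classfun_sum0]
    applies. *)
Lemma stalk_mult_eq0 w X : w \in W ->
  (forall kap, refines kap (ka w) -> stalk_mult w kap X = 0) ->
  {in young (ka w), forall g, stalk w g X = 0}.
Proof.
move=> wW h g gk; pose f g := sgn F g * stalk w g X.
have f_class : {in young (ka w) &, forall k g, f (k *c g *c k^-1%g) = f g}.
  by move=> k g' kk g'k; rewrite /f stalk_class // sgnJ.
have : f g = 0.
  apply: (classfun_sum0 f_class) => // mu mk; have /eqP := h _ mk.
  by rewrite /stalk_mult mulf_eq0 invr_eq0 (negPf (card_young_neq0 _ _)) /= => /eqP.
by move/(congr1 ( *%R (sgn F g))); rewrite /f mulrA sgn2 mul1r mulr0.
Qed.

Let J := [set p : 'S_n * part n | (p.1 \in W) && (p.2 \in M p.1)].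

Let M_sub w : w \in W -> {in M w, forall mu, refines mu (ka w)}.
Proof. by move=> wW; apply: (orbit_transversal_sub (M_trans wW)). Qed.

Section Matrix.
Variable N : 'S_n -> part n -> part n -> int.
Hypothesis NE : forall w mu kap, w \in W -> refines mu (ka w) -> refines kap (ka w) ->
  sgn_mult F (ka w) mu kap = (N w mu kap)%:~R.

Lemma stalk_mult_sum w kap (c : 'S_n * part n -> int) : w \in W -> refines kap (ka w) ->
  stalk_mult w kap (\sum_(p in J) basis_elt p *~ c p) =
  (\sum_(mu in M w) N w mu kap * c (w, mu))%:~R.
Proof.
move=> wW kk; rewrite (raddf_sum (stalk_mult w kap)).
rewrite (eq_big (fun p => (p.1 \in W) && (p.2 \in M p.1))
  (fun p => stalk_mult w kap (basis_elt (p.1, p.2) *~ c (p.1, p.2)))) => [|p|[] //]; last first.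
  by rewrite in_set.
rewrite -(pair_big_dep (fun w => w \in W) (fun w mu => mu \in M w)
  (fun w' mu => stalk_mult w kap (basis_elt (w', mu) *~ c (w', mu)))) /=.
rewrite (bigD1 w) //= [X in _ + X]big1 ?addr0 => [|w' /andP[w'W ww']].
  rewrite rmorph_sum; apply: eq_bigr => mu mM /=.
  rewrite (raddfMz (stalk_mult w kap)) /= (stalk_mult_basis wW wW (M_sub wW mM) kk) eqxx.
  by rewrite (NE wW (M_sub wW mM) kk) intrM -mulrzr.
rewrite big1 // => mu mM; rewrite (raddfMz (stalk_mult w kap)) /=.
by rewrite (stalk_mult_basis wW w'W (M_sub w'W mM) kk) (negPf ww') mul0rz.
Qed.

Lemma N_neq0 w mu kap : w \in W -> refines mu (ka w) -> refines kap (ka w) ->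
  N w mu kap != 0 -> exists2 y, y \in young (ka w) & pmeet (pact y mu) kap = pbot.
Proof.
by move=> wW mk kk nz; apply: (@sgn_mult_neq0 F); rewrite (NE wW mk kk) intr_eq0.
Qed.

Lemma N_ferrers w mu kap : w \in W -> ferrers (ka w) mu kap -> N w mu kap = 1.
Proof.
move=> wW fe; case: (fe) => mk kk _ _; apply: (@intr_inj F).
by rewrite -NE // sgn_mult_ferrers.
Qed.

Lemma N_act w mu kap k : w \in W -> k \in young (ka w) -> refines mu (ka w) ->
  refines kap (ka w) -> N w mu (pact k kap) = N w mu kap.
Proof.
move=> wW kk mk ks; apply: (@intr_inj F); rewrite -!NE ?sgn_mult_act //.
by rewrite -(pact_young_id kk) refines_act.
Qed.

(** The integral system is solved separately at each representative [w], as a basis element has only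
    one nonzero stalk among these. The difference with [X] then has zero multiplicities at every
    stalk. *)
Lemma basis_span X : summand nu la X ->
  exists c : 'S_n * part n -> int, X = \sum_(p in J) basis_elt p *~ c p.
Proof.
move=> sX.
have /choice[c hc] w : exists c : part n -> int, w \in W -> forall kap, refines kap (ka w) ->
    stalk_mult w kap X = (\sum_(mu in M w) N w mu kap * c mu)%:~R.
  case: (boolP (w \in W)) => [wW|_]; last by exists (fun=> 0).
  have /choice[p hp] kap : exists z : int, refines kap (ka w) -> stalk_mult w kap X = z%:~R.
    case: (boolP (refines kap (ka w))) => [kk|_]; last by exists 0.
    by have [z] := stalk_mult_int X kk; exists z.
  have [|c hc] := young_solvable (M_sub wW) (orbit_transversal_ex (M_trans wW))
    (orbit_transversal_uniq (M_trans wW)) (fun mu kap k => N_act wW) (fun mu kap => N_neq0 wW)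
    (fun mu kap => N_ferrers wW) (p := p).
    move=> mu k kk mk; apply: (@intr_inj F); rewrite -!hp ?stalk_mult_act //.
    by rewrite -(pact_young_id kk) refines_act.
  by exists c => _ kap kk; rewrite hc ?hp.
exists (fun p => c p.1 p.2); apply/eqP; rewrite -subr_eq0; apply/eqP.
apply: stalk_eq0 => [|w wW].
  apply: summandB => //; apply: big_ind => [|Y Z|q _]; first exact: summand0.
    exact: summandD.
  exact/summandMz/basis_summand.
apply: stalk_mult_eq0 => // kap kk.
by rewrite stalk_multB hc // stalk_mult_sum // subrr.
Qed.

Lemma basis_free (c : 'S_n * part n -> int) :
  \sum_(p in J) basis_elt p *~ c p = 0 -> forall p, p \in J -> c p = 0.
Proof.
move=> c0 [w mu]; rewrite in_set /= => /andP[wW mM].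
have h kap : refines kap (ka w) -> \sum_(mu' in M w) N w mu' kap * c (w, mu') = 0.
  move=> kk; apply: (@intr_inj F); rewrite -stalk_mult_sum // c0.
  exact: (raddf0 (stalk_mult w kap)).
exact: (young_independent (M_sub wW) (orbit_transversal_uniq (M_trans wW))
  (fun mu kap => N_neq0 wW) (fun mu kap => N_ferrers wW) (c := fun mu => c (w, mu)) h mM).
Qed.
End Matrix.

Lemma basis_zbasis : zbasis (@summand F n nu la) J basis_elt.
Proof.
have [N NE] : exists N : 'S_n -> part n -> part n -> int, forall w mu kap,
    w \in W -> refines mu (ka w) -> refines kap (ka w) ->
    sgn_mult F (ka w) mu kap = (N w mu kap)%:~R.
  have /choice[N hN] (t : 'S_n * part n * part n) : exists z : int,
      [&& t.1.1 \in W, refines t.1.2 (ka t.1.1) & refines t.2 (ka t.1.1)] ->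
      sgn_mult F (ka t.1.1) t.1.2 t.2 = z%:~R.
    case: (boolP [&& _, _ & _]) => [/and3P[a b c]|_]; last by exists 0.
    by have [z] := sgn_mult_int a b c; exists z.
  exists (fun w mu kap => N (w, mu, kap)) => w mu kap a b c.
  by apply: (hN (w, mu, kap)); rewrite a b c.
split.
- by move=> p _; apply: basis_summand.
- exact: basis_span NE.
- exact: basis_free NE.
Qed.

End Basis.

(** * Normal forms *)

Section Transversals.
Variable n : nat.
Implicit Types (nu la ka mu : part n) (w : 'S_n).

Lemma imset_partition (T : finType) (D : {set T}) (cl : T -> {set T}) :
    {in D, forall x, x \in cl x} -> {in D, forall x, cl x \subset D} ->
    (forall x y, x \in D -> y \in cl x -> cl y = cl x) ->
  partition [set cl x | x in D] D.
Proof.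
move=> self sub eqcl; apply/and3P; split.
- apply/eqP/setP=> x; apply/bigcupP/idP => [[_ /imsetP[y yD ->]]|xD].
    exact: subsetP (sub _ yD) x.
  by exists (cl x); [apply: imset_f | apply: self].
- apply/trivIsetP=> _ _ /imsetP[x xD ->] /imsetP[y yD ->]; apply: contraR.
  rewrite -setI_eq0 => /set0Pn[z /setIP[zx zy]].
  by rewrite -(eqcl _ _ xD zx) (eqcl _ _ yD zy).
- by apply/imsetP=> -[x xD e]; have := self _ xD; rewrite -e in_set0.
Qed.

Lemma dcosets_partition nu la :
  partition (dcosets (young nu) [set: 'S_n] (young la)) [set: 'S_n].
Proof.
apply: imset_partition => [x _|x _|x y _].
- by apply/imset2P; exists 1%g 1%g; rewrite ?group1 // p1comp pcomp1.
- exact: subsetT.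
case/imset2P=> a b an bl ->; apply/setP=> z; apply/imset2P/imset2P => -[c d cn dl ->].
  by exists (c *c a) (b *c d); rewrite ?youngM // !pcompA.
exists (c *c a^-1%g) (b^-1%g *c d); rewrite ?youngM ?groupV //.
by rewrite -!pcompA !pcompVK pcompK.
Qed.

Lemma part_orbits_partition ka :
  partition (part_orbits (young ka) (pinterval pbot ka)) (pinterval pbot ka).
Proof.
apply: imset_partition => [mu _|mu|mu kap _].
- by apply/imsetP; exists 1%g; rewrite ?group1 // pact1.
- rewrite in_set refines_bot /= => mk; apply/subsetP=> _ /imsetP[g gk ->].
  by rewrite in_set refines_bot /= -(pact_young_id gk) refines_act.
case/imsetP=> g gk ->; apply/setP=> z; apply/imsetP/imsetP => -[h hk ->].
  by exists (h *c g); rewrite ?youngM // pactM.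
by exists (h *c g^-1%g); rewrite ?youngM ?groupV // -pactM -pcompA pVcomp pcomp1.
Qed.

Definition dcoset_reps nu la : {set 'S_n} :=
  transversal (dcosets (young nu) [set: 'S_n] (young la)) [set: 'S_n].
Definition part_reps ka : {set part n} :=
  transversal (part_orbits (young ka) (pinterval pbot ka)) (pinterval pbot ka).

Lemma dcoset_repsP nu la : is_transversal (dcoset_reps nu la)
  (dcosets (young nu) [set: 'S_n] (young la)) [set: 'S_n].
Proof. exact/transversalP/dcosets_partition. Qed.
Lemma part_repsP ka : is_transversal (part_reps ka)
  (part_orbits (young ka) (pinterval pbot ka)) (pinterval pbot ka).
Proof. exact/transversalP/part_orbits_partition. Qed.

End Transversals.

Section NormalForm.
Variables (n : nat) (A : pzRingType) (o : part n -> part n -> A) (s : 'S_n -> A).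
Variable Z : part n -> part n -> part n -> {set 'S_n}.
Hypothesis rel : relations eq o s Z.
Implicit Types (nu la mu ka kap : part n) (w z g a b : 'S_n).

Lemma rel_idl nu mu : part_comparable nu mu -> o nu nu * o nu mu = o nu mu.
Proof.
move=> c; apply: (rel_trans rel); rewrite refines_refl !andbT.
by rewrite orbC.
Qed.

Lemma rel_idr nu mu : part_comparable nu mu -> o nu mu * o mu mu = o nu mu.
Proof. by move=> c; apply: (rel_trans rel); rewrite refines_refl !andbT /= orbC. Qed.

(** The basis expression in any ring where the relations hold, for all [w] and [mu] and not just for
    chosen representatives. *)
Definition nf nu la w mu := o nu mu * o mu (pact w la) * s w.

Lemma comparable_meet nu la mu : refines mu (pmeet nu la) ->
  [/\ refines mu nu, refines mu la, part_comparable nu mu & part_comparable mu la].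
Proof.
by rewrite refines_meet /part_comparable => /andP[h1 h2]; rewrite h1 h2 orbT.
Qed.

Lemma star_nf z nu la w mu : refines mu (pmeet nu (pact w la)) ->
  s z * nf nu la w mu = nf (pact z nu) la (z *c w) (pact z mu).
Proof.
case/comparable_meet=> _ _ c1 c2; rewrite /nf !mulrA (rel_conj rel) 1?part_comparableC //.
rewrite -(mulrA _ (s z)) (rel_conj rel) 1?part_comparableC // -pactM mulrA.
by rewrite -(mulrA _ (s z)) (rel_starM rel).
Qed.

Lemma one_nf_orth kap nu' nu la w mu : part_comparable kap nu' ->
  refines mu (pmeet nu (pact w la)) -> nu' != nu -> o kap nu' * nf nu la w mu = 0.
Proof.
move=> c /comparable_meet[_ _ c1 _] ne; rewrite -(rel_idr c) /nf -(rel_idl c1) !mulrA.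
by rewrite -(mulrA (o kap nu')) (rel_orth rel) 1?eq_sym // mulr0 !mul0r.
Qed.

Lemma one_nf_up kap nu la w mu : refines nu kap ->
  refines mu (pmeet nu (pact w la)) -> o kap nu * nf nu la w mu = nf kap la w mu.
Proof.
move=> nk /comparable_meet[mn _ _ _]; rewrite /nf !mulrA (rel_trans rel) //.
by rewrite mn nk.
Qed.

(** The Mackey relation rewrites the two leftmost factors; each resulting star is moved to the right
    end, and the chain relation then fuses the middle factors. *)
Lemma one_nf_down kap nu la w mu : refines kap nu ->
  refines mu (pmeet nu (pact w la)) -> o kap nu * nf nu la w mu =
    \sum_(z in Z kap nu mu) nf kap la (z *c w) (pmeet kap (pact z mu)).
Proof.
move=> kn /comparable_meet[mn ml c1 c2].
rewrite /nf !mulrA (rel_mackey rel) // (rel_mackey' rel) // !mulr_suml.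
apply: eq_bigr => z _; rewrite -(mulrA _ (s z)) (rel_conj rel) 1?part_comparableC //.
rewrite mulrA -(mulrA _ (o _ (pact z mu))) (rel_trans rel); last first.
  by rewrite pmeet_r !refines_act ml orbT.
by rewrite -pactM -!mulrA (rel_starM rel).
Qed.

(** A factor [s g] can be inserted between the first two factors and absorbed by either one: on the
    left it turns [pact g mu] into [mu], on the right [mu] into [pact g mu]. *)
Lemma nf_orbit nu la w mu g : refines mu (pmeet nu (pact w la)) ->
  g \in young (pmeet nu (pact w la)) -> nf nu la w (pact g mu) = nf nu la w mu.
Proof.
case/comparable_meet=> mn ml c1 c2; rewrite young_meet in_setI => /andP[gn gl].
have e1 : o nu (pact g mu) * s g = o nu mu.
  by rewrite -{1}(pact_young_id gn) -(rel_conj rel) 1?part_comparableC // (rel_absl rel) 1?part_comparableC.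
have e2 : s g * o mu (pact w la) = o (pact g mu) (pact w la).
  rewrite (rel_conj rel) 1?part_comparableC // (pact_young_id gl) (rel_absr rel) //.
  by rewrite -{1}(pact_young_id gl) part_comparable_act part_comparableC.
by rewrite /nf -e1 -(mulrA _ (s g)) e2.
Qed.

Lemma nf_dcoset nu la w mu a b : refines mu (pmeet nu (pact w la)) ->
    a \in young nu -> b \in young la ->
  nf nu la (a *c w *c b) (pact a mu) = nf nu la w mu.
Proof.
move=> h an bl; have hb : pact (w *c b) la = pact w la by rewrite pactM (pact_young_id bl).
have h' : refines mu (pmeet nu (pact (w *c b) la)) by rewrite hb.
rewrite -pcompA -{1}(pact_young_id an) -star_nf // /nf hb !mulrA.
case/comparable_meet: h => mn ml c1 c2.
rewrite (rel_absl rel) 1?part_comparableC // -(rel_starM rel) -!mulrA; congr (_ * _).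
rewrite !mulrA; have -> : o mu (pact w la) = o (pact w (pact w^-1%g mu)) (pact w la).
  by rewrite pactVK.
have c3 : part_comparable la (pact w^-1%g mu).
  by rewrite -(part_comparable_act w) pactVK part_comparableC.
by rewrite -(rel_conj rel) // -mulrA (rel_absr rel).
Qed.

Local Notation index := (part n * part n * ('S_n * part n))%type.
Definition nf_index : {set index} := [set q | (q.2.1 \in dcoset_reps q.1.1 q.1.2) &&
  (q.2.2 \in part_reps (pmeet q.1.1 (pact q.2.1 q.1.2)))].

Definition nf_span (x : A) := exists c : index -> int,
  x = \sum_(q in nf_index) nf q.1.1 q.1.2 q.2.1 q.2.2 *~ c q.

Lemma nf_span0 : nf_span 0.
Proof. by exists (fun=> 0); rewrite big1 // => q _; rewrite mulr0z. Qed.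
Lemma nf_spanB x y : nf_span x -> nf_span y -> nf_span (x - y).
Proof.
move=> [c ->] [d ->]; exists (fun q => c q - d q); rewrite -sumrB.
by apply: eq_bigr => q _; rewrite mulrzBr.
Qed.
Lemma nf_spanD x y : nf_span x -> nf_span y -> nf_span (x + y).
Proof.
move=> sx sy; rewrite -[y]opprK -[- y]add0r; apply: nf_spanB => //.
exact/nf_spanB/sy/nf_span0.
Qed.
Lemma nf_spanMz x m : nf_span x -> nf_span (x *~ m).
Proof.
move=> [c ->]; exists (fun q => c q * m); rewrite mulrz_suml.
by apply: eq_bigr => q _; rewrite mulrzA.
Qed.
Lemma nf_span_sum (I : Type) (r : seq I) (P : pred I) (f : I -> A) :
  (forall i, P i -> nf_span (f i)) -> nf_span (\sum_(i <- r | P i) f i).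
Proof. by move=> h; apply: big_ind; [exact: nf_span0 | exact: nf_spanD | exact: h]. Qed.

(** First [w] is moved to its representative, which fixes the group acting on the interval, and only
    then [mu] within its orbit. *)
Lemma nf_spanP nu la w mu : refines mu (pmeet nu (pact w la)) -> nf_span (nf nu la w mu).
Proof.
move=> h; have [w0 w0W [a [b [an bl wE]]]] := dcoset_rep (dcoset_repsP nu la) w.
have h0 : refines (pact a^-1%g mu) (pmeet nu (pact w0 la)).
  have an' : a^-1%g \in young nu by rewrite groupV.
  move: h; rewrite -(refines_act a^-1%g) pact_meet wE (pact_young_id an').
  by rewrite -pactM -!pcompA pcompK pactM (pact_young_id bl).
have [g gk gM] := orbit_transversal_ex (part_repsP _) h0.
pose q : index := ((nu, la), (w0, pact g (pact a^-1%g mu))).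
have -> : nf nu la w mu = nf q.1.1 q.1.2 q.2.1 q.2.2.
  by rewrite /= nf_orbit // -(nf_dcoset h0 an bl) -wE pactVK.
have qJ : q \in nf_index by rewrite in_set /= w0W gM.
exists (fun q' => (q' == q)%:Z); rewrite (bigD1 q) //= eqxx mulr1z big1 ?addr0 //.
by move=> q' /andP[_ /negPf->]; rewrite mulr0z.
Qed.

Lemma one_span nu mu : part_comparable nu mu -> nf_span (o nu mu).
Proof.
move=> c; case/orP: (c) => h.
  suff -> : o nu mu = nf nu mu 1%g nu.
    by apply: nf_spanP; rewrite pact1 refines_meet refines_refl.
  by rewrite /nf pact1 rel_idl // (rel_absr rel) ?group1 // part_comparableC.
suff -> : o nu mu = nf nu mu 1%g mu.
  by apply: nf_spanP; rewrite pact1 refines_meet refines_refl h.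
by rewrite /nf pact1 rel_idr // (rel_absr rel) ?group1 // part_comparableC.
Qed.

Lemma star_span w : nf_span (s w).
Proof.
(* Inserting [s 1], the sum of the idempotents, splits [s w] into its components. *)
rewrite -[w]pcomp1 -(rel_starM rel) (rel_star1 rel) mulr_sumr.
apply: nf_span_sum => la _; rewrite (rel_conj rel) ?part_comparable_refl //.
suff -> : o (pact w la) (pact w la) * s w = nf (pact w la) la w (pact w la).
  by apply: nf_spanP; rewrite refines_meet refines_refl.
by rewrite /nf rel_idl // part_comparable_refl.
Qed.

Lemma nf_span_mul x y : (forall nu la w mu, refines mu (pmeet nu (pact w la)) ->
  nf_span (x * nf nu la w mu)) -> nf_span y -> nf_span (x * y).
Proof.
move=> h [c ->]; rewrite mulr_sumr; apply: nf_span_sum => -[[nu la] [w mu]].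
rewrite in_set /= => /andP[_ mM]; rewrite -mulrzr mulrA mulrzr.
exact/nf_spanMz/h/(orbit_transversal_sub (part_repsP _)).
Qed.

Lemma star_mul_span w y : nf_span y -> nf_span (s w * y).
Proof.
apply: nf_span_mul => nu la z mu h; rewrite star_nf //; apply: nf_spanP.
by rewrite pactM -pact_meet refines_act.
Qed.

Lemma one_mul_span nu mu y : part_comparable nu mu -> nf_span y -> nf_span (o nu mu * y).
Proof.
move=> c; apply: nf_span_mul => ka la w kap; have [<-|ne] := eqVneq mu ka => h; last first.
  by rewrite one_nf_orth //; apply: nf_span0.
case/orP: c => c; last first.
  rewrite one_nf_up //; apply: nf_spanP; move: h; rewrite !refines_meet => /andP[hk ->].
  by rewrite andbT (refines_trans hk).
rewrite one_nf_down //; apply: nf_span_sum => z _; apply: nf_spanP.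
rewrite refines_meet pmeet_l pactM (refines_trans (pmeet_r _ _)) // refines_act.
by move: h; rewrite refines_meet => /andP[].
Qed.

End NormalForm.

(** * Completeness of the relations *)

Section QuotientRing.
Local Open Scope quotient_scope.

(** Turns congruence modulo an ideal into equality in a ring, so that the normal form lemmas
    apply. *)
Lemma quotient_ring (A : pzRingType) (I : {pred A}) : two_sided_ideal I ->
  exists (B : pzRingType) (f : {rmorphism A -> B}), forall x, (f x == 0) = (x \in I).
Proof.
case=> Iz Im; pose zm := GRing.isZmodClosed.Build A I Iz.
pose J : zmodClosed A := HB.pack I zm.
pose Q := Quotient.quot J; pose p (x : A) : Q := \pi x.
have pE x y : p x = p y <-> x - y \in I.
  by split=> [/eqP|h]; [|apply/eqP]; rewrite /p -Quotient.idealrBE.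
have pB : {morph p : x y / x - y} by move=> x y; rewrite /p raddfB.
have pr x : p (generic_quotient.repr x) = x by rewrite /p reprK.
pose mul (x y : Q) : Q := p (generic_quotient.repr x * generic_quotient.repr y).
have ID x y : x \in I -> y \in I -> x + y \in I.
  have [I0 IB] := Iz => xI yI; rewrite -[y]opprK -[- y]add0r.
  exact: (IB _ _ xI (IB _ _ I0 yI)).
have pM : {morph p : x y / x * y >-> mul x y}.
  move=> x y; rewrite /mul; apply/pE.
  set x' := generic_quotient.repr (p x); set y' := generic_quotient.repr (p y).
  have -> : x * y - x' * y' = x * (y - y') + (x - x') * y'.
    by rewrite mulrBr mulrBl addrA subrK.
  apply: ID; [have [] := Im x (y - y') | have [] := Im y' (x - x')] => //.
    by apply/pE; rewrite pr.
  by apply/pE; rewrite pr.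
have pD : {morph p : x y / x + y} by move=> x y; rewrite /p raddfD.
have mulA : associative mul by move=> x y z; rewrite -[x]pr -[y]pr -[z]pr -!pM mulrA.
have mul1l : left_id (p 1) mul by move=> x; rewrite -[x]pr -pM mul1r.
have mul1r : right_id (p 1) mul by move=> x; rewrite -[x]pr -pM mulr1.
have mulDl : left_distributive mul +%R.
  by move=> x y z; rewrite -[x]pr -[y]pr -[z]pr -pD -!pM mulrDl pD.
have mulDr : right_distributive mul +%R.
  by move=> x y z; rewrite -[x]pr -[y]pr -[z]pr -pD -!pM mulrDr pD.
pose rm := GRing.Zmodule_isPzRing.Build Q mulA mul1l mul1r mulDl mulDr.
pose B : pzRingType := HB.pack Q rm.
pose fB := GRing.isZmodMorphism.Build A B p pB.
pose fM := GRing.isMonoidMorphism.Build A B p (conj erefl pM).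
pose f : {rmorphism A -> B} := HB.pack (p : A -> B) fB fM.
exists B, f => x; apply/eqP/idP => /= [h|xI].
  by rewrite -[x]subr0; apply/pE; rewrite h /p raddf0.
by transitivity (p 0); [apply/pE; rewrite subr0 | rewrite /p raddf0].
Qed.
End QuotientRing.

Section Completeness.
Variables (F : numFieldType) (n : nat).
Variable Z : part n -> part n -> part n -> {set 'S_n}.
Implicit Types (nu la mu ka : part n) (w : 'S_n) (X : partring F n).
Local Notation one := (@pone F n).
Local Notation star := (@pstar F n).

Lemma pair_sum (A B : zmodType) (I : Type) (r : seq I) (P : pred I) (f : I -> A) (g : I -> B) :
  \sum_(i <- r | P i) (f i, g i) = (\sum_(i <- r | P i) f i, \sum_(i <- r | P i) g i).
Proof. by elim/big_rec3: _ => // i x y z _ ->. Qed.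

Lemma pair_mulrz (A B : zmodType) (x : A) (y : B) (m : int) : (x, y) *~ m = (x *~ m, y *~ m).
Proof. by rewrite [LHS]surjective_pairing (raddfMz fst) (raddfMz snd). Qed.

Lemma relations_pair (A B : pzRingType) o s o' s' :
  @relations n A eq o s Z -> @relations n B eq o' s' Z ->
  @relations n (A * B)%type eq (fun nu mu => (o nu mu, o' nu mu)) (fun w => (s w, s' w)) Z.
Proof.
move=> [r1 r2 r3 r4 r5 r6 r7 r8 r9] [t1 t2 t3 t4 t5 t6 t7 t8 t9]; split.
- by move=> la mu nu c; congr pair; [apply: r1 | apply: t1].
- by move=> la mu c; congr pair; [apply: r2 | apply: t2].
- by move=> w z; congr pair; [apply: r3 | apply: t3].
- by rewrite pair_sum r4 t4.
- by move=> w mu nu c; congr pair; [apply: r5 | apply: t5].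
- by move=> w mu nu c wn; congr pair; [apply: r6 | apply: t6].
- by move=> w mu nu c wn; congr pair; [apply: r7 | apply: t7].
- by move=> la mu nu ln mn; rewrite pair_sum; congr pair; [apply: r8 | apply: t8].
- by move=> la mu nu ln mn; rewrite !pair_sum; congr pair; [apply: r9 | apply: t9].
Qed.

Lemma relations_quotient (A B : pzRingType) (I : {pred A}) (f : {rmorphism A -> B}) o s :
  (forall x, (f x == 0) = (x \in I)) ->
  @relations n A (fun x y => x - y \in I) o s Z ->
  @relations n B eq (fun nu mu => f (o nu mu)) (fun w => f (s w)) Z.
Proof.
move=> fI [r1 r2 r3 r4 r5 r6 r7 r8 r9].
have fE x y : x - y \in I -> f x = f y.
  by rewrite -fI rmorphB subr_eq0 => /eqP.
split.
- by move=> la mu nu c; rewrite -rmorphM; apply/fE/r1.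
- by move=> la mu c; rewrite -rmorphM -(rmorph0 f); apply/fE/r2.
- by move=> w z; rewrite -rmorphM; apply/fE/r3.
- by rewrite -rmorph_sum; apply/fE/r4.
- by move=> w mu nu c; rewrite -!rmorphM; apply/fE/r5.
- by move=> w mu nu c wn; rewrite -rmorphM; apply/fE/r6.
- by move=> w mu nu c wn; rewrite -rmorphM; apply/fE/r7.
- move=> la mu nu ln mn; rewrite -rmorphM (fE _ _ (r8 _ _ _ ln mn)) rmorph_sum.
  by apply: eq_bigr => z _; rewrite !rmorphM.
- move=> la mu nu ln mn; have := fE _ _ (r9 _ _ _ ln mn); rewrite !rmorph_sum.
  by under eq_bigr do rewrite !rmorphM; under [in RHS]eq_bigr do rewrite !rmorphM.
Qed.

Lemma chi_summand nu la nu' la' x g h X : summand nu la X -> (nu', la') != (nu, la) ->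
  chi nu' la' x g h X = 0.
Proof. by move=> sX ne; rewrite /chi /entry (sX _ ne) (raddf0 (gchar x g h)). Qed.

(** Normal forms with different [(nu, la)] lie in different summands, so the basis statement applies
    to each pair on its own. *)
Lemma nf_free (c : part n * part n * ('S_n * part n) -> int) :
  \sum_(q in nf_index n) nf one star q.1.1 q.1.2 q.2.1 q.2.2 *~ c q = 0 ->
  {in nf_index n, forall q, c q = 0}.
Proof.
pose J p := [set q : 'S_n * part n | (q.1 \in dcoset_reps p.1 p.2) &&
  (q.2 \in part_reps (pmeet p.1 (pact q.1 p.2)))].
pose X p := \sum_(q in J p) basis_elt F p.1 p.2 q *~ c (p, q).
have basis (p : part n * part n) := basis_zbasis F (dcoset_repsP p.1 p.2)
  (M := fun w => part_reps (pmeet p.1 (pact w p.2))) (fun w _ => part_repsP _).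
have sX p : summand p.1 p.2 (X p).
  apply: big_ind => [|x y|q _]; [exact: summand0 | exact: summandD |].
  exact/summandMz/basis_summand.
have -> : \sum_(q in nf_index n) nf one star q.1.1 q.1.2 q.2.1 q.2.2 *~ c q = \sum_p X p.
  rewrite pair_big_dep /=; apply: eq_big => [q|[p q] //].
  by rewrite [LHS]in_set [RHS]in_set.
move=> X0 [p q]; rewrite in_set /= => qJ.
have Xp : X p = 0.
  apply: chi_inj => nu la x g h; rewrite (raddf0 (chi _ _ _ _ _)).
  have [e|ne] := eqVneq (nu, la) (p.1, p.2); last exact: chi_summand (sX p) ne.
  have := chi_sum nu la x g h predT X; rewrite X0 (raddf0 (chi _ _ _ _ _)) => ->.
  rewrite (bigD1 p) //= big1 ?addr0 // => p' ne; apply: chi_summand (sX p') _.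
  by rewrite e -!surjective_pairing eq_sym.
have [_ _ free] := basis p.
by apply: (free (fun q => c (p, q)) Xp q); rewrite in_set.
Qed.

(** Words are built from the right by left multiplication with generators. The empty word is
    excluded because the relations do not express the unit of the free ring through the
    generators. *)
Lemma monomial_span (B : pzRingType) (f : {rmorphism {malg int[{fmonom gen n}]} -> B}) :
    relations eq one star Z ->
    @relations n B eq (fun nu mu => f (gen_one nu mu)) (fun w => f (gen_star w)) Z ->
  forall m : {fmonom gen n}, m != fmone (gen n) ->
  nf_span (fun nu mu => (f (gen_one nu mu), one nu mu)) (fun w => (f (gen_star w), star w))
    (f << m >>, \prod_(g <- m) gen_val F g).
Proof.
move=> relR relB; have rel := relations_pair relB relR.
set o := fun nu mu => _ in rel *; set s := fun w => _ in rel *.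
have gen1 (g : gen n) : (exists2 p, g = inl p & (f << fmu g >>, gen_val F g) = o (val p).1 (val p).2) \/
    (exists2 w, g = inr w & (f << fmu g >>, gen_val F g) = s w).
  case: g => [p|w]; [left | right]; last by exists w.
  by exists p => //; rewrite /o /gen_one -surjective_pairing valK.
have gen_span (g : gen n) : nf_span o s (f << fmu g >>, gen_val F g).
  case: (gen1 g) => -[p _ ->]; last exact: star_span rel _.
  by apply: one_span rel _ _ _; apply: (valP p).
have gen_mul (g : gen n) y : nf_span o s y -> nf_span o s ((f << fmu g >>, gen_val F g) * y).
  case: (gen1 g) => -[p _ ->]; last exact: star_mul_span rel _ _.
  by apply: one_mul_span rel _ _ _ _; apply: (valP p).
move=> [l]; elim: l => [|g l IH]; first by rewrite fmoneE eqxx.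
case: l IH => [_ _|h l IH _]; first by rewrite -fmuE fmU big_seq1.
have -> : << FMonom [:: g, h & l] >> = << fmu g >> * << FMonom (h :: l) >> :> {malg int[{fmonom gen n}]}.
  rewrite malgM_def fgmulUU mulr1; congr (<< _ >>); apply: val_inj.
  by rewrite /= fmM fmU.
rewrite rmorphM big_cons; apply: (gen_mul g (_, _)); apply: IH.
by rewrite fmoneE.
Qed.

Lemma relations_complete : relations eq one star Z -> complete_relations F Z.
Proof.
move=> relR p p1 p0 I idI relI; have [B [f fI]] := quotient_ring idI.
have relB := relations_quotient fI relI.
pose o nu mu := (f (gen_one nu mu), one nu mu); pose s w := (f (gen_star w), star w).
(* The second component is [free_eval p], which is zero by assumption. *)
have [c hc] : nf_span o s (f p, 0).
  have -> : (f p, 0) = \sum_(m <- msupp p)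
      (f << m >>, \prod_(g <- (m : seq _)) gen_val F g : partring F n) *~ p@_m.
    have e1 : f p = \sum_(m <- msupp p) f << m >> *~ p@_m.
      rewrite [in LHS](monalgE p) rmorph_sum; apply: eq_bigr => m _.
      have -> : << p@_m *g m >> = << m >> *~ p@_m :> {malg int[{fmonom gen n}]}.
        by rewrite -[in LHS](intz p@_m) (raddfMz (mkmalgU m)).
      by rewrite rmorphMz.
    rewrite -{1}p0 e1 /free_eval /zlift.
    by rewrite -pair_sum; apply: eq_bigr => m _; rewrite pair_mulrz.
  rewrite big_seq; apply: nf_span_sum => m mp; apply: nf_spanMz.
  apply: monomial_span => //; apply: contraTneq mp => ->.
  by rewrite -mcoeff_eq0 p1.
have c0 : {in nf_index n, forall q, c q = 0}.
  apply: nf_free; have /= e := congr1 snd hc; rewrite [RHS]e (raddf_sum snd).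
  by apply: eq_bigr => q _; rewrite (raddfMz snd).
rewrite -fI; have /(congr1 fst) /= -> := hc; rewrite big1 // => q qJ.
by rewrite c0 // mulr0z.
Qed.

End Completeness.

(** * Generation *)

Section Generation.
Variables (F : numFieldType) (n : nat) (S : {pred partring F n}).
Hypotheses (S_zmod : GRing.zmod_closed S) (S_mul : GRing.mulr_2closed S).
Hypothesis S_one : forall la mu, part_comparable la mu -> pone F la mu \in S.
Hypothesis S_star : forall w, pstar F w \in S.

Let S0 : 0 \in S. Proof. by case: S_zmod. Qed.
Let SB x y : x \in S -> y \in S -> x - y \in S. Proof. by case: S_zmod => _; apply. Qed.
Let SD x y : x \in S -> y \in S -> x + y \in S.
Proof. by move=> xS yS; rewrite -[y]opprK -[- y]add0r; apply/SB/SB. Qed.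
Let SM x (m : int) : x \in S -> x *~ m \in S.
Proof.
move=> xS; have Sn k : x *+ k \in S by elim: k => // k IH; rewrite mulrS SD.
case: m => k; first exact: Sn.
by rewrite NegzE mulrNz -[- _]add0r SB // Sn.
Qed.

Lemma pone_pstar_generate x : x \in S.
Proof.
pose comp (p : part n * part n) : partring F n := [ffun q => if q == p then x q else 0].
have -> : x = \sum_p comp p.
  apply: chi_inj => nu la y g h; rewrite chi_sum (bigD1 (nu, la)) //= big1 ?addr0.
    by rewrite /chi /entry ffunE eqxx.
  move=> p ne; rewrite /chi /entry ffunE eq_sym (negPf ne).
  exact: (raddf0 (gchar y g h)).
apply: (big_ind (fun x => x \in S)) => // -[nu la] _.
have [_ span _] := basis_zbasis F (dcoset_repsP nu la)
  (M := fun w => part_reps (pmeet nu (pact w la))) (fun w _ => part_repsP _).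
have [|c ->] := span (comp (nu, la)); first by move=> p ne; rewrite ffunE (negPf ne).
apply: (big_ind (fun x => x \in S)) => // -[w mu].
rewrite in_set /= => /andP[_ /(orbit_transversal_sub (part_repsP _))].
case/comparable_meet=> _ _ c1 c2; apply: SM; apply: S_mul => //.
by apply: S_mul; apply: S_one.
Qed.
End Generation.

Theorem theorem2p4 (R : realType) (n : nat) :
  (* generators *)
  (forall S : {pred partring R[i] n},
      GRing.zmod_closed S -> GRing.mulr_2closed S ->
      (forall la mu, part_comparable la mu -> pone R[i] la mu \in S) ->
      (forall w, pstar R[i] w \in S) ->
      forall x, x \in S) /\
  (* basis *)
  (forall (nu la : part n) (W : {set 'S_n}) (M : 'S_n -> {set part n}),
      is_transversal W (dcosets (young nu) [set: 'S_n] (young la)) [set: 'S_n] ->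
      (forall w, w \in W ->
         let ka := pmeet nu (pact w la) in
         is_transversal (M w) (part_orbits (young ka) (pinterval pbot ka))
           (pinterval pbot ka)) ->
      zbasis (@summand R[i] n nu la)
        [set p : 'S_n * part n | (p.1 \in W) && (p.2 \in M p.1)]
        (fun p => pone R[i] nu p.2 * pone R[i] p.2 (pact p.1 la) * pstar R[i] p.1)) /\
  (* relations *)
  (forall Z : part n -> part n -> part n -> {set 'S_n},
      (forall la mu nu, refines la nu -> refines mu nu ->
         is_transversal (Z mu nu la) (dcosets (young mu) (young nu) (young la))
           (young nu)) ->
      relations eq (@pone R[i] n) (@pstar R[i] n) Z /\
      complete_relations R[i] Z).
Proof.
split; first exact: pone_pstar_generate.
split; first by move=> nu la W M; apply: basis_zbasis.
move=> Z HZ; have rel := pone_relations R[i] HZ.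
by split=> //; apply: relations_complete.
Qed.
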